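(* Let $G$ be a second-countable locally compact group, $A$ a unital separable $C^*$-algebra, $(A,G,\alpha)$ a $C^*$-dynamical system, and $(\theta,\mathcal H_\theta)$ a faithful representation of $A$ on a separable Hilbert space. Then the space of Herz--Schur $\theta$-multipliers of $(A,G,\alpha)$, with norm $F\mapsto\|S_F^\theta\|_{\mathrm{cb}}$, coincides isometrically with the space $\mathrm{M}^{\mathrm{cb}}\mathcal A^\theta(A,G,\alpha)$ of completely bounded multipliers of the Fourier space $\mathcal A^\theta(A,G,\alpha)$, with norm $\|\cdot\|_{\mathrm{M}^{\mathrm{cb}}}$.
   Context: A $C^*$-dynamical system $(A,G,\alpha)$ is a $C^*$-algebra $A$, a locally compact group $G$ (with left Haar measure $ds$), and a group homomorphism $\alpha:G\to\mathrm{Aut}(A)$ such that $s\mapsto\alpha_s(a)$ is norm-continuous for every $a\in A$. On $L^2(G,\mathcal H_\theta)$ define $(\pi^\theta(a)\xi)(s)=\theta(\alpha_{s^{-1}}(a))(\xi(s))$ and $(\lambda^\theta_t\xi)(s)=\xi(t^{-1}s)$ for $a\in A$, $s,t\in G$. For $f\in L^1(G,A)$ let $(\pi^\theta\rtimes\lambda^\theta)(f)=\int_G\pi^\theta(f(s))\lambda^\theta_s\,ds$. Let $A\rtimes_{\alpha,\theta}G$ be the operator-norm closure of $(\pi^\theta\rtimes\lambda^\theta)(L^1(G,A))$ in $\mathcal B(L^2(G,\mathcal H_\theta))$, and $A\rtimes^{w^*}_{\alpha,\theta}G$ its weak* closure, which is identified with the bicommutant $(A\rtimes_{\alpha,\theta}G)''$;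 it contains all $\pi^\theta(a)\lambda^\theta_t$. $\mathcal B(A)$, $\mathcal{CB}(A)$ denote the bounded, respectively completely bounded, linear maps on $A$. Herz--Schur $\theta$-multiplier: a bounded function $F:G\to\mathcal{CB}(A)$ such that the map $\pi^\theta(a)\lambda^\theta_t\mapsto\pi^\theta(F(t)(a))\lambda^\theta_t$ ($a\in A$, $t\in G$) has an extension to a completely bounded weak*-continuous map $S_F^\theta$ on $A\rtimes^{w^*}_{\alpha,\theta}G$. Fourier space: consider the functionals $\tilde u(T)=\sum_{n\in\mathbb N}\langle T\xi_n,\eta_n\rangle$ with $\xi_n,\eta_n\in L^2(G,\mathcal H_\theta)$, $\sum_n\|\xi_n\|^2<\infty$, $\sum_n\|\eta_n\|^2<\infty$; these form the predual of $A\rtimes^{w^*}_{\alpha,\theta}G$. To each associate $u:G\to A^*$, $u(t)(a):=\tilde u(\pi^\theta(a)\lambda^\theta_t)$. The Fourier space $\mathcal A^\theta(A,G,\alpha)$ is the linear space of all such functions $u$, with norm $\|u\|_{\mathcal A}:=\|\tilde u\|$ (norm as a functional on $A\rtimes^{w^*}_{\alpha,\theta}G$), so it is identified with the predual of $A\rtimes^{w^*}_{\alpha,\theta}G$ and its dual with $A\rtimes^{w^*}_{\alpha,\theta}G$. Multipliers: a bounded function $F:G\to\mathcal B(A)$ is a multiplier of $\mathcal A^\theta(A,G,\alpha)$ if there is a bounded map $s_F:\mathcal A^\theta(A,G,\alpha)\to\mathcal A^\theta(A,G,\alpha)$ with $(s_Fu)(t)(a)=u(t)(F(t)(a))$ for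 all $u$, $t\in G$, $a\in A$. If moreover $F$ takes values in $\mathcal{CB}(A)$ and $s_F^*$ is completely bounded on $A\rtimes^{w^*}_{\alpha,\theta}G$, then $F$ is a completely bounded multiplier, with $\|F\|_{\mathrm{M}^{\mathrm{cb}}}:=\|s_F^*\|_{\mathrm{cb}}$. *)

(* Defs.v *)
From HB Require Import structures.
From mathcomp Require Import all_boot all_order all_algebra.
From mathcomp Require Import all_classical all_reals all_analysis.
From mathcomp Require Import measurable_realfun complex ring generic_quotient.
From mathcomp Require Import ring_quotient.

Set Implicit Arguments.
Unset Strict Implicit.
Unset Printing Implicit Defensive.
Import Order.TTheory GRing.Theory Num.Theory.
Import numFieldNormedType.Exports.

Local Open Scope classical_set_scope.
Local Open Scope ring_scope.

Definition separable (T : topologicalType) : Prop :=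
  exists2 D : set T, countable D & dense D.

HB.mixin Record isTopologicalGroup G of Group G & PointedTopological G := {
  mulg_continuous : continuous (fun p : G * G => (p.1 * p.2)%g) ;
  invg_continuous : continuous (fun x : G => (x^-1)%g)
}.

#[short(type="topologicalGroupType")]
HB.structure Definition TopologicalGroup :=
  {G of isTopologicalGroup G & Group G & PointedTopological G}.

(* Unital C*-algebras. *)
HB.mixin Record isCstarAlgebra (R : realType) A
    of CompleteNormedModule R[i] A := {
  cmul : A -> A -> A ;
  cone : A ;
  cstar : A -> A ;
  cmulA : associative cmul ;
  cmul1l : left_id cone cmul ;
  cmul1r : right_id cone cmul ;
  cmul_linearl : forall b, linear (cmul ^~ b) ;
  cmul_linearr : forall a, linear (cmul a) ;
  cstarK : involutive cstar ;
  cstar_antilinear : forall (k : R[i]) a b,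
    cstar (k *: a + b) = k^* *: cstar a + cstar b ;
  cstarM : forall a b, cstar (cmul a b) = cmul (cstar b) (cstar a) ;
  cmul_norm : forall a b, `|cmul a b| <= `|a| * `|b| ;
  cstar_identity : forall a, `|cmul (cstar a) a| = `|a| ^+ 2
}.

#[short(type="cstarAlgType")]
HB.structure Definition CstarAlgebra (R : realType) :=
  {A of isCstarAlgebra R A & CompleteNormedModule R[i] A}.

HB.mixin Record isHilbert (R : realType) H of CompleteNormedModule R[i] H := {
  inner : H -> H -> R[i] ;
  inner_linearl : forall y (k : R[i]) x x',
    inner (k *: x + x') y = k * inner x y + inner x' y ;
  inner_conj : forall x y, inner x y = (inner y x)^* ;
  inner_norm : forall x, inner x x = `|x| ^+ 2
}.

#[short(type="hilbertType")]
HB.structure Definition Hilbert (R : realType) :=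
  {H of isHilbert R H & CompleteNormedModule R[i] H}.

HB.mixin Record isSeparable T of Topological T := {
  separable_subproof : separable T
}.

#[short(type="separableHilbertType")]
HB.structure Definition SeparableHilbert (R : realType) :=
  {H of isSeparable H & Hilbert R H}.

Notation borel G := (g_sigma_algebraType (@open G)).

(* For separable [E] this is strong (Bochner) measurability. *)
Definition borel_fun (G : ptopologicalType) (E : topologicalType)
    (f : G -> E) : Prop :=
  forall U : set E, open U -> measurable (f @^-1` U : set (borel G)).

(* Norms of [normedModType R[i]] are nonnegative elements of [R[i]]. *)
Definition rnorm (R : realType) (V : normedModType R[i]) (x : V) : R :=
  complex.Re `|x|.

Section real_norm.
Context (R : realType) (V : normedModType R[i]).
Implicit Types (x y : V).

Lemma rnormE x : `|x| = (rnorm x)%:C%C.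
Proof.
rewrite /rnorm; have := normr_ge0 x; case: `|x| => a b.
by rewrite lecE /= => /andP[/eqP -> _].
Qed.

Lemma rnorm_ge0 x : 0 <= rnorm x.
Proof. by have := normr_ge0 x; rewrite rnormE lecR. Qed.

Lemma rnormD x y : rnorm (x + y) <= rnorm x + rnorm y.
Proof.
have := ler_normD x y; rewrite !rnormE.
by rewrite -rmorphD /= lecR.
Qed.

Lemma rnormZ (k : R[i]) x : rnorm (k *: x) = complex.Re `|k| * rnorm x.
Proof.
rewrite {1}/rnorm normrZ (rnormE x) mulrC.
by case: `|k| => a b /=; rewrite mul0r subr0 mulrC.
Qed.

Lemma rnorm0 : rnorm (0 : V) = 0.
Proof. by rewrite /rnorm normr0. Qed.

Lemma ball_rnormP (x y : V) (e : R) :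
  ball x e%:C%C y <-> rnorm (x - y) < e.
Proof. by rewrite -ball_normE /ball_ /= rnormE ltcR. Qed.

Lemma open_rnormP (U : set V) : open U <->
  forall x, U x -> exists2 e : R, 0 < e & forall y, rnorm (x - y) < e -> U y.
Proof.
split=> [oU x Ux|H].
  have /nbhs_ballP[e e0 eU] : nbhs x U by exact: open_nbhs_nbhs.
  have {}e0 : 0 < e := e0.
  have eE : e = (complex.Re e)%:C%C.
    by move: e0; case: (e) {eU} => a b; rewrite ltcE /= => /andP[/eqP -> _].
  exists (complex.Re e); first by rewrite -(ltcR 0) -eE.
  by move=> y /ball_rnormP; rewrite -eE; exact: eU.
rewrite openE => x /H[e e0 eU]; apply/nbhs_ballP.
exists e%:C%C; first by rewrite /= ltcR.
by move=> y /ball_rnormP; exact: eU.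
Qed.

Lemma open_rnorm_gt (a : R) : open [set x : V | a < rnorm x].
Proof.
apply/open_rnormP => x /= ax; exists (rnorm x - a); first by rewrite subr_gt0.
move=> y; rewrite ltrBrDl -ltrBrDr => h; apply: (lt_le_trans h).
by rewrite lerBlDr -{1}(subrK y x) addrC rnormD.
Qed.
End real_norm.

Section borel_fun_lemmas.
Context (R : realType) (G : ptopologicalType) (V : normedModType R[i]).
Implicit Types (f g : G -> V).

Lemma borel_rnorm f : borel_fun f ->
  measurable_fun [set: borel G] (fun s => rnorm (f s)).
Proof.
move=> mf mD; apply: (measurability _ (RGenOInfty.measurableE R)) => //.
move=> _ [_ [a ->]] <-; rewrite setTI.
have -> : (fun s => rnorm (f s)) @^-1` `]a, +oo[%classic =
    f @^-1` [set x | a < rnorm x].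
  by apply/seteqP; split => x /=; rewrite in_itv /= andbT.
by apply: mf; exact: open_rnorm_gt.
Qed.

Lemma borel_comp (phi : V -> V) f :
  continuous phi -> borel_fun f -> borel_fun (phi \o f).
Proof.
move=> /continuousP cphi mf U oU; rewrite comp_preimage.
by apply: mf; exact: cphi.
Qed.

Lemma open_rnorm_ball (x : V) (r : R) : open [set y | rnorm (x - y) < r].
Proof.
apply/open_rnormP => y /= xy; exists (r - rnorm (x - y)).
  by rewrite subr_gt0.
move=> z; rewrite ltrBrDl => h; apply: le_lt_trans h.
by apply: le_trans (rnormD _ _); rewrite addrA subrK.
Qed.

Lemma borelD f g : separable V -> borel_fun f -> borel_fun g ->
  borel_fun (f \+ g).
Proof.
move=> [D cD dD] mf mg U oU.
have [d dP] : exists d : nat -> V, D `<=` range d.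
  move: cD => /pfcard_geP [->|[h]]; first by exists (fun=> 0).
  by exists h => x /(@surj _ _ _ _ h)[n _ <-]; exists n.
pose r n : R := n.+1%:R^-1.
pose P i j n := forall x y, rnorm (d i - x) < r n -> rnorm (d j - y) < r n ->
  U (x + y).
pose F i j n : set (borel G) := if `[< P i j n >] then
  f @^-1` [set x | rnorm (d i - x) < r n] `&`
  g @^-1` [set x | rnorm (d j - x) < r n] else set0.
have mF i j n : measurable (F i j n).
  rewrite /F; case: ifP => _; last exact: measurable0.
  by apply: measurableI; [apply: mf|apply: mg]; exact: open_rnorm_ball.
suff -> : (f \+ g) @^-1` U = \bigcup_i \bigcup_j \bigcup_n F i j n.
  by do 3 (apply: bigcupT_measurable => ?); exact: mF.
apply/seteqP; split=> [s /= Us|s [i _ [j _ [n _]]]]; last first.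
  rewrite /F; case: ifPn => // /asboolP Pijn [/= fs gs].
  exact: Pijn.
have /open_rnormP/(_ _ Us)[e e0 eU] := oU.
have [n ne] : exists n, r n < e / 4%:R.
  have e4 : 0 < e / 4%:R by rewrite divr_gt0 ?ltr0n.
  have [n] := ltr_add_invr e4.
  by rewrite add0r => ?; exists n.
have rn0 : 0 < r n by rewrite invr_gt0 ltr0n.
have near v : exists i, rnorm (d i - v) < r n.
  have [|x [/= vx Dx]] := dD [set y | rnorm (v - y) < r n] _ (open_rnorm_ball _ _).
    by exists v; rewrite /= subrr rnorm0.
  have [i _ iE] := dP _ Dx; exists i.
  by rewrite iE /rnorm distrC.
have [i fi] := near (f s); have [j gj] := near (g s).
exists i => //; exists j => //; exists n => //.
rewrite /F; case: ifPn => // /asboolP; case=> x y xi yj; apply: eU.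
have -> : f s + g s - (x + y) =
    ((f s - d i) + (d i - x)) + ((g s - d j) + (d j - y)).
  by rewrite (addrA (f s - d i)) subrK (addrA (g s - d j)) subrK opprD addrACA.
apply: le_lt_trans (rnormD _ _) _.
have h u v w : rnorm (d w - u) < r n -> rnorm (d w - v) < r n ->
    rnorm (u - d w + (d w - v)) < e / 2%:R.
  move=> hu hv; apply: le_lt_trans (rnormD _ _) _.
  have -> : e / 2%:R = e / 4%:R + e / 4%:R by field.
  apply: ltrD; last exact: lt_trans ne.
  by rewrite {1}/rnorm distrC; exact: lt_trans ne.
have -> : e = e / 2%:R + e / 2%:R by field.
by apply: ltrD; exact: h.
Qed.
End borel_fun_lemmas.

Section L2_space.
Context (R : realType) (G : ptopologicalType).
Variables (mu : {measure set (borel G) -> \bar R}) (H : separableHilbertType R).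

Definition square_integrable (f : G -> H) : Prop :=
  borel_fun f /\ (\int[mu]_s ((rnorm (f s)) ^+ 2)%:E < +oo)%E.

Definition sqint : {pred (G -> H)} := [pred f | `[< square_integrable f >]].

Lemma sqint_submod : submod_closed sqint.
Proof.
pose nsq (f : G -> H) : borel G -> \bar R := fun s => ((rnorm (f s)) ^+ 2)%:E.
have mfun2 (f : G -> H) : borel_fun f -> measurable_fun setT (nsq f).
  move=> /borel_rnorm mf; apply/measurable_EFinP.
  exact: measurable_funX.
split=> [|k f g].
  apply/asboolP; split.
    move=> U oU; have [U0|U0] := pselect (U 0).
      rewrite (_ : _ @^-1` _ = setT); first exact: measurableT.
      by apply/seteqP; split.
    rewrite (_ : _ @^-1` _ = set0); first exact: measurable0.
    by apply/seteqP; split.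
  under eq_integral do rewrite rnorm0 expr0n /=.
  by rewrite integral0 ltry.
move=> /asboolP[mf fi] /asboolP[mg gi]; apply/asboolP.
have mkf : borel_fun (k *: f).
  by apply: (borel_comp (phi := fun x => k *: x)) mf; exact: scaler_continuous.
split; first exact: (borelD separable_subproof mkf mg).
pose c : R := 2 * (complex.Re `|k|) ^+ 2.
have c0 : 0 <= c by rewrite mulr_ge0 // sqr_ge0.
apply: (@le_lt_trans _ _ (\int[mu]_s (c%:E * ((rnorm (f s)) ^+ 2)%:E +
    2%:E * ((rnorm (g s)) ^+ 2)%:E))%E).
  apply: ge0_le_integral => //.
  - by move=> s _; rewrite lee_fin sqr_ge0.
  - apply: (mfun2 (k *: f + g)); exact: (borelD separable_subproof mkf mg).
  - by apply: emeasurable_funD; apply: emeasurable_funM;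
      [exact: measurable_cst|exact: mfun2|exact: measurable_cst|exact: mfun2].
  - move=> s _; rewrite -!EFinM -EFinD lee_fin.
    have := rnormD (k *: f s) (g s); rewrite rnormZ /c => h.
    have h2 := rnorm_ge0 (k *: f s + g s).
    set a := complex.Re _ in h *; set x := rnorm (f s) in h *.
    set y := rnorm (g s) in h *; set z := rnorm _ in h h2 *.
    apply: (@le_trans _ _ ((a * x + y) ^+ 2)).
      by rewrite ler_pXn2r // nnegrE; exact: le_trans h.
    have := sqr_ge0 (a * x - y); rewrite sqrrB sqrrD -subr_ge0.
    move=> {}h2; rewrite -subr_ge0; apply: le_trans h2 _; rewrite subr0.
    by rewrite le_eqVlt; apply/orP; left; apply/eqP; ring.
rewrite ge0_integralD //; last first.
- by apply: emeasurable_funM; [exact: measurable_cst|exact: mfun2].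
- by move=> s _; rewrite -EFinM lee_fin mulr_ge0 ?sqr_ge0.
- by apply: emeasurable_funM; [exact: measurable_cst|exact: mfun2].
- by move=> s _; rewrite -EFinM lee_fin mulr_ge0 ?sqr_ge0.
rewrite !ge0_integralZl_EFin //; do ?[exact: mfun2|by move=> *; rewrite lee_fin sqr_ge0].
by apply: lte_add_pinfty; apply: lte_mul_pinfty => //; rewrite lee_fin.
Qed.

HB.instance Definition _ := GRing.isSubmodClosed.Build _ _ sqint sqint_submod.

Definition sqfun := {f : G -> H | f \in sqint}.
HB.instance Definition _ := SubChoice.on sqfun.
HB.instance Definition _ := [SubChoice_isSubLmodule of sqfun by <:].

Definition null_sqfun : {pred sqfun} :=
  [pred f | `[< {ae mu, forall s, \val f s = 0} >]].

Lemma null_sqfun_submod : submod_closed null_sqfun.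
Proof.
split; first by apply/asboolP; exact: aeW.
move=> k f g /asboolP f0 /asboolP g0; apply/asboolP.
apply: filterS2 f0 g0 => s /= f0 g0.
rewrite -[LHS]/(k *: sval f s + sval g s).
by rewrite f0 g0 scaler0 addr0.
Qed.

HB.instance Definition _ :=
  GRing.isSubmodClosed.Build _ _ null_sqfun null_sqfun_submod.

Definition L2 : Type := Quotient.quot null_sqfun.
HB.instance Definition _ := GRing.Zmodule.on L2.

Local Open Scope quotient_scope.

Definition L2_scale (k : R[i]) (x : L2) : L2 :=
  \pi_(Quotient.quot null_sqfun) (k *: repr (x : (Quotient.quot null_sqfun))).

Let L2_scale_pi k (f : sqfun) : L2_scale k (\pi_(Quotient.quot null_sqfun) f) =
  \pi_(Quotient.quot null_sqfun) (k *: f).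
Proof.
apply/eqP; rewrite -Quotient.idealrBE -scalerBr rpredZ //.
by rewrite Quotient.idealrBE reprK.
Qed.

Let L2_scaleA a b (x : L2) : L2_scale a (L2_scale b x) = L2_scale (a * b) x.
Proof. by rewrite [X in L2_scale a X]/L2_scale L2_scale_pi scalerA. Qed.

Let L2_scale1 : left_id 1 L2_scale.
Proof. by move=> x; rewrite /L2_scale scale1r reprK. Qed.

Let L2_scaleDr : right_distributive L2_scale +%R.
Proof.
move=> k x y; rewrite -[x]reprK -[y]reprK -raddfD !L2_scale_pi.
by rewrite scalerDr raddfD.
Qed.

Let L2_scaleDl (x : L2) : {morph L2_scale^~ x : a b / a + b}.
Proof. by move=> a b; rewrite /L2_scale scalerDl raddfD. Qed.

HB.instance Definition _ := GRing.Zmodule_isLmodule.Build R[i] L2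
  L2_scaleA L2_scale1 L2_scaleDr L2_scaleDl.

(* The class of [f], with junk value [0] when [f] is not square integrable. *)
Definition L2_class (f : G -> H) : L2 :=
  \pi_(Quotient.quot null_sqfun) (insubd (0 : sqfun) f).

Definition L2_fun (x : L2) : G -> H := \val (repr (x : (Quotient.quot null_sqfun))).

End L2_space.

Section operators.
Context (R : realType) (V : lmodType R[i]) (ip : V -> V -> R[i]).
Implicit Types (T : V -> V) (X M : set (V -> V)).

Definition ipnorm (x : V) : R := Num.sqrt (complex.Re (ip x x)).

Definition bounded_op T : Prop :=
  linear T /\ exists C : R, forall x, ipnorm (T x) <= C * ipnorm x.

Definition opnorm T : \bar R :=
  ereal_sup [set (ipnorm (T x))%:E | x in [set x | ipnorm x <= 1]].

(* Norm of the operator on [V ^ n] with matrix [T]. *)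
Definition mxnorm n (T : 'I_n -> 'I_n -> V -> V) : \bar R :=
  ereal_sup [set (Num.sqrt (\sum_i ipnorm (\sum_j T i j (x j)) ^+ 2))%:E
    | x in [set x : 'I_n -> V | \sum_j ipnorm (x j) ^+ 2 <= 1]].

Definition norm_closure X : set (V -> V) := [set T | bounded_op T /\
  forall e : R, 0 < e -> exists2 T', X T' & (opnorm (T - T')%R < e%:E)%E].

Definition square_summable (x : nat -> V) : Prop :=
  (\sum_(0 <= n <oo) (ipnorm (x n) ^+ 2)%:E < +oo)%E.

Definition predual_index := {p : (nat -> V) * (nat -> V) |
  square_summable p.1 /\ square_summable p.2}.

(* The functional $T \mapsto \sum_n \langle T \xi_n, \eta_n\rangle$. *)
Definition normal_functional (p : predual_index) T : R[i] :=
  limn ((fun n => \sum_(k < n) ip (T ((sval p).1 k)) ((sval p).2 k))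
    : nat -> R[i]^o).

Definition normal_pairing T : prod_topology (fun _ : predual_index => R[i]^o) :=
  fun p => normal_functional p T.

(* All functions [V -> V] with the coarsest topology making the normal
   functionals continuous; on the bounded operators, the only place where it
   is used, it induces the weak* topology. *)
Definition weak_star : topologicalType := initial_topology normal_pairing.

Definition weak_star_closure X : set (V -> V) :=
  [set T | bounded_op T /\ closure (X : set weak_star) T].

Definition weak_star_continuous M (S : (V -> V) -> V -> V) : Prop :=
  {within (M : set weak_star), continuous (S : weak_star -> weak_star)}.

End operators.

Definition linear_on (R : realType) (V : lmodType R[i]) (D : set V)
    (S : V -> V) : Prop :=
  forall (k : R[i]) x y, D x -> D y -> S (k *: x + y) = k *: S x + S y.

(* [cb_norm N D S] is $\sup_n \|S^{(n)}\|$ for the map [S] on the linear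
   space [D], where [N n] is the norm of $M_n(D)$. *)
Definition cb_norm (R : realType) (X : Type)
    (N : forall n, ('I_n -> 'I_n -> X) -> \bar R) (D : set X) (S : X -> X) :
    \bar R :=
  ereal_sup [set r | exists n (x : 'I_n -> 'I_n -> X),
    [/\ forall i j, D (x i j), (N n x <= 1)%E & r = N n (fun i j => S (x i j))]].

Definition left_haar_measure (R : realType) (G : topologicalGroupType)
    (mu : {measure set (borel G) -> \bar R}) : Prop :=
  [/\ (mu setT != 0)%E,
      forall (t : G) (B : set G), measurable (B : set (borel G)) ->
        mu [set (t * x)%g | x in B] = mu B,
      forall K : set G, compact K -> (mu K < +oo)%E,
      forall B : set G, measurable (B : set (borel G)) ->
        mu B = ereal_inf [set mu U | U in [set U | open U /\ B `<=` U]] &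
      forall U : set G, open U ->
        mu U = ereal_sup [set mu K | K in [set K | compact K /\ K `<=` U]]].

Section dynamical_system.
Context (R : realType) (G : topologicalGroupType) (A : cstarAlgType R).

Definition star_automorphism (phi : A -> A) : Prop :=
  [/\ linear phi, bijective phi, {morph phi : a b / cmul a b} &
      {morph phi : a / cstar a}].

Definition cstar_dynamical_system (alpha : G -> A -> A) : Prop :=
  [/\ forall s, star_automorphism (alpha s),
      forall s t a, alpha (s * t)%g a = alpha s (alpha t a) &
      forall a, continuous (fun s => alpha s a)].

Definition representation (H : hilbertType R) (theta : A -> H -> H) : Prop :=
  [/\ forall a, bounded_op inner (theta a),
      forall (k : R[i]) a b x, theta (k *: a + b) x = k *: theta a x + theta b x,
      forall a b x, theta (cmul a b) x = theta a (theta b x) &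
      forall a x y, inner (theta (cstar a) x) y = inner x (theta a y)].

Definition faithful_representation (H : hilbertType R) (theta : A -> H -> H) :
    Prop :=
  representation theta /\ injective theta.

End dynamical_system.

Section crossed_product.
Context (R : realType) (G : topologicalGroupType).
Context (mu : {measure set (borel G) -> \bar R}).
Context (A : cstarAlgType R) (H : separableHilbertType R).
Context (alpha : G -> A -> A) (theta : A -> H -> H).

Definition cintegral (f : G -> R[i]) : R[i] :=
  ((\int[mu]_s complex.Re (f s)) +i* (\int[mu]_s complex.Im (f s)))%C.

Local Notation K := (L2 mu H).

Definition L2_inner (x y : K) : R[i] :=
  cintegral (fun s => inner (L2_fun x s) (L2_fun y s)).

Definition pi_theta (a : A) (x : K) : K :=
  L2_class mu (fun s => theta (alpha (s^-1)%g a) (L2_fun x s)).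

Definition lambda_theta (t : G) (x : K) : K :=
  L2_class mu (fun s => L2_fun x (t^-1 * s)%g).

Definition pi_lambda (a : A) (t : G) : K -> K :=
  fun x => pi_theta a (lambda_theta t x).

Definition L1 (f : G -> A) : Prop :=
  borel_fun f /\ (\int[mu]_s (rnorm (f s))%:E < +oo)%E.

(* $T = \int_G \pi^\theta(f(s))\lambda^\theta_s\,ds$, in the weak sense. *)
Definition is_integrated_form (f : G -> A) (T : K -> K) : Prop :=
  bounded_op L2_inner T /\ forall x y,
    L2_inner (T x) y = cintegral (fun s => L2_inner (pi_lambda (f s) s x) y).

Definition crossed_product : set (K -> K) :=
  norm_closure L2_inner [set T | exists2 f, L1 f & is_integrated_form f T].

Definition ws_crossed_product : set (K -> K) :=
  weak_star_closure L2_inner crossed_product.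

Local Notation M := ws_crossed_product.

(* The norm of $M_n(A)$, computed in the faithful representation [theta]. *)
Definition Amxnorm n (a : 'I_n -> 'I_n -> A) : \bar R :=
  mxnorm inner (fun i j => theta (a i j)).

Definition bounded_map (phi : A -> A) : Prop :=
  linear phi /\ exists C : R, forall a, rnorm (phi a) <= C * rnorm a.

Definition Acb_norm (phi : A -> A) : \bar R := cb_norm Amxnorm setT phi.

Definition completely_bounded_map (phi : A -> A) : Prop :=
  linear phi /\ (Acb_norm phi < +oo)%E.

Definition Mcb_norm (S : (K -> K) -> K -> K) : \bar R :=
  cb_norm (mxnorm L2_inner) M S.

(* Only the restriction of [S] to [M] is meaningful. *)
Definition completely_bounded_on_M (S : (K -> K) -> K -> K) : Prop :=
  [/\ forall T, M T -> M (S T), linear_on M S & (Mcb_norm S < +oo)%E].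

Definition herz_schur_extension (F : G -> A -> A)
    (S : (K -> K) -> K -> K) : Prop :=
  [/\ completely_bounded_on_M S, weak_star_continuous L2_inner M S &
      forall a t, S (pi_lambda a t) = pi_lambda (F t a) t].

Definition herz_schur_multiplier (F : G -> A -> A) : Prop :=
  [/\ forall t, completely_bounded_map (F t),
      exists C : R, forall t, (Acb_norm (F t) <= C%:E)%E &
      exists S, herz_schur_extension F S].

(* Two extensions of the same [F] agree on [M], so the choice is immaterial. *)
Definition herz_schur_norm (F : G -> A -> A) : \bar R :=
  Mcb_norm (xget (@id (K -> K)) [set S | herz_schur_extension F S]).

Definition fourier_coefficient (p : predual_index L2_inner) : G -> A -> R[i] :=
  fun t a => normal_functional p (pi_lambda a t).

Definition fourier_space : set (G -> A -> R[i]) := range fourier_coefficient.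

(* The functional $\tilde u$ associated with [u]; different choices agree
   on [M]. *)
Definition fourier_functional (u : G -> A -> R[i]) : (K -> K) -> R[i] :=
  xget (fun=> 0) [set normal_functional p | p in
    [set p : predual_index L2_inner | fourier_coefficient p = u]].

Definition fourier_norm (u : G -> A -> R[i]) : \bar R :=
  ereal_sup [set (complex.Re `|fourier_functional u T|)%:E
    | T in [set T | M T /\ (opnorm L2_inner T <= 1)%E]].

(* The map $s_F$, which its defining formula determines. *)
Definition fourier_multiplication (F : G -> A -> A) (u : G -> A -> R[i]) :
    G -> A -> R[i] :=
  fun t a => u t (F t a).

Definition fourier_multiplier (F : G -> A -> A) : Prop :=
  [/\ forall t, bounded_map (F t),
      exists C : R, forall t a, rnorm (F t a) <= C * rnorm a,
      forall u, fourier_space u ->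
        fourier_space (fourier_multiplication F u) &
      exists C : R, forall u, fourier_space u ->
        (fourier_norm (fourier_multiplication F u) <= C%:E * fourier_norm u)%E].

(* The map $s_F^*$ on [M], which is identified with the dual of
   [fourier_space] via $\langle T, u\rangle = \tilde u(T)$. *)
Definition fourier_adjoint (F : G -> A -> A) (T : K -> K) : K -> K :=
  xget (fun=> 0) [set T' | M T' /\ forall u, fourier_space u ->
    fourier_functional u T' =
    fourier_functional (fourier_multiplication F u) T].

Definition cb_fourier_multiplier (F : G -> A -> A) : Prop :=
  [/\ fourier_multiplier F, forall t, completely_bounded_map (F t) &
      completely_bounded_on_M (fourier_adjoint F)].

Definition cb_fourier_multiplier_norm (F : G -> A -> A) : \bar R :=
  Mcb_norm (fourier_adjoint F).

End crossed_product.

(* Main.v *)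
Require Import Defs.
From HB Require Import structures.
From mathcomp Require Import all_boot all_order all_algebra.
From mathcomp Require Import all_classical all_reals all_analysis.
From mathcomp Require Import measurable_realfun complex ring lra.

Set Implicit Arguments.
Unset Strict Implicit.
Unset Printing Implicit Defensive.
Import Order.TTheory GRing.Theory Num.Theory.
Import numFieldNormedType.Exports.

Local Open Scope classical_set_scope.
Local Open Scope ring_scope.

(* Write M for the weak* crossed product and u_p for the coefficient of a normal
   functional p. Averaging integrated forms over small sets shows that every
   pi(a) lambda_t lies in M, and conversely the value of p on an integrated form
   is the integral of s |-> u_p(s)(f(s)); so p is determined on M by u_p, and the
   Fourier space is the predual of M.
   If S is the extension attached to a Herz-Schur multiplier F, weak* continuity
   says that p o S is again given by a normal functional on M, whose coefficient
   is F u_p; thus S = s_F^* on M and the norms agree. Conversely, for T in M the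
   map u |-> (F u)~(T) is a bounded functional on the predual, hence given by an
   element of M, and s_F^* is weak* continuous with
   s_F^*(pi(a) lambda_t) = pi(F(t) a) lambda_t. The bound on F(t) uniform in t
   holds because the matrix norms of [a_ij] and [pi(a_ij) lambda_t] coincide:
   two faithful representations of A give the same norms on matrices. *)

(** * Inner product spaces and their operators *)

Section complex_modulus.
Context (R : realType).
Implicit Types (z w : R[i]).

(** Three points stay implicit in this outline. Membership in a weak* closure is decided by linear
    algebra in place of the bipolar theorem: a basic weak* neighbourhood involves finitely many
    normal functionals, and an operator killed by every normal functional that kills a subspace can
    be matched exactly on finitely many of them by an element of the subspace. The comparison of
    matrix norms concerns [theta] and the fibres [theta o alpha_{s^-1}] of pi; it uses only the norm
    of [A], with powers of self-adjoint matrices removing a constant that depends on [n], and the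
    isometry of a faithful representation rests on square roots obtained by iteration, without
    spectra. The [t] in pi(a) lambda_t does not influence these norms because lambda_t is unitary,
    which is why one bound serves all F(t). Finally, the functional attached to [u] and the map
    s_F^* are picked by choice, so identities are stated on M, and every construction on
    representatives has to be shown to depend on coefficients alone. *)

Definition cabs z : R := rnorm (z : R[i]^o).

Lemma cabsE z : `|z| = (cabs z)%:C%C.
Proof. exact: (@rnormE R R[i]^o). Qed.

Lemma cabs_sqrt z : cabs z = Num.sqrt (complex.Re z ^+ 2 + complex.Im z ^+ 2).
Proof. by rewrite /cabs /rnorm normc_def. Qed.

Lemma cabs_ge0 z : 0 <= cabs z.
Proof. exact: rnorm_ge0. Qed.

Lemma cabsD z w : cabs (z + w) <= cabs z + cabs w.
Proof. exact: (@rnormD R R[i]^o). Qed.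

Lemma cabsM z w : cabs (z * w) = cabs z * cabs w.
Proof.
suff : (cabs (z * w))%:C%C = (cabs z * cabs w)%:C%C :> R[i] by case.
by rewrite rmorphM /= -!cabsE normrM.
Qed.

Lemma cabs0 : cabs 0 = 0.
Proof. exact: (@rnorm0 R R[i]^o). Qed.

Lemma cabs1 : cabs 1 = 1.
Proof. by rewrite cabs_sqrt /= expr1n expr0n addr0 sqrtr1. Qed.

Lemma cabsN z : cabs (- z) = cabs z.
Proof. by rewrite /cabs /rnorm normrN. Qed.

Lemma cabs_eq0 z : cabs z = 0 -> z = 0.
Proof. by move=> z0; apply/eqP; rewrite -normr_eq0 cabsE z0. Qed.

Lemma cabs_real (r : R) : cabs r%:C%C = `|r|.
Proof. by rewrite cabs_sqrt /= expr0n addr0 sqrtr_sqr. Qed.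

Lemma cabs_i : cabs 'i%C = 1.
Proof. by rewrite cabs_sqrt /= expr1n expr0n add0r sqrtr1. Qed.

Lemma conjE z : z^* = (complex.Re z -i* complex.Im z)%C.
Proof. by case: z. Qed.

Lemma cabs_conj z : cabs z^* = cabs z.
Proof. by rewrite conjE !cabs_sqrt /= sqrrN. Qed.

Lemma Re_le_cabs z : `|complex.Re z| <= cabs z.
Proof.
by rewrite cabs_sqrt -sqrtr_sqr ler_wsqrtr // ler_wpDr // sqr_ge0.
Qed.

Lemma Im_le_cabs z : `|complex.Im z| <= cabs z.
Proof.
by rewrite cabs_sqrt -sqrtr_sqr ler_wsqrtr // ler_wpDl // sqr_ge0.
Qed.

Lemma cabs_le_ReIm z : cabs z <= `|complex.Re z| + `|complex.Im z|.
Proof.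
have -> : z = (complex.Re z)%:C%C + (complex.Im z)%:C%C * 'i%C.
  by case: z => a b; apply/eqP; rewrite eq_complex /=; apply/andP; split; apply/eqP; ring.
apply: le_trans (cabsD _ _) _; rewrite cabsM cabs_i !cabs_real mulr1.
by rewrite /= !(mul0r, mulr0, mul1r, mulr1, add0r, addr0, subr0).
Qed.

Lemma ReD z w : complex.Re (z + w) = complex.Re z + complex.Re w.
Proof. by case: z; case: w. Qed.

Lemma ImD z w : complex.Im (z + w) = complex.Im z + complex.Im w.
Proof. by case: z; case: w. Qed.

Lemma ReM z w : complex.Re (z * w) =
  complex.Re z * complex.Re w - complex.Im z * complex.Im w.
Proof. by case: z; case: w. Qed.

Lemma ImM z w : complex.Im (z * w) =
  complex.Re z * complex.Im w + complex.Im z * complex.Re w.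
Proof. by case: z => a b; case: w. Qed.

Lemma complexP z w : complex.Re z = complex.Re w ->
  complex.Im z = complex.Im w -> z = w.
Proof. by case: z => a b; case: w => c d /= -> ->. Qed.

Lemma ReN z : complex.Re (- z) = - complex.Re z. Proof. by case: z. Qed.
Lemma ImN z : complex.Im (- z) = - complex.Im z. Proof. by case: z. Qed.
Lemma Re_conj z : complex.Re z^* = complex.Re z. Proof. by case: z. Qed.
Lemma Im_conj z : complex.Im z^* = - complex.Im z. Proof. by case: z. Qed.

Lemma Re_sum (I : Type) (r : seq I) (P : pred I) (F : I -> R[i]) :
  complex.Re (\sum_(i <- r | P i) F i) = \sum_(i <- r | P i) complex.Re (F i).
Proof. by elim/big_ind2: _ => // x a y b <- <-; rewrite ReD. Qed.

Lemma Im_sum (I : Type) (r : seq I) (P : pred I) (F : I -> R[i]) :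
  complex.Im (\sum_(i <- r | P i) F i) = \sum_(i <- r | P i) complex.Im (F i).
Proof. by elim/big_ind2: _ => // x a y b <- <-; rewrite ImD. Qed.

Lemma mul_conj z : z * z^* = (cabs z ^+ 2)%:C%C.
Proof.
rewrite cabs_sqrt sqr_sqrtr ?addr_ge0 ?sqr_ge0 //.
by apply: complexP; rewrite ?ReM ?ImM ?Re_conj ?Im_conj /=; ring.
Qed.

Lemma conjD z w : (z + w)^* = z^* + w^*. Proof. exact: rmorphD. Qed.
Lemma conjM z w : (z * w)^* = z^* * w^*. Proof. exact: rmorphM. Qed.
Lemma conjK z : (z^*)^* = z. Proof. exact: conjCK. Qed.

Lemma conj_real (r : R) : (r%:C%C : R[i])^* = r%:C%C.
Proof. by apply: complexP; rewrite ?Re_conj ?Im_conj //= oppr0. Qed.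

End complex_modulus.

(** * Inner products on a bare module *)

Section inner_product.
Context (R : realType) (V : lmodType R[i]) (ip : V -> V -> R[i]).

(** A predicate on a form, so that the same lemmas serve [H], the space [L2 mu H], which is only an
    [lmodType], and the powers [V^n]. *)
Record inner_product : Prop := InnerProduct {
  ipPl : forall (k : R[i]) x x' y, ip (k *: x + x') y = k * ip x y + ip x' y ;
  ipC : forall x y, ip x y = (ip y x)^* ;
  ip_ge0 : forall x, 0 <= ip x x ;
  ip_eq0 : forall x, ip x x = 0 -> x = 0
}.

Hypothesis ipV : inner_product.
Implicit Types (x y z : V).
Local Notation nrm := (ipnorm ip).

Lemma ipDl x x' y : ip (x + x') y = ip x y + ip x' y.
Proof. by rewrite -{1}(scale1r x) (ipPl ipV) mul1r. Qed.

Lemma ip0l y : ip 0 y = 0.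
Proof. by have := ipDl 0 0 y; rewrite addr0 -{1}[ip 0 y]addr0 => /addrI. Qed.

Lemma ipZl k x y : ip (k *: x) y = k * ip x y.
Proof. by rewrite -[k *: x]addr0 (ipPl ipV) ip0l addr0. Qed.

Lemma ipNl x y : ip (- x) y = - ip x y.
Proof. by rewrite -scaleN1r ipZl mulN1r. Qed.

Lemma ipBl x x' y : ip (x - x') y = ip x y - ip x' y.
Proof. by rewrite ipDl ipNl. Qed.

Lemma ipDr x y y' : ip x (y + y') = ip x y + ip x y'.
Proof. by rewrite (ipC ipV) ipDl rmorphD (ipC ipV x y) (ipC ipV x y'). Qed.

Lemma ipZr k x y : ip x (k *: y) = k^* * ip x y.
Proof. by rewrite (ipC ipV) ipZl rmorphM (ipC ipV x y). Qed.

Lemma ipNr x y : ip x (- y) = - ip x y.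
Proof. by rewrite -scaleN1r ipZr rmorphN1 mulN1r. Qed.

Lemma ip0r x : ip x 0 = 0.
Proof. by rewrite (ipC ipV) ip0l rmorph0. Qed.

Lemma ipBr x y y' : ip x (y - y') = ip x y - ip x y'.
Proof. by rewrite ipDr ipNr. Qed.

Lemma ip_suml (I : Type) (r : seq I) (F : I -> V) y :
  ip (\sum_(i <- r) F i) y = \sum_(i <- r) ip (F i) y.
Proof.
elim: r => [|i r IH]; first by rewrite !big_nil ip0l.
by rewrite !big_cons ipDl IH.
Qed.

Lemma ipnorm_ge0 x : 0 <= nrm x.
Proof. exact: sqrtr_ge0. Qed.

Lemma Re_ip_ge0 x : 0 <= complex.Re (ip x x).
Proof. by have := ip_ge0 ipV x; rewrite lecE => /andP[]. Qed.

Lemma ipnorm_sqr x : nrm x ^+ 2 = complex.Re (ip x x).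
Proof. by rewrite sqr_sqrtr // Re_ip_ge0. Qed.

Lemma ipxx x : ip x x = (nrm x ^+ 2)%:C%C.
Proof.
apply: complexP; first by rewrite ipnorm_sqr.
by have := ip_ge0 ipV x; rewrite lecE => /andP[/eqP].
Qed.

Lemma ipnorm_eq0 x : nrm x = 0 -> x = 0.
Proof. by move=> x0; apply: (ip_eq0 ipV); rewrite ipxx x0 expr0n. Qed.

Lemma ipnorm0 : nrm 0 = 0.
Proof. by rewrite /ipnorm ip0l sqrtr0. Qed.

Lemma ipnormZ k x : nrm (k *: x) = cabs k * nrm x.
Proof.
apply: (@pexpIrn _ 2); rewrite ?nnegrE ?mulr_ge0 ?ipnorm_ge0 ?cabs_ge0 //.
have /(congr1 (@complex.Re R)) := ipxx (k *: x).
rewrite ipZl ipZr mulrA mul_conj ipxx -rmorphM /= => <-.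
by rewrite exprMn.
Qed.

Lemma ipnormN x : nrm (- x) = nrm x.
Proof. by rewrite -scaleN1r ipnormZ cabsN cabs1 mul1r. Qed.

Lemma ipnormC x y : nrm (x - y) = nrm (y - x).
Proof. by rewrite -opprB ipnormN. Qed.

Lemma ipnormD_sqr x y :
  nrm (x + y) ^+ 2 = nrm x ^+ 2 + 2 * complex.Re (ip x y) + nrm y ^+ 2.
Proof.
rewrite !ipnorm_sqr ipDl !ipDr !ReD (ipC ipV y x) Re_conj.
by ring.
Qed.

Lemma Cauchy_Schwarz x y : cabs (ip x y) <= nrm x * nrm y.
Proof.
have [y0|y0] := eqVneq (nrm y) 0.
  by rewrite (ipnorm_eq0 y0) ip0r cabs0 ipnorm0 mulr0.
have yp : 0 < nrm y by rewrite lt_def y0 ipnorm_ge0.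
rewrite -ler_pdivrMr // -(@ler_pXn2r _ 2) ?nnegrE ?divr_ge0 ?ipnorm_ge0 ?cabs_ge0 //.
(* [k *: y] is the orthogonal projection of [x] on the line of [y]; the inequality is the
   nonnegativity of the squared norm of the remainder. *)
set k := (nrm y ^- 2)%:C%C * ip x y.
have := sqr_ge0 (nrm (x - k *: y)).
rewrite ipnormD_sqr ipNr ipnormN ReN ipnormZ ipZr.
rewrite {1}/k rmorphM /= conj_real -mulrA [_^* * _]mulrC mul_conj -rmorphM /=.
rewrite /k cabsM cabs_real ger0_norm ?invr_ge0 ?exprn_ge0 ?ipnorm_ge0 //.
have -> : nrm x ^+ 2 + 2 * - (nrm y ^- 2 * cabs (ip x y) ^+ 2) +
  (nrm y ^- 2 * cabs (ip x y) * nrm y) ^+ 2 =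
  nrm x ^+ 2 - (cabs (ip x y) / nrm y) ^+ 2 by field.
by rewrite subr_ge0.
Qed.

Lemma ipnormD x y : nrm (x + y) <= nrm x + nrm y.
Proof.
rewrite -(@ler_pXn2r _ 2) ?nnegrE ?addr_ge0 ?ipnorm_ge0 // ipnormD_sqr sqrrD.
rewrite lerD2r lerD2l mulr_natl lerMn2r /=.
exact: le_trans (le_trans (ler_norm _) (Re_le_cabs _)) (Cauchy_Schwarz _ _).
Qed.

Lemma ipnormB x y z : nrm (x - z) <= nrm (x - y) + nrm (y - z).
Proof. by apply: le_trans (ipnormD _ _); rewrite addrA subrK. Qed.

Lemma ipnorm_sum (I : Type) (r : seq I) (F : I -> V) :
  nrm (\sum_(i <- r) F i) <= \sum_(i <- r) nrm (F i).
Proof.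
elim: r => [|i r IH]; first by rewrite !big_nil ipnorm0.
by rewrite !big_cons (le_trans (ipnormD _ _)) // lerD2l.
Qed.

Lemma ip_inj x y : (forall z, ip x z = ip y z) -> x = y.
Proof.
move=> xy; apply/eqP; rewrite -subr_eq0; apply/eqP; apply: (ip_eq0 ipV).
by rewrite ipBl xy subrr.
Qed.

Lemma parallelogram x y :
  nrm (x + y) ^+ 2 + nrm (x - y) ^+ 2 = 2 * nrm x ^+ 2 + 2 * nrm y ^+ 2.
Proof. by rewrite !ipnormD_sqr ipNr ipnormN ReN; ring. Qed.

(** Sequential and phrased through [ipnorm], since [V] carries no topology. *)
Definition ip_complete : Prop := forall u : nat -> V,
  (forall e : R, 0 < e -> exists N, forall m n, (N <= m)%N -> (N <= n)%N ->
    nrm (u m - u n) < e) ->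
  exists l, forall e : R, 0 < e -> exists N, forall n, (N <= n)%N ->
    nrm (u n - l) < e.

End inner_product.

(** * Riesz representation and operators from sesquilinear forms *)

Section riesz.
Context (R : realType) (V : lmodType R[i]) (ip : V -> V -> R[i]).
Hypotheses (ipV : inner_product ip) (cV : ip_complete ip).
Implicit Types (x y z : V).
Local Notation nrm := (ipnorm ip).

Lemma eps_invS (e : R) : 0 < e -> exists N, forall n, (N <= n)%N -> n.+1%:R^-1 < e.
Proof.
move=> e0; have [N] := ltr_add_invr e0.
rewrite add0r => Ne; exists N => n Nn; apply: le_lt_trans Ne.
by rewrite lef_pV2 ?posrE ?ltr0n // ler_nat ltnS.
Qed.

(* The representing vector minimizes [|x|^2 - 2 Re (phi x)]; minimizing
   sequences are Cauchy by the parallelogram law. *)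
Lemma riesz (phi : V -> R[i]) (C : R) :
  (forall k x y, phi (k *: x + y) = k * phi x + phi y) ->
  (forall x, cabs (phi x) <= C * nrm x) ->
  exists y, forall x, phi x = ip x y.
Proof.
move=> philin phiC.
have phiD x y : phi (x + y) = phi x + phi y.
  by rewrite -[in LHS](scale1r x) philin mul1r.
have phi0 : phi 0 = 0 by have := phiD 0 0; rewrite addr0 -{1}[phi 0]addr0 => /addrI.
have phiZ k x : phi (k *: x) = k * phi x by rewrite -[k *: x]addr0 philin phi0 addr0.
pose J x := nrm x ^+ 2 - 2 * complex.Re (phi x).
have JC x : - C ^+ 2 <= J x.
  have h1 := phiC x; have h2 := Re_le_cabs (phi x); have h3 := ler_norm (complex.Re (phi x)).
  have h4 := sqr_ge0 (nrm x - C); rewrite /J; nra.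
pose d := inf (range J).
have hinf : has_inf (range J).
  split; first by exists (J 0), 0.
  by exists (- C ^+ 2) => _ [x _ <-].
have dJ x : d <= J x by apply: ge_inf; [exact: hinf.2|exists x].
have /choice[u uP] : forall n, exists x, J x < d + n.+1%:R^-1.
  move=> n.
  have [|_ [x _ <-] xd] := @inf_adherent _ (range J) n.+1%:R^-1 _ hinf.
    by rewrite invr_gt0 ltr0n.
  by exists x.
(* By the parallelogram law, [J (u m) + J (u n)] minus twice [J] at the midpoint is half of
   [nrm (u m - u n) ^+ 2], and [J] at the midpoint is at least [d]. The half is kept as an [r] with
   [2 * r = 1]. *)
have uC m n : nrm (u m - u n) ^+ 2 <= 2 * m.+1%:R^-1 + 2 * n.+1%:R^-1.
  have := parallelogram ipV (u m) (u n).
  have [r [r0 r2]] : exists r : R, 0 <= r /\ 2 * r = 1.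
    by exists 2^-1; rewrite invr_ge0 mulfV.
  have := dJ (r%:C%C *: (u m + u n)).
  rewrite /J ipnormZ // cabs_real ger0_norm // phiZ ReM /= mul0r subr0.
  rewrite phiD ReD; have := uP m; have := uP n; rewrite /J.
  set a := nrm (u m + u n); set b := nrm (u m - u n).
  have -> : forall y : R, 2 * (r * y) = y by move=> y; rewrite mulrA r2 mul1r.
  have h : 4 * (r * a) ^+ 2 = a ^+ 2.
    rewrite [RHS](_ : _ = (2 * r) ^+ 2 * a ^+ 2); last by rewrite r2 expr1n mul1r.
    by ring.
  clearbody a b d; move: (a ^+ 2) (b ^+ 2) ((r * a) ^+ 2) h (nrm (u n) ^+ 2)
    (nrm (u m) ^+ 2) (complex.Re (phi (u m))) (complex.Re (phi (u n)))
    (m.+1%:R^-1) (n.+1%:R^-1) => *; lra.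
have [l lP] : exists l, forall e : R, 0 < e ->
    exists N, forall n, (N <= n)%N -> nrm (u n - l) < e.
  apply: cV => e e0; have [|N NP] := @eps_invS (e ^+ 2 / 4).
    by rewrite divr_gt0 // exprn_gt0.
  exists N => m n Nm Nn; rewrite -(@ltr_pXn2r _ 2) ?nnegrE ?ipnorm_ge0 ?ltW //.
  have := uC m n; have := NP _ Nm; have := NP _ Nn.
  by move: (m.+1%:R^-1) (n.+1%:R^-1) (nrm _ ^+ 2) (e ^+ 2) => *; lra.
(* First variation without derivatives: moving [u n] by [- g / c] along [h] lowers [J] by at least
   [g ^+ 2 / c], while [u n] is within [1 / (n + 1)] of the infimum. The 1 in [c] avoids a division
   by zero. *)
have ReP h : complex.Re (phi h) = complex.Re (ip h l).
  pose c := nrm h ^+ 2 + 1.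
  have c0 : 0 < c by rewrite ltr_wpDl // sqr_ge0.
  have gP n : (complex.Re (ip h (u n)) - complex.Re (phi h)) ^+ 2 <= c * n.+1%:R^-1.
    set g := _ - _.
    have := dJ (u n + (- (g / c))%:C%C *: h); have := uP n; rewrite /J.
    rewrite ipnormD_sqr // ipnormZ // cabs_real phiD phiZ ipZr // conj_real.
    rewrite (ipC ipV (u n) h) !ReD !ReM Re_conj /= !mul0r !subr0 exprMn real_normK ?num_real //.
    move=> h1 h2.
    have h3 : g ^+ 2 / c <= n.+1%:R^-1.
      have h4 : (- (g / c)) ^+ 2 * nrm h ^+ 2 <= g ^+ 2 / c.
        rewrite sqrrN (_ : g ^+ 2 / c = (g / c) ^+ 2 * c); last by field; rewrite gt_eqF.
        by rewrite ler_wpM2l ?sqr_ge0 // /c lerDl.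
      have h5 : g / c * g = g ^+ 2 / c by ring.
      move: h1 h2 h4 h5; have gE : g = complex.Re (ip h (u n)) - complex.Re (phi h) by [].
      clearbody g; move: (g ^+ 2 / c) (g / c) gE => G q ->.
      move: (n.+1%:R^-1) ((- q) ^+ 2 * _) (nrm (u n) ^+ 2).
      by move: (complex.Re _) (complex.Re _) (complex.Re _) => *; lra.
    by rewrite mulrC -ler_pdivrMr.
  apply/eqP; rewrite eq_sym -subr_eq0 -normr_le0; apply/ler_addgt0Pr => e e0.
  rewrite add0r.
  have [|N1 N1P] := @eps_invS ((e / 2) ^+ 2 / c).
    by rewrite divr_gt0 // exprn_gt0 // divr_gt0.
  have [|N2 N2P] := lP (e / 2 / c); first by rewrite !divr_gt0.
  pose n := maxn N1 N2.
  have g1 : `|complex.Re (ip h (u n)) - complex.Re (phi h)| <= e / 2.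
    rewrite -(@ler_pXn2r _ 2) ?nnegrE ?divr_ge0 ?(ltW e0) // real_normK ?num_real //.
    apply: le_trans (gP n) _; rewrite mulrC -ler_pdivlMr //.
    exact/ltW/N1P/leq_maxl.
  have g2 : `|complex.Re (ip h l) - complex.Re (ip h (u n))| <= e / 2.
    rewrite -ReN -ReD -ipBr //; apply: le_trans (Re_le_cabs _) _.
    apply: le_trans (Cauchy_Schwarz ipV _ _) _.
    have := N2P n (leq_maxr _ _); rewrite ipnormC // ltr_pdivlMr // => h1.
    apply: le_trans (ltW h1); rewrite mulrC ler_wpM2l ?ipnorm_ge0 // /c.
    have := sqr_ge0 (nrm h - 2^-1); nra.
  have := ler_distD (complex.Re (ip h (u n))) (complex.Re (ip h l)) (complex.Re (phi h)).
  lra.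
exists l => x; apply: complexP; first exact: ReP.
by have := ReP ('i%C *: x); rewrite phiZ ipZl // !ReM /= !mul0r !mul1r !sub0r => /oppr_inj.
Qed.

(** Riesz in the second variable, applied to the linear functional [y |-> (B x y)^*]; the bound on
    [T x] is the bound on [B x (T x)]. Integrated forms and adjoints of multipliers are both
    produced this way. *)
Lemma sesquilinear_operator (B : V -> V -> R[i]) (C : R) :
  (forall k x x' y, B (k *: x + x') y = k * B x y + B x' y) ->
  (forall k x y y', B x (k *: y + y') = k^* * B x y + B x y') ->
  (forall x y, cabs (B x y) <= C * (nrm x * nrm y)) ->
  exists T, [/\ linear T, forall x, nrm (T x) <= C * nrm x &
    forall x y, ip (T x) y = B x y].
Proof.
move=> Bl Br BC.
have /choice[T TP] : forall x, exists z, forall y, (B x y)^* = ip y z.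
  move=> x; apply: (@riesz _ (C * nrm x)) => [k y y'|y].
    by rewrite Br conjD conjM conjK.
  by rewrite cabs_conj -mulrA.
have TB x y : ip (T x) y = B x y by rewrite (ipC ipV) -TP conjK.
exists T; split=> // [k x x'|x].
  by apply: (ip_inj ipV) => z; rewrite (ipPl ipV) !TB Bl.
(* The sign of [C] is unknown; if it is negative, the bound on [B x x] forces [nrm x = 0]. *)
have [T0|T0] := eqVneq (nrm (T x)) 0.
  rewrite T0; have [C0|C0] := leP 0 C; first by rewrite mulr_ge0 ?ipnorm_ge0.
  have := BC x x; have := cabs_ge0 (B x x); have := ipnorm_ge0 ip x; nra.
have Tp : 0 < nrm (T x) by rewrite lt_def T0 ipnorm_ge0.
rewrite -(ler_pM2r Tp) -mulrA.
have /(congr1 (@complex.Re R)) /= := ipxx ipV (T x); rewrite -expr2 => <-.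
by rewrite TB; apply: le_trans (BC _ _); apply: le_trans (ler_norm _) (Re_le_cabs _).
Qed.

End riesz.

(** * Operator norms and matrices of operators *)

Section operator_norm.
Context (R : realType) (V : lmodType R[i]) (ip : V -> V -> R[i]).
Hypothesis ipV : inner_product ip.
Local Notation nrm := (ipnorm ip).

Lemma linear_homog (T : V -> V) : linear T -> forall k x, T (k *: x) = k *: T x.
Proof.
move=> lT k x; have lT0 : T 0 = 0.
  by have := lT 1 0 0; rewrite !scale1r addr0 -{1}[T 0]addr0 => /addrI.
by rewrite -[k *: x]addr0 lT lT0 addr0.
Qed.

Lemma opnorm_ub (S : V -> V) (c : R) : 0 <= c ->
  (forall x, nrm (S x) <= c * nrm x) -> (opnorm ip S <= c%:E)%E.
Proof.
move=> c0 Sc; apply: ge_ereal_sup => _ [x /= x1 <-].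
by rewrite lee_fin; apply: le_trans (Sc x) _; rewrite ler_piMr.
Qed.

Lemma unit_ball_bound (f : V -> R) (c : R) :
  (forall k x, f (k%:C%C *: x) = `|k| * f x) ->
  (forall x, nrm x <= 1 -> f x <= c) -> forall x, f x <= c * nrm x.
Proof.
move=> fZ fc x; have [x0|x0] := eqVneq (nrm x) 0.
  rewrite x0 mulr0 (ipnorm_eq0 ipV x0).
  by have := fZ 0 0; rewrite scaler0 normr0 mul0r => ->.
have xp : 0 < nrm x by rewrite lt_def x0 ipnorm_ge0.
rewrite -ler_pdivrMr //.
have := fc ((nrm x)^-1%:C%C *: x).
rewrite fZ ipnormZ // cabs_real ger0_norm ?invr_ge0 ?ipnorm_ge0 //.
by rewrite mulVf // mulrC; exact.
Qed.

Lemma opnorm_lb (S : V -> V) (c : R) : linear S ->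
  (opnorm ip S <= c%:E)%E -> forall x, nrm (S x) <= c * nrm x.
Proof.
move=> /linear_homog SZ Sc; apply: unit_ball_bound => // [k x|x x1].
  by rewrite SZ ipnormZ // cabs_real.
by rewrite -lee_fin; apply: le_trans Sc; apply: ereal_sup_ubound; exists x.
Qed.

Context (n : nat).
Implicit Types (x y : 'I_n -> V).

Definition ipn x y : R[i] := \sum_i ip (x i) (y i).

Lemma ipn_inner_product : inner_product ipn.
Proof.
split=> [k x x' y|x y|x|x /eqP].
- by rewrite /ipn mulr_sumr -big_split; apply: eq_bigr => i _; rewrite (ipPl ipV).
- rewrite /ipn rmorph_sum; apply: eq_bigr => i _; exact: (ipC ipV).
- by apply: sumr_ge0 => i _; exact: (ip_ge0 ipV).
- rewrite psumr_eq0 => [/allP x0|i _]; last exact: (ip_ge0 ipV).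
  apply/funext => i; apply: (ip_eq0 ipV); apply/eqP.
  by apply: x0; rewrite mem_index_enum.
Qed.

Lemma ipnorm_ipn x : ipnorm ipn x = Num.sqrt (\sum_i nrm (x i) ^+ 2).
Proof.
rewrite /ipnorm /ipn Re_sum; congr Num.sqrt; apply: eq_bigr => i _.
by rewrite sqr_sqrtr // Re_ip_ge0.
Qed.

Lemma eq_ipnorm_ipn x y : (forall i, nrm (x i) = nrm (y i)) ->
  ipnorm ipn x = ipnorm ipn y.
Proof.
by move=> xy; rewrite !ipnorm_ipn; congr Num.sqrt; apply: eq_bigr => i _; rewrite xy.
Qed.

Lemma ipnorm_ipn_sqr x : ipnorm ipn x ^+ 2 = \sum_i nrm (x i) ^+ 2.
Proof.
by rewrite ipnorm_ipn sqr_sqrtr // sumr_ge0 // => i _; exact: sqr_ge0.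
Qed.

Lemma le_ipnorm_ipn x i : nrm (x i) <= ipnorm ipn x.
Proof.
rewrite -(@ler_pXn2r _ 2) ?nnegrE ?ipnorm_ge0 // ipnorm_ipn_sqr (bigD1 i) //=.
by rewrite lerDl sumr_ge0 // => j _; exact: sqr_ge0.
Qed.

Lemma ipnorm_ipn_le x : ipnorm ipn x <= \sum_i nrm (x i).
Proof.
have s0 (r : seq 'I_n) : 0 <= \sum_(i <- r) nrm (x i).
  by apply: sumr_ge0 => i _; exact: ipnorm_ge0.
rewrite -(@ler_pXn2r _ 2) ?nnegrE ?ipnorm_ge0 // ipnorm_ipn_sqr.
elim: (index_enum _) => [|i r IH]; first by rewrite !big_nil expr0n.
rewrite !big_cons sqrrD.
have := ipnorm_ge0 ip (x i); have := s0 r; set a := nrm _; set b := \sum_(i <- r) nrm _.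
by move=> *; rewrite addrAC ler_wpDr ?mulrn_wge0 ?mulr_ge0 // lerD2l.
Qed.

(** Its operator norm for [ipn] is [mxnorm ip T]; this makes one-operator lemmas available for
    matrices. *)
Definition mxop (T : 'I_n -> 'I_n -> V -> V) x : 'I_n -> V :=
  fun i => \sum_j T i j (x j).

Lemma mxnorm_ub (T : 'I_n -> 'I_n -> V -> V) (c : R) : 0 <= c ->
  (forall x, ipnorm ipn (mxop T x) <= c * ipnorm ipn x) -> (mxnorm ip T <= c%:E)%E.
Proof.
move=> c0 Sc; apply: ge_ereal_sup => _ [x /= x1 <-].
rewrite lee_fin -ipnorm_ipn; apply: le_trans (Sc x) _; rewrite ler_piMr //.
by rewrite -(@ler_pXn2r _ 2) ?nnegrE ?ipnorm_ge0 // ipnorm_ipn_sqr expr1n.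
Qed.

End operator_norm.

Section mxnorm_lower.
Context (R : realType) (V : lmodType R[i]) (ip : V -> V -> R[i]).
Hypothesis ipV : inner_product ip.

Lemma mxnorm_lb n (T : 'I_n -> 'I_n -> V -> V) (c : R) :
  (forall i j, linear (T i j)) -> (mxnorm ip T <= c%:E)%E ->
  forall x, ipnorm (ipn ip (n := n)) (mxop T x) <= c * ipnorm (ipn ip (n := n)) x.
Proof.
move=> lT Tc; apply: (unit_ball_bound (ipn_inner_product ipV n)) => // [k x|x x1].
  have -> : mxop T (k%:C%C *: x) = k%:C%C *: mxop T x.
    apply/funext => i; rewrite -[RHS]/(k%:C%C *: mxop T x i) /mxop scaler_sumr; apply: eq_bigr => j _.
    exact: linear_homog.
  by rewrite ipnormZ ?cabs_real //; exact: ipn_inner_product.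
rewrite -lee_fin; apply: le_trans Tc; apply: ereal_sup_ubound; exists x.
  by rewrite /= -(ipnorm_ipn_sqr ipV) exprn_ile1 // ipnorm_ge0.
by rewrite (ipnorm_ipn ipV).
Qed.

(** Reads a bound on single operators off the level [n = 1] of a cb norm. *)
Lemma opnorm_mxnorm1 (T : V -> V) (c : R) : linear T -> 0 <= c ->
  (mxnorm ip (fun _ _ : 'I_1 => T) <= c%:E)%E <-> (opnorm ip T <= c%:E)%E.
Proof.
have e (x : V) : ipnorm (ipn ip (n := 1)) (fun=> x) = ipnorm ip x.
  by rewrite (ipnorm_ipn ipV) big_ord1 sqrtr_sqr ger0_norm // ipnorm_ge0.
have e' (x : 'I_1 -> V) : x = fun=> x ord0.
  by apply/funext => i; rewrite (ord1 i).
move=> lT c0; split=> Tc.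
  apply: opnorm_ub => // x.
  have := mxnorm_lb (fun _ _ => lT) Tc (fun=> x); rewrite e.
  by rewrite (e' (mxop _ _)) e /mxop big_ord1.
apply: (mxnorm_ub ipV) => // x.
rewrite (e' (mxop _ _)) (e' x) !e /mxop big_ord1.
exact: (opnorm_lb ipV).
Qed.

End mxnorm_lower.

(** * C*-algebras and their representations *)

Section norm_limits.
Context (R : realType) (V : normedModType R[i]).
Implicit Types (u : nat -> V) (x y : V).

Lemma rnormZE k x : rnorm (k *: x) = cabs k * rnorm x.
Proof. exact: rnormZ. Qed.

Lemma rnormN x : rnorm (- x) = rnorm x.
Proof. by rewrite /rnorm normrN. Qed.

Lemma rnormC x y : rnorm (x - y) = rnorm (y - x).
Proof. by rewrite -opprB rnormN. Qed.

Lemma rnorm_eq0 x : rnorm x = 0 -> x = 0.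
Proof. by move=> x0; apply/eqP; rewrite -normr_eq0 rnormE x0. Qed.

Lemma rnorm_small (C : R) x : (forall e : R, 0 < e -> rnorm x <= C * e) -> x = 0.
Proof.
move=> xC; apply: rnorm_eq0; apply/eqP; rewrite eq_le rnorm_ge0 andbT.
apply/ler_addgt0Pr => e e0; rewrite add0r.
have C0 : 0 < `|C| + 1 by rewrite ltr_wpDl.
apply: le_trans (xC (e / (`|C| + 1)) _) _; first by rewrite divr_gt0.
rewrite mulrCA ger_pMr // ler_pdivrMr // mul1r.
by apply: le_trans (ler_norm _) _; rewrite lerDl.
Qed.

Definition rcauchy u : Prop := forall e : R, 0 < e ->
  exists N, forall m n, (N <= m)%N -> (N <= n)%N -> rnorm (u m - u n) < e.

Definition rtends u x : Prop := forall e : R, 0 < e ->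
  exists N, forall n, (N <= n)%N -> rnorm (u n - x) < e.

Lemma rtends_cvg u x : rtends u x <-> u @ \oo --> x.
Proof.
split=> [ux|/cvg_ballP ux e e0].
  apply/cvg_ballP => e e0.
  have eE : e = (complex.Re e)%:C%C.
    by move: e0; case: (e) => a b; rewrite ltcE /= => /andP[/eqP -> _].
  have [|N NP] := ux (complex.Re e); first by rewrite -(ltcR 0) -eE.
  by exists N => // n /= Nn; rewrite eE; apply/ball_rnormP; rewrite rnormC NP.
have [|N _ NP] := ux e%:C%C; first by rewrite ltcR.
by exists N => n Nn; rewrite rnormC; apply/ball_rnormP/NP.
Qed.

Lemma rtends_le u x c : (forall n, rnorm (u n) <= c) -> rtends u x -> rnorm x <= c.
Proof.
move=> uc ux; apply/ler_addgt0Pr => e e0; have [N NP] := ux e e0.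
have -> : x = u N + (x - u N) by rewrite addrC subrK.
apply: le_trans (rnormD _ _) _; apply: lerD => //.
by rewrite rnormC ltW // NP.
Qed.

End norm_limits.

Lemma rcauchy_tends (R : realType) (V : completeNormedModType R[i]) (u : nat -> V) :
  rcauchy u -> exists x, rtends u x.
Proof.
move=> uC; have /cauchy_cvg uc : cauchy (u @ \oo).
  apply: cauchy_exP => e e0.
  have eE : e = (complex.Re e)%:C%C.
    by move: e0; case: (e) => a b; rewrite ltcE /= => /andP[/eqP -> _].
  have [|N NP] := uC (complex.Re e); first by rewrite -(ltcR 0) -eE.
  exists (u N); exists N => // n /= Nn.
  by rewrite eE; apply/ball_rnormP; exact: NP.
exists (lim (u @ \oo)) => e e0.
have /cvg_ballP/(_ e%:C%C) := uc; rewrite ltcR => /(_ e0)[N _ NP].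
by exists N => n Nn; rewrite rnormC; apply/ball_rnormP/NP.
Qed.

(** * Square roots in a unital C*-algebra *)

Section cstar_algebra.
Context (R : realType) (A : cstarAlgType R).
Implicit Types (a b x y : A).
Local Notation "a '** b" := (cmul a b) (at level 40, left associativity).
Local Notation one := (cone : A).

Lemma cmulDl a a' b : (a + a') '** b = a '** b + a' '** b.
Proof. by have := cmul_linearl b 1 a a'; rewrite /= !scale1r. Qed.
Lemma cmulDr a b b' : a '** (b + b') = a '** b + a '** b'.
Proof. by have := cmul_linearr a 1 b b'; rewrite /= !scale1r. Qed.
Lemma cmul0l b : 0 '** b = 0.
Proof. by have := cmulDl 0 0 b; rewrite addr0 -{1}[0 '** b]addr0 => /addrI. Qed.
Lemma cmul0r b : b '** 0 = 0.
Proof. by have := cmulDr b 0 0; rewrite addr0 -{1}[b '** 0]addr0 => /addrI. Qed.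
Lemma cmulZl k a b : (k *: a) '** b = k *: (a '** b).
Proof. by have := cmul_linearl b k a 0; rewrite /= cmul0l !addr0. Qed.
Lemma cmulZr k a b : a '** (k *: b) = k *: (a '** b).
Proof. by have := cmul_linearr a k b 0; rewrite /= cmul0r !addr0. Qed.
Lemma cmulNl a b : (- a) '** b = - (a '** b).
Proof. by rewrite -[- a]scaleN1r cmulZl scaleN1r. Qed.
Lemma cmulNr a b : a '** (- b) = - (a '** b).
Proof. by rewrite -[- b]scaleN1r cmulZr scaleN1r. Qed.
Lemma cmulBl a a' b : (a - a') '** b = a '** b - a' '** b.
Proof. by rewrite cmulDl cmulNl. Qed.
Lemma cmulBr a b b' : a '** (b - b') = a '** b - a '** b'.
Proof. by rewrite cmulDr cmulNr. Qed.

Lemma cstarD a b : cstar (a + b) = cstar a + cstar b.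
Proof. by have := cstar_antilinear 1 a b; rewrite rmorph1 !scale1r. Qed.
Lemma cstar0 : cstar (0 : A) = 0.
Proof. by have := cstarD 0 0; rewrite addr0 -{1}[cstar 0]addr0 => /addrI. Qed.
Lemma cstarZ k a : cstar (k *: a) = k^* *: cstar a.
Proof. by have := cstar_antilinear k a 0; rewrite cstar0 !addr0. Qed.
Lemma cstarZr (r : R) a : cstar (r%:C%C *: a) = r%:C%C *: cstar a.
Proof. by rewrite cstarZ conj_real. Qed.
Lemma cstarN a : cstar (- a) = - cstar a.
Proof. by rewrite -[- a]scaleN1r cstarZ rmorphN1 scaleN1r. Qed.
Lemma cstarB a b : cstar (a - b) = cstar a - cstar b.
Proof. by rewrite cstarD cstarN. Qed.
Lemma cstar1 : cstar one = one.
Proof. by rewrite -[LHS]cmul1l -{1}[one]cstarK -cstarM cmul1l cstarK. Qed.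

Lemma rnorm_cmul a b : rnorm (a '** b) <= rnorm a * rnorm b.
Proof. by have := cmul_norm a b; rewrite !rnormE -rmorphM lecR. Qed.

Lemma rnorm_cstar_identity a : rnorm (cstar a '** a) = rnorm a ^+ 2.
Proof. by have := cstar_identity a; rewrite !rnormE -rmorphXn /= => -[]. Qed.

Lemma rnorm_cstar a : rnorm (cstar a) = rnorm a.
Proof.
suff h b : rnorm b <= rnorm (cstar b).
  by apply/eqP; rewrite eq_le h -{2}(cstarK a) h.
have [b0|b0] := eqVneq (rnorm b) 0; first by rewrite b0 rnorm_ge0.
have bp : 0 < rnorm b by rewrite lt_def b0 rnorm_ge0.
rewrite -(ler_pM2r bp); apply: le_trans (rnorm_cmul _ _).
by rewrite rnorm_cstar_identity expr2.
Qed.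

Lemma rnorm_sqr x : cstar x = x -> rnorm (x '** x) = rnorm x ^+ 2.
Proof. by move=> xs; rewrite -rnorm_cstar_identity xs. Qed.

(** The C*-identity gives [r = r ^+ 2] for the norm [r] of the unit; the value 0 occurs in the zero
    algebra. *)
Lemma rnorm_one : rnorm one <= 1.
Proof.
have := rnorm_cstar_identity one; rewrite cstar1 cmul1l.
have := rnorm_ge0 one; move: (rnorm one) => r r0 rr; nra.
Qed.

Definition ccommute a b : Prop := a '** b = b '** a.

Fixpoint rsqrt_iter n : R :=
  if n is m.+1 then 2^-1 * (1 + rsqrt_iter m ^+ 2) else 0.

Fixpoint csqrt_iter x n : A :=
  if n is m.+1 then 2^-1%:C%C *: (x + csqrt_iter x m '** csqrt_iter x m) else 0.

Lemma rsqrt_iter_bound n : 0 <= rsqrt_iter n <= 1.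
Proof.
elim: n => [|n IH] /=; first by rewrite lexx ler01.
have [h0 h1] := andP IH; move: (rsqrt_iter n) h0 h1 => r h0 h1.
by apply/andP; split; nra.
Qed.

Lemma rsqrt_iter_homo : {homo rsqrt_iter : m n / (m <= n)%N >-> m <= n}.
Proof.
apply: homo_leq => [x|y x z|n]; [exact: lexx|exact: le_trans|].
have [_ _] := andP (rsqrt_iter_bound n).
by rewrite /=; move: (rsqrt_iter n) => r; have := sqr_ge0 (r - 1); nra.
Qed.

Lemma rsqrt_iter_cauchy (e : R) : 0 < e -> exists N, forall m n, (N <= m)%N ->
  (m <= n)%N -> rsqrt_iter n - rsqrt_iter m < e.
Proof.
move=> e0; have hs : has_sup (range rsqrt_iter).
  split; first by exists 0, 0%N.
  by exists 1 => _ [n _ <-]; have /andP[] := rsqrt_iter_bound n.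
have [_ [N _ <-] Ne] := sup_adherent e0 hs.
exists N => m n Nm mn; have := rsqrt_iter_homo Nm.
have : rsqrt_iter n <= sup (range rsqrt_iter) by apply: sup_upper_bound => //; exists n.
lra.
Qed.

Lemma half_double a : 2^-1%:C%C *: (a + a) = a.
Proof.
rewrite scalerDr -scalerDl (_ : _ + _ = 1) ?scale1r //.
by apply: complexP; rewrite ?ReD ?ImD /=; field.
Qed.

Lemma csqrt_iter_commute x z n : ccommute x z -> ccommute (csqrt_iter x n) z.
Proof.
rewrite /ccommute => xz; elim: n => [|n IH] /=; first by rewrite cmul0l cmul0r.
by rewrite cmulZl cmulZr cmulDl cmulDr xz -cmulA IH cmulA IH cmulA.
Qed.

Lemma csqrt_iter_commute2 x m n : ccommute (csqrt_iter x m) (csqrt_iter x n).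
Proof.
by apply: csqrt_iter_commute; apply/esym; apply: csqrt_iter_commute.
Qed.

Lemma csqrt_iter_star x n : cstar x = x -> cstar (csqrt_iter x n) = csqrt_iter x n.
Proof.
move=> xs; elim: n => [|n IH] /=; first exact: cstar0.
by rewrite cstarZr cstarD cstarM IH xs.
Qed.

Lemma csqrt_iter_norm x n : rnorm x <= 1 -> rnorm (csqrt_iter x n) <= rsqrt_iter n.
Proof.
move=> x1; elim: n => [|n IH] /=; first by rewrite rnorm0.
rewrite rnormZE cabs_real ger0_norm ?invr_ge0 // ler_wpM2l ?invr_ge0 //.
apply: le_trans (rnormD _ _) _; apply: lerD => //.
apply: le_trans (rnorm_cmul _ _) _.
by rewrite expr2 ler_pM ?rnorm_ge0.
Qed.

(** Since iterates commute, the next increment is [(y - z) (y + z) / 2] for consecutive iterates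
    [z], [y]. The scalar increments satisfy the same recursion, so domination propagates by
    induction. *)
Lemma csqrt_iter_step x n : rnorm x <= 1 ->
  rnorm (csqrt_iter x n.+1 - csqrt_iter x n) <= rsqrt_iter n.+1 - rsqrt_iter n.
Proof.
move=> x1; elim: n => [|n IH].
  rewrite !subr0 /= cmul0l addr0 rnormZE cabs_real ger0_norm ?invr_ge0 //.
  by rewrite ler_wpM2l ?invr_ge0 // expr0n addr0.
set y := csqrt_iter x n.+1 in IH *; set z := csqrt_iter x n in IH *.
have yz : y '** z = z '** y := csqrt_iter_commute2 x n.+1 n.
rewrite -[csqrt_iter x n.+2]/(2^-1%:C%C *: (x + y '** y)).
have -> : 2^-1%:C%C *: (x + y '** y) - y = 2^-1%:C%C *: ((y - z) '** (y + z)).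
  rewrite {2}/y /= -/z -scalerBr; congr (_ *: _).
  by rewrite cmulBl !cmulDr yz addrKA (addrC x) addrKA.
rewrite rnormZE cabs_real ger0_norm ?invr_ge0 //.
have ny := csqrt_iter_norm n.+1 x1; have nz := csqrt_iter_norm n x1.
have h1 : rnorm (y + z) <= rsqrt_iter n.+1 + rsqrt_iter n.
  by apply: le_trans (rnormD _ _) _; exact: lerD.
have h2 := rnorm_cmul (y - z) (y + z).
have h3 := ler_pM (rnorm_ge0 (y - z)) (rnorm_ge0 (y + z)) IH h1.
rewrite -[rsqrt_iter n.+2]/(2^-1 * (1 + rsqrt_iter n.+1 ^+ 2)).
have -> : 2^-1 * (1 + rsqrt_iter n.+1 ^+ 2) - rsqrt_iter n.+1 =
    2^-1 * ((rsqrt_iter n.+1 - rsqrt_iter n) * (rsqrt_iter n.+1 + rsqrt_iter n)).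
  by rewrite /=; ring.
by rewrite ler_wpM2l ?invr_ge0 //; exact: le_trans h3.
Qed.

Lemma csqrt_iter_dist x m n : rnorm x <= 1 -> (m <= n)%N ->
  rnorm (csqrt_iter x n - csqrt_iter x m) <= rsqrt_iter n - rsqrt_iter m.
Proof.
move=> x1; elim: n => [|n IH]; first by rewrite leqn0 => /eqP ->; rewrite !subrr rnorm0.
rewrite leq_eqVlt => /orP[/eqP ->|]; first by rewrite !subrr rnorm0.
rewrite ltnS => /IH {}IH; rewrite -(subrK (csqrt_iter x n) (csqrt_iter x n.+1)) -addrA.
apply: le_trans (rnormD _ _) _.
by have := csqrt_iter_step n x1; lra.
Qed.

(* [1 - y] is a square root of [1 - x]. The iterates of [y |-> (x + y^2) / 2]
   have nonnegative coefficients as polynomials in [x], so their increments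
   are dominated by those of the scalar iteration at [x = 1]. *)
Lemma cstar_sqrt_iter_limit x : cstar x = x -> rnorm x <= 1 ->
  exists y, [/\ cstar y = y, rnorm y <= 1, x + y '** y = y + y &
    forall z, ccommute x z -> ccommute y z].
Proof.
move=> xs x1; pose u := csqrt_iter x.
have u1 n : rnorm (u n) <= 1.
  apply: le_trans (csqrt_iter_norm n x1) _.
  by have /andP[] := rsqrt_iter_bound n.
have /rcauchy_tends[y uy] : rcauchy u.
  move=> e /rsqrt_iter_cauchy[N NP]; exists N => m n Nm Nn.
  have [mn|/ltnW nm] := leqP m n.
    by rewrite rnormC; apply: le_lt_trans (csqrt_iter_dist x1 mn) _; exact: NP.
  by apply: le_lt_trans (csqrt_iter_dist x1 nm) _; exact: NP.
have y1 : rnorm y <= 1 by exact: rtends_le uy.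
exists y; split=> // [||z xz]; apply/eqP; rewrite -subr_eq0; apply/eqP.
- apply: (@rnorm_small _ _ 2) => e e0; have [N /(_ _ (leqnn N)) NP] := uy e e0.
  have -> : cstar y - y = - cstar (u N - y) + (u N - y).
    by rewrite cstarB (csqrt_iter_star _ xs) opprB addrA subrK.
  by apply: le_trans (rnormD _ _) _; rewrite rnormN rnorm_cstar; lra.
(* As [2 u_(N+1) = x + u_N^2], the defect [x + y^2 - 2 y] consists of two terms [u_(N+1) - y] and
   two terms [u_N - y] multiplied by elements of norm at most 1: hence the constant 4. *)
- apply: (@rnorm_small _ _ 4) => e e0; have [N NP] := uy e e0.
  have h1 := NP _ (leqnn N); have h2 := NP _ (leqnSn N).
  have -> : x + y '** y - (y + y) =
      (u N.+1 - y) + (u N.+1 - y) - ((u N - y) '** u N + y '** (u N - y)).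
    have uNE : u N.+1 + u N.+1 = x + u N '** u N.
      by rewrite /u /= -scalerDr half_double.
    rewrite cmulBl cmulBr (addrA (_ - y '** u N)) subrK [in RHS]addrACA uNE -opprD opprB [in RHS]addrAC.
    by rewrite [in RHS]addrACA subrr addr0.
  apply: le_trans (rnormD _ _) _; rewrite rnormN.
  have h3 := rnormD (u N.+1 - y) (u N.+1 - y).
  have h4 := rnormD ((u N - y) '** u N) (y '** (u N - y)).
  have h5 : rnorm ((u N - y) '** u N) <= e.
    apply: le_trans (rnorm_cmul _ _) _; apply: le_trans (ltW h1).
    by rewrite ler_piMr ?rnorm_ge0.
  have h6 : rnorm (y '** (u N - y)) <= e.
    apply: le_trans (rnorm_cmul _ _) _; apply: le_trans (ltW h1).
    by rewrite ler_piMl ?rnorm_ge0.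
  lra.
- apply: (@rnorm_small _ _ (2 * rnorm z)) => e e0.
  have [N /(_ _ (leqnn N)) NP] := uy e e0.
  have -> : y '** z - z '** y = z '** (u N - y) - (u N - y) '** z.
    have uz : u N '** z = z '** u N := csqrt_iter_commute N xz.
    by rewrite cmulBl cmulBr uz opprB [in RHS]addrC addrA subrK.
  apply: le_trans (rnormD _ _) _; rewrite rnormN.
  have h1 := rnorm_cmul z (u N - y); have h2 := rnorm_cmul (u N - y) z.
  have := rnorm_ge0 z; nra.
Qed.

(** [b = 1 - y] for the limit [y] of the iteration. The clause on [one - b] stands in for
    positivity: it allows a second application, with [one - b] as argument, which yields a square
    root of [b]. The commutation clause replaces membership in the closed subalgebra generated by
    [x]. *)
Lemma cstar_sqrt x : cstar x = x -> rnorm x <= 1 ->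
  exists b, [/\ cstar b = b, rnorm (one - b) <= 1, b '** b = one - x &
    forall z, ccommute x z -> ccommute b z].
Proof.
move=> xs x1; have [y [ys y1 yE yC]] := cstar_sqrt_iter_limit xs x1.
exists (one - y); split=> [|||z /yC yz].
- by rewrite cstarB cstar1 ys.
- by rewrite opprB addrC subrK.
- have -> : x = y + y - y '** y by rewrite -yE addrK.
  by rewrite cmulBl !cmulBr !cmul1l cmul1r -[y + y - _]addrA [in RHS]opprD addrA.
- by rewrite /ccommute cmulBl cmulBr cmul1l cmul1r yz.
Qed.

(* [u = x + i y] satisfies [u^* u = x^2 + y^2]. *)
Lemma rnorm_sum_squares x y (r : R) : cstar x = x -> cstar y = y ->
  ccommute x y -> 0 <= r -> x '** x + y '** y = (r ^+ 2)%:C%C *: one -> rnorm x <= r.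
Proof.
move=> xs ys xy r0 xyr; pose u := x + 'i%C *: y.
have us : cstar u = x - 'i%C *: y.
  rewrite cstarD xs cstarZ ys (_ : 'i%C^* = - 'i%C) ?scaleNr //.
  by apply: complexP; rewrite ?Re_conj ?Im_conj ?ReN ?ImN /= ?oppr0.
have uu : cstar u '** u = (r ^+ 2)%:C%C *: one.
  rewrite us /u cmulBl !cmulDr !cmulZr !cmulZl !scalerA -xyr xy.
  have -> : 'i%C * 'i%C = -1 :> R[i] by rewrite -expr2 sqr_i.
  by rewrite scaleN1r opprD opprK addrA addrK.
have ur : rnorm u <= r.
  rewrite -(@ler_pXn2r _ 2) ?nnegrE ?rnorm_ge0 // -rnorm_cstar_identity uu.
  rewrite rnormZE cabs_real ger0_norm ?exprn_ge0 //.
  by rewrite ler_piMr ?exprn_ge0 // rnorm_one.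
have -> : x = 2^-1%:C%C *: (u + cstar u).
  by rewrite us addrACA subrr addr0 half_double.
rewrite rnormZE cabs_real ger0_norm ?invr_ge0 //.
have := rnormD u (cstar u); rewrite rnorm_cstar; lra.
Qed.

End cstar_algebra.

Section hilbert_space.
Context (R : realType) (H : hilbertType R).

Lemma hilbert_inner_product : inner_product (@inner R H).
Proof.
split=> [k x x' y|x y|x|x].
- exact: inner_linearl.
- exact: inner_conj.
- by rewrite inner_norm exprn_ge0.
- by rewrite inner_norm => /eqP; rewrite expf_eq0 /= normr_eq0 => /eqP.
Qed.

Lemma ipnorm_inner (x : H) : ipnorm inner x = rnorm x.
Proof.
apply: (@pexpIrn _ 2); rewrite ?nnegrE ?ipnorm_ge0 ?rnorm_ge0 //.
by rewrite (ipnorm_sqr hilbert_inner_product) inner_norm rnormE -rmorphXn.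
Qed.

End hilbert_space.

(** * Representations are contractive, faithful ones isometric *)

Section representations.
Context (R : realType) (A : cstarAlgType R) (H : hilbertType R).
Implicit Types (theta : A -> H -> H) (a b : A) (v w : H).
Local Notation "a '** b" := (cmul a b) (at level 40, left associativity).
Local Notation one := (cone : A).
Local Notation nrm := (ipnorm (@inner R H)).
Let ipH := hilbert_inner_product H.

Section one_representation.
Variable theta : A -> H -> H.
Hypothesis rep : representation theta.

Lemma rep_linear a : linear (theta a).
Proof. by have [/(_ a)[]] := rep. Qed.
Lemma repD a b v : theta (a + b) v = theta a v + theta b v.
Proof. by have [_ + _ _] := rep => /(_ 1 a b v); rewrite !scale1r. Qed.
Lemma rep0 v : theta 0 v = 0.
Proof. by have := repD 0 0 v; rewrite addr0 -{1}[theta 0 v]addr0 => /addrI. Qed.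
Lemma repZ k a v : theta (k *: a) v = k *: theta a v.
Proof. by have [_ + _ _] := rep => /(_ k a 0 v); rewrite !addr0 rep0 addr0. Qed.
Lemma repN a v : theta (- a) v = - theta a v.
Proof. by rewrite -[- a]scaleN1r repZ scaleN1r. Qed.
Lemma repB a b v : theta (a - b) v = theta a v - theta b v.
Proof. by rewrite repD repN. Qed.
Lemma repM a b v : theta (a '** b) v = theta a (theta b v).
Proof. by have [_ _ + _] := rep; exact. Qed.
Lemma rep_adj a v w : inner (theta (cstar a) v) w = inner v (theta a w).
Proof. by have [_ _ _] := rep; exact. Qed.
Lemma rep_vZ a k v : theta a (k *: v) = k *: theta a v.
Proof. exact: (linear_homog (rep_linear a)). Qed.
Lemma rep_v0 a : theta a 0 = 0.
Proof. by have := rep_vZ a 0 0; rewrite !scale0r. Qed.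
Lemma rep_vD a v w : theta a (v + w) = theta a v + theta a w.
Proof. by have := rep_linear a 1 v w; rewrite !scale1r. Qed.
Lemma rep_vB a v w : theta a (v - w) = theta a v - theta a w.
Proof. by rewrite rep_vD -scaleN1r rep_vZ scaleN1r. Qed.

Lemma rep_sqr a v : complex.Re (inner (theta (cstar a '** a) v) v) = nrm (theta a v) ^+ 2.
Proof. by rewrite repM rep_adj (ipnorm_sqr ipH). Qed.

Lemma rep_sa_sqr a v : cstar a = a ->
  complex.Re (inner (theta (a '** a) v) v) = nrm (theta a v) ^+ 2.
Proof. by move=> sa; rewrite -rep_sqr sa. Qed.

Lemma Re_inner_le v w : complex.Re (inner v w) <= nrm v * nrm w.
Proof.
exact: le_trans (le_trans (ler_norm _) (Re_le_cabs _)) (Cauchy_Schwarz ipH _ _).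
Qed.

(** A representation may be non-unital, so [theta one] is only a projection; its quadratic form is
    [nrm (theta one v) ^+ 2], and Cauchy-Schwarz concludes. *)
Lemma rep_one_le v : complex.Re (inner (theta one v) v) <= nrm v ^+ 2.
Proof.
have h1 := rep_sa_sqr v (cstar1 A); rewrite cmul1l in h1.
have h2 := Re_inner_le (theta one v) v; have := ipnorm_ge0 inner v.
have := ipnorm_ge0 inner (theta one v).
by rewrite h1 in h2 *; move: (nrm v) (nrm _) h2 => p q h2 *; nra.
Qed.

(* [r^2 - a^* a = r^2 b^2] with [b] self-adjoint. *)
Lemma rep_contractive a v : nrm (theta a v) <= rnorm a * nrm v.
Proof.
(* A bound strictly above [rnorm a] is positive and can be divided by, also when [a = 0]. *)
suff h r : rnorm a < r -> nrm (theta a v) <= r * nrm v.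
  apply/ler_addgt0Pr => e e0.
  have d0 : 0 < nrm v + 1 by rewrite ltr_wpDl // ipnorm_ge0.
  apply: le_trans (h (rnorm a + e / (nrm v + 1)) _) _; first by rewrite ltrDl divr_gt0.
  rewrite mulrDl lerD2l -mulrA ger_pMr // mulrC ler_pdivrMr // mul1r lerDl //.
move=> ar; have r0 : 0 < r := le_lt_trans (rnorm_ge0 _) ar.
pose x := (r ^- 2)%:C%C *: (cstar a '** a).
have xs : cstar x = x by rewrite cstarZr cstarM cstarK.
have r2 : 0 <= r ^- 2 by rewrite invr_ge0 exprn_ge0 // ltW.
have x1 : rnorm x <= 1.
  rewrite rnormZE rnorm_cstar_identity cabs_real ger0_norm // mulrC ler_pdivrMr ?exprn_gt0 //.
  by rewrite mul1r ler_pXn2r ?nnegrE ?rnorm_ge0 ?ltW.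
have [b [bs _ bE _]] := cstar_sqrt xs x1.
have := rep_sa_sqr v bs; rewrite bE repB (ipBl ipH) ReD ReN {1}/x repZ (ipZl ipH).
rewrite ReM /= mul0r subr0 rep_sqr => h1.
have h2 := rep_one_le v; have h3 := sqr_ge0 (nrm (theta b v)).
rewrite -(@ler_pXn2r _ 2) ?nnegrE ?mulr_ge0 ?ipnorm_ge0 ?(ltW r0) //.
rewrite exprMn -ler_pdivrMl ?exprn_gt0 //; lra.
Qed.

End one_representation.

(** An order argument in disguise. [y] is a positive multiple of [x^2 - r^2], [p] plays the role of
    its absolute value and [d = p + y] that of twice its positive part. The bound makes the form of
    [theta y] nonpositive on the range of [theta d], which forces [theta d = 0]; injectivity then
    gives [y = - p = - c^2], so [x^2] and the square of a commuting self-adjoint element add up to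
    [r^2]. *)
Lemma faithful_sa_bound theta x (r : R) : faithful_representation theta ->
  cstar x = x -> 0 <= r -> (forall v, nrm (theta x v) <= r * nrm v) -> rnorm x <= r.
Proof.
move=> [rep inj] xs r0 xr.
pose y0 := x '** x - (r ^+ 2)%:C%C *: one.
pose m := rnorm y0 + 1.
have m0 : 0 < m by rewrite ltr_wpDl // rnorm_ge0.
pose y := m^-1%:C%C *: y0.
have y0s : cstar y0 = y0 by rewrite cstarB cstarM xs cstarZr cstar1.
have ys : cstar y = y by rewrite cstarZr y0s.
have y1 : rnorm y <= 1.
  rewrite rnormZE cabs_real ger0_norm ?invr_ge0 ?(ltW m0) // ler_pdivrMl // mulr1.
  by rewrite lerDl.
have y2s : cstar (y '** y) = y '** y by rewrite cstarM ys.
have y21 : rnorm (y '** y) <= 1 by rewrite rnorm_sqr // exprn_ile1 // rnorm_ge0.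
(* Roots are available only for [1 - z] with [z] in the unit ball. So a root of [y^2] is taken in
   two steps: [b^2 = 1 - y^2], whence [b] has norm at most 1, and then [p^2 = 1 - b^2 = y^2]. *)
have [b [bs _ bE bC]] := cstar_sqrt y2s y21.
have by_ : ccommute b y by apply: bC; rewrite /ccommute cmulA.
have b1 : rnorm b <= 1.
  apply: (@rnorm_sum_squares _ _ b y) => //.
  by rewrite bE subrK expr1n scale1r.
have b2s : cstar (b '** b) = b '** b by rewrite cstarM bs.
have b21 : rnorm (b '** b) <= 1 by rewrite rnorm_sqr // exprn_ile1 // rnorm_ge0.
have [p [ps p1 pE pC]] := cstar_sqrt b2s b21.
have pp : p '** p = y '** y by rewrite pE bE opprB addrC subrK.
have oneps : cstar (one - p) = one - p by rewrite cstarB cstar1 ps.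
(* The norm clause on [one - p] makes [p] itself a square, [p = c^2]. *)
have [c [cs _ cE cC]] := cstar_sqrt oneps p1.
have {}cE : c '** c = p by rewrite cE opprB addrC subrK.
have py : ccommute p y.
  by apply: pC; rewrite /ccommute -cmulA by_ !cmulA by_.
have cx z : ccommute x z -> ccommute c z.
  move=> xz; apply: cC; rewrite /ccommute cmulBl cmulBr cmul1l cmul1r.
  congr (_ - _); apply: pC.
  have yz : ccommute y z.
    rewrite /ccommute cmulZl cmulZr cmulBl cmulBr cmulZl cmulZr cmul1l cmul1r.
    by rewrite -cmulA xz cmulA xz cmulA.
  have bz : ccommute b z by apply: bC; rewrite /ccommute -cmulA yz cmulA yz cmulA.
  by rewrite /ccommute -cmulA bz cmulA bz cmulA.
pose d := p + y.
have ds : cstar d = d by rewrite cstarD ps ys.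
have pd : p '** d = y '** d by rewrite !cmulDr py pp addrC.
have pyd : (p - y) '** d = 0 by rewrite cmulBl pd subrr.
(* On [w = theta d v] the forms of [theta p] and [theta y] agree because [p d = y d]; the first is
   [nrm (theta c w) ^+ 2], the second is at most 0. *)
have thpd v : theta (p '** d) v = 0.
  pose w := theta d v.
  have h1 : complex.Re (inner (theta p w) w) - complex.Re (inner (theta y w) w) = 0.
    by rewrite -ReN -ReD -(ipBl ipH) -(repB rep) -(repM rep) pyd (rep0 rep) (ip0l ipH).
  have h2 : complex.Re (inner (theta p w) w) = nrm (theta c w) ^+ 2.
    by rewrite -cE (rep_sa_sqr rep).
  (* The unit acts as the identity on the range of [theta d], although perhaps not on all of [H]. *)
  have h3 : theta one w = w by rewrite /w -(repM rep) cmul1l.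
  have h4 : complex.Re (inner (theta y w) w) <= 0.
    rewrite /y (repZ rep) (ipZl ipH) ReM /= mul0r subr0 pmulr_rle0 ?invr_gt0 //.
    rewrite (repB rep) (repZ rep) h3 (ipBl ipH) (ipZl ipH) ReD ReN (rep_sa_sqr rep) //.
    rewrite ReM /= mul0r subr0 -(ipnorm_sqr ipH) -exprMn subr_le0.
    by rewrite ler_pXn2r ?nnegrE ?mulr_ge0 ?ipnorm_ge0.
  have h5 : nrm (theta c w) = 0.
    have h6 := sqr_ge0 (nrm (theta c w)); have : nrm (theta c w) ^+ 2 = 0 by lra.
    by move=> /eqP; rewrite expf_eq0 /= => /eqP.
  rewrite (repM rep) -/w -cE (repM rep) (ipnorm_eq0 ipH h5) (rep_v0 rep) //.
(* [d^2 = p d + y d = 2 p d] is killed by [theta], hence so is [d], being self-adjoint. *)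
have d0 : d = 0.
  apply: inj; apply/funext => v; rewrite (rep0 rep); apply: (ipnorm_eq0 ipH).
  apply/eqP; rewrite -[_ == 0](expf_eq0 _ 2) -(rep_sa_sqr rep) //.
  by rewrite [d '** d]cmulDl -pd (repD rep) thpd addr0 (ip0l ipH).
have yE : y = - (c '** c) by rewrite cE; apply/eqP; rewrite -addr_eq0 addrC; exact/eqP.
pose s := (Num.sqrt m)%:C%C : R[i].
apply: (@rnorm_sum_squares _ _ x (s *: c)) => //.
- by rewrite cstarZr cs.
- by rewrite /ccommute cmulZl cmulZr; congr (_ *: _); apply/esym/cx.
- rewrite cmulZl cmulZr scalerA -rmorphM -expr2 sqr_sqrtr ?(ltW m0) //=.
  have -> : c '** c = - y by rewrite yE opprK.
  rewrite /y scalerN scalerA -rmorphM mulfV ?gt_eqF //= scale1r.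
  by rewrite opprB addrC subrK.
Qed.

End representations.

Lemma adjoint_bound (R : realType) (V : lmodType R[i]) (ip : V -> V -> R[i])
    (S T : V -> V) (c : R) : inner_product ip ->
  (forall x y, ip (S x) y = ip x (T y)) ->
  (forall x, ipnorm ip (T x) <= c * ipnorm ip x) ->
  forall x, ipnorm ip (S x) <= c * ipnorm ip x.
Proof.
move=> ipV ST Tc x; have [S0|S0] := eqVneq (ipnorm ip (S x)) 0.
  by rewrite S0; apply: le_trans (Tc x); exact: ipnorm_ge0.
have Sp : 0 < ipnorm ip (S x) by rewrite lt_def S0 ipnorm_ge0.
rewrite -(ler_pM2r Sp) -expr2 (ipnorm_sqr ipV) ST.
apply: le_trans (le_trans (ler_norm _) (Re_le_cabs _)) _.
apply: le_trans (Cauchy_Schwarz ipV _ _) _.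
rewrite mulrAC [leRHS]mulrC ler_wpM2l ?ipnorm_ge0 //.
Qed.

(** If [t > c > 0], Bernoulli's inequality makes [(t / c) ^+ (2 ^ k)] unbounded in [k], against the
    bound [D]. *)
Lemma le_of_pow2_le (R : realType) (t c D : R) : 0 <= t -> 0 <= c ->
  (forall k, t ^+ (2 ^ k) <= D * c ^+ (2 ^ k)) -> t <= c.
Proof.
move=> t0 c0 tD; rewrite leNgt; apply/negP => ct.
have [cz|cz] := eqVneq c 0.
  by have := tD 0%N; rewrite expn0 !expr1 cz mulr0 => /(lt_le_trans _); rewrite -cz => /(_ _ ct); rewrite ltxx.
have cp : 0 < c by rewrite lt_def cz.
pose q := t / c; have q1 : 0 < q - 1 by rewrite subr_gt0 /q ltr_pdivlMr // mul1r.
have qD k : q ^+ (2 ^ k) <= D.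
  by rewrite expr_div_n ler_pdivrMr ?exprn_gt0.
have bern m : 1 + m%:R * (q - 1) <= q ^+ m.
  elim: m => [|m IH]; first by rewrite mul0r addr0 expr0.
  rewrite exprS -natr1; have : 0 <= m%:R * (q - 1) by rewrite mulr_ge0 // ltW.
  have : (q - 1) * (m%:R * (q - 1)) >= 0 by rewrite mulr_ge0 ?mulr_ge0 // ltW.
  by move: (m%:R) (q ^+ m) IH => M P IH; nra.
have [k kD] : exists k : nat, D / (q - 1) < k%:R.
  exists (Num.bound (D / (q - 1))); apply: archi_boundP.
  by rewrite divr_ge0 ?(ltW q1) //; have := qD 0%N; rewrite expn0 expr1; lra.
have := le_trans (bern _) (qD k); apply/negP; rewrite -ltNge.
have : D < k%:R * (q - 1) by rewrite -ltr_pdivrMr.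
have : (k%:R : R) <= (2 ^ k)%:R by rewrite ler_nat ltnW // ltn_expl.
by move: (k%:R) ((2 ^ k)%:R) => K L; nra.
Qed.

(** * Matrices over [A]: comparison of two representations *)

Section matrix_norms.
Context (R : realType) (A : cstarAlgType R) (H : hilbertType R) (n : nat).
Implicit Types (theta : A -> H -> H) (a b : 'I_n -> 'I_n -> A) (x y : 'I_n -> H).
Local Notation nrm := (ipnorm (@inner R H)).
Let ipH := hilbert_inner_product H.
Local Notation ipHn := (@ipn R H inner n).
Let ipHnP : inner_product ipHn := ipn_inner_product ipH n.

(** The C*-identity reduces [a] to the self-adjoint [a^* a]. Together with [rep_contractive] this
    says that a faithful representation is isometric. *)
Lemma faithful_bound theta (a : A) (r : R) : faithful_representation theta ->
  0 <= r -> (forall v, nrm (theta a v) <= r * nrm v) -> rnorm a <= r.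
Proof.
move=> faith r0 ar; have rep := faith.1.
rewrite -(@ler_pXn2r _ 2) ?nnegrE ?rnorm_ge0 // -rnorm_cstar_identity.
apply: (faithful_sa_bound faith); rewrite ?exprn_ge0 //.
  by rewrite cstarM cstarK.
move=> v; rewrite (repM rep) expr2 -mulrA.
apply: le_trans (_ : r * nrm (theta a v) <= _); last by rewrite ler_wpM2l.
by apply: (adjoint_bound ipH) ar _ => x y; rewrite (rep_adj rep).
Qed.

Definition amxmul a b : 'I_n -> 'I_n -> A := fun i k => \sum_j cmul (a i j) (b j k).
Definition amxstar a : 'I_n -> 'I_n -> A := fun i j => cstar (a j i).
Definition amxop theta a := mxop (fun i j => theta (a i j)).
Definition amx_bounded theta a (c : R) : Prop :=
  forall x, ipnorm ipHn (amxop theta a x) <= c * ipnorm ipHn x.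

Lemma amxstarM a b : amxstar (amxmul a b) = amxmul (amxstar b) (amxstar a).
Proof.
apply/funext => i; apply/funext => j; rewrite /amxstar /amxmul.
rewrite (big_morph _ (@cstarD _ _) (@cstar0 _ _)).
by apply: eq_bigr => k _; rewrite cstarM.
Qed.

Lemma amxstarK a : amxstar (amxstar a) = a.
Proof. by apply/funext => i; apply/funext => j; rewrite /amxstar cstarK. Qed.

Section one_representation.
Variable theta : A -> H -> H.
Hypothesis rep : representation theta.

Lemma rep_sum (I : Type) (r : seq I) (F : I -> A) v :
  theta (\sum_(i <- r) F i) v = \sum_(i <- r) theta (F i) v.
Proof.
elim: r => [|i r IH]; first by rewrite !big_nil (rep0 rep).
by rewrite !big_cons (repD rep) IH.
Qed.

Lemma rep_vsum (I : Type) (r : seq I) (F : I -> H) (a : A) :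
  theta a (\sum_(i <- r) F i) = \sum_(i <- r) theta a (F i).
Proof.
elim: r => [|i r IH]; first by rewrite !big_nil (rep_v0 rep).
by rewrite !big_cons (rep_vD rep) IH.
Qed.

Lemma amxopM a b x : amxop theta (amxmul a b) x = amxop theta a (amxop theta b x).
Proof.
apply/funext => i; rewrite /amxop /mxop /amxmul.
under eq_bigr do rewrite rep_sum.
under [RHS]eq_bigr do rewrite rep_vsum.
rewrite exchange_big; apply: eq_bigr => j _; apply: eq_bigr => k _.
exact: (repM rep).
Qed.

Lemma amxop_adj a x y :
  ipHn (amxop theta (amxstar a) x) y = ipHn x (amxop theta a y).
Proof.
rewrite /ipn /amxop /mxop.
under eq_bigr do rewrite (ip_suml ipH).
transitivity (\sum_i \sum_j inner (x i) (theta (a i j) (y j))).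
  rewrite exchange_big; apply: eq_bigr => i _; apply: eq_bigr => j _.
  by rewrite (rep_adj rep).
apply: eq_bigr => i _; rewrite (ipC ipH) (ip_suml ipH) rmorph_sum.
by apply: eq_bigr => j _; rewrite (ipC ipH).
Qed.

Lemma amxop_linear a : linear (amxop theta a).
Proof.
move=> k x y; apply/funext => i.
rewrite -[RHS]/(k *: amxop theta a x i + amxop theta a y i) /amxop /mxop.
rewrite scaler_sumr -big_split; apply: eq_bigr => j _.
exact: (rep_linear rep).
Qed.

Lemma amx_bounded_entry a (c : R) i j v : amx_bounded theta a c ->
  nrm (theta (a i j) v) <= c * nrm v.
Proof.
move=> /(_ (fun k => if k == j then v else 0)).
have -> : ipnorm ipHn (fun k => if k == j then v else 0) = nrm v.
  rewrite (ipnorm_ipn ipH) (bigD1 j) //= eqxx big1 ?addr0 ?sqrtr_sqr ?ger0_norm ?ipnorm_ge0 //.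
  by move=> k /negbTE ->; rewrite (ipnorm0 ipH) expr0n.
apply: le_trans; apply: le_trans (le_ipnorm_ipn ipH _ i).
rewrite /amxop /mxop (bigD1 j) //= eqxx big1 ?addr0 // => k /negbTE ->.
exact: (rep_v0 rep).
Qed.

Lemma amx_bounded_crude a (c : R) : (forall i j, rnorm (a i j) <= c) ->
  amx_bounded theta a ((n * n)%:R * c).
Proof.
move=> ac x; apply: le_trans (ipnorm_ipn_le ipH _) _.
apply: (@le_trans _ _ (\sum_(i < n) \sum_(j < n) c * ipnorm ipHn x)).
  apply: ler_sum => i _; apply: le_trans (ipnorm_sum ipH _ _) _.
  apply: ler_sum => j _; apply: le_trans (rep_contractive rep _ _) _.
  by rewrite ler_pM ?rnorm_ge0 ?ipnorm_ge0 // (le_ipnorm_ipn ipH).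
by rewrite !sumr_const !card_ord -mulrnA -mulrA mulr_natl.
Qed.

Lemma amx_bounded_mul a b (c d : R) : 0 <= c -> amx_bounded theta a c ->
  amx_bounded theta b d -> amx_bounded theta (amxmul a b) (c * d).
Proof.
move=> c0 ac bd x; rewrite amxopM; apply: le_trans (ac _) _.
by rewrite -mulrA ler_wpM2l.
Qed.

End one_representation.

Section two_representations.
Variables theta1 theta2 : A -> H -> H.
Hypotheses (faith1 : faithful_representation theta1) (rep2 : representation theta2).
Let rep1 := faith1.1.

(* On self-adjoint matrices both operator norms satisfy [|h^2| = |h|^2], so the
   crude comparison with an [n]-dependent constant, applied to [h^(2^k)],
   improves to constant [1]. *)
Lemma amx_bounded_transfer_sa h (c : R) : 0 <= c -> amxstar h = h ->
  amx_bounded theta1 h c -> amx_bounded theta2 h c.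
Proof.
move=> c0 hs hc; pose p k := iter k (fun g => amxmul g g) h.
have ps k : amxstar (p k) = p k by elim: k => //= k IH; rewrite amxstarM IH.
have pc k : amx_bounded theta1 (p k) (c ^+ (2 ^ k)).
  elim: k => [|k IH] //; rewrite expnS mul2n -addnn exprD.
  by apply: (amx_bounded_mul rep1) => //; rewrite exprn_ge0.
(* The only passage from [theta1] to [theta2]: each entry of [p k] is bounded in the norm of [A]
   through the faithful [theta1], and [theta2] is contractive on entries. *)
have p2 k : amx_bounded theta2 (p k) ((n * n)%:R * c ^+ (2 ^ k)).
  apply: (amx_bounded_crude rep2) => i j.
  apply: (faithful_bound faith1); rewrite ?exprn_ge0 // => v.
  exact: (amx_bounded_entry rep1).
apply: (unit_ball_bound ipHnP (f := ipnorm ipHn \o amxop theta2 h)).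
  move=> k x /=.
  by rewrite (linear_homog (amxop_linear rep2 h)) (ipnormZ ipHnP) cabs_real.
move=> x x1 /=.
apply: (@le_of_pow2_le _ _ _ (n * n)%:R) => [||k]; [exact: ipnorm_ge0|by []|].
(* Self-adjointness gives [|p_m x|^2 = <p_(m+1) x, x>] for [p_m = h^(2^m)], and [x] lies in the unit
   ball. *)
have step m : ipnorm ipHn (amxop theta2 (p m) x) ^+ 2 <=
    ipnorm ipHn (amxop theta2 (p m.+1) x).
  rewrite (ipnorm_sqr ipHnP) -(amxop_adj rep2) (ipC ipHnP) ps -(amxopM rep2) Re_conj.
  apply: le_trans (le_trans (ler_norm _) (Re_le_cabs _)) _.
  apply: le_trans (Cauchy_Schwarz ipHnP _ _) _.
  by rewrite ler_piMl ?ipnorm_ge0.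
apply: (@le_trans _ _ (ipnorm ipHn (amxop theta2 (p k) x))).
  elim: k => [|k IH]; first by rewrite expn0 expr1.
  apply: le_trans (step k); rewrite expnS mulnC exprM.
  by rewrite ler_pXn2r ?nnegrE ?exprn_ge0 ?ipnorm_ge0.
apply: le_trans (p2 k x) _; rewrite ler_piMr //.
by rewrite mulr_ge0 ?exprn_ge0.
Qed.

(** The C*-identity for operators on [H^n] reduces [a] to the self-adjoint matrix [a^* a], with
    bound [c ^+ 2]. *)
Lemma amx_bounded_transfer a (c : R) : 0 <= c ->
  amx_bounded theta1 a c -> amx_bounded theta2 a c.
Proof.
move=> c0 ac; pose h := amxmul (amxstar a) a.
have hs : amxstar h = h by rewrite amxstarM amxstarK.
have hc : amx_bounded theta2 h (c * c).
  apply: amx_bounded_transfer_sa; rewrite ?mulr_ge0 //.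
  apply: (amx_bounded_mul rep1) => //.
  by apply: (adjoint_bound ipHnP) ac => x y; exact: (amxop_adj rep1).
move=> x; rewrite -(@ler_pXn2r _ 2) ?nnegrE ?mulr_ge0 ?ipnorm_ge0 //.
rewrite (ipnorm_sqr ipHnP) -(amxop_adj rep2) -(amxopM rep2).
apply: le_trans (le_trans (ler_norm _) (Re_le_cabs _)) _.
apply: le_trans (Cauchy_Schwarz ipHnP _ _) _.
by rewrite exprMn [in leRHS]expr2 [in leRHS]expr2 mulrA ler_wpM2r ?ipnorm_ge0.
Qed.

End two_representations.
End matrix_norms.

(** * Borel functions and the space L2 *)

Section borel_functions.
Context (R : realType) (G : ptopologicalType).

Lemma borel_openP (U : set G) : open U -> measurable (U : set (borel G)).
Proof. exact: sub_sigma_algebra. Qed.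

Lemma borel_continuous (E : topologicalType) (f : G -> E) :
  continuous f -> borel_fun f.
Proof. by move=> /continuousP cf U oU; apply: borel_openP; exact: cf. Qed.

Lemma borel_cst (E : topologicalType) (x : E) : borel_fun (fun _ : G => x).
Proof.
by apply: borel_continuous; exact: cst_continuous.
Qed.

Lemma borel_closed (E : topologicalType) (f : G -> E) (C : set E) :
  borel_fun f -> closed C -> measurable (f @^-1` C : set (borel G)).
Proof.
move=> bf cC; rewrite -[C]setCK preimage_setC; apply: measurableC.
exact: (bf _ (closed_openC cC)).
Qed.

Lemma borel_pieces (E : topologicalType) (idx : G -> nat) (g : nat -> G -> E) :
  (forall j, measurable (idx @^-1` [set j] : set (borel G))) ->
  (forall j, borel_fun (g j)) -> borel_fun (fun s => g (idx s) s).
Proof.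
move=> mi mg U oU.
rewrite (_ : _ @^-1` U = \bigcup_j (idx @^-1` [set j] `&` g j @^-1` U)).
  by apply: bigcupT_measurable => j; apply: measurableI; [exact: mi|exact: mg].
apply/seteqP; split=> [s Us|s [j _ [/= <-]]] //.
by exists (idx s).
Qed.

(** [C k] is the closed set of points at distance at least [1 / (k + 1)] from the complement of [U];
    [f s] lies in [U] exactly when some [C k] eventually contains the [f_ n s]. *)
Lemma borel_limit (V : normedModType R[i]) (f_ : nat -> G -> V) (f : G -> V) :
  (forall n, borel_fun (f_ n)) -> (forall s, rtends (f_ ^~ s) (f s)) -> borel_fun f.
Proof.
move=> mf ff U oU.
pose C k := [set x : V | forall y, rnorm (x - y) < k.+1%:R^-1 -> U y].
have cC k : closed (C k).
  rewrite -openC; apply/open_rnormP => x /= /existsNP[y /not_implyP[xy nUy]].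
  exists (k.+1%:R^-1 - rnorm (x - y)); first by rewrite subr_gt0.
  move=> z; rewrite ltrBrDr => xz /(_ y) h; apply/nUy/h; apply: le_lt_trans xz.
  by rewrite (rnormC x z); apply: le_trans (rnormD _ _); rewrite addrA subrK.
rewrite (_ : _ @^-1` U =
    \bigcup_k \bigcup_N \bigcap_(n in [set n | (N <= n)%N]) (f_ n @^-1` C k)).
  apply: bigcupT_measurable => k; apply: bigcupT_measurable => N.
  by apply: bigcap_measurableType => n _; exact: borel_closed.
apply/seteqP; split=> [s /= Us|s [k _ [N _ NC]] /=].
  have /open_rnormP/(_ _ Us)[e e0 eU] := oU.
  have [k kP] := eps_invS (divr_gt0 e0 (ltr0n R 2)).
  have k0 : 0 < k.+1%:R^-1 :> R by rewrite invr_gt0 ltr0n.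
  have [N NP] := ff s _ k0.
  exists k => //; exists N => // n /= /NP fn y ny; apply: eU.
  rewrite -(subrK (f_ n s) (f s)) -addrA; apply: le_lt_trans (rnormD _ _) _.
  rewrite rnormC; move: fn ny (kP k (leqnn k)); move: (k.+1%:R^-1) => q *; lra.
have k0 : 0 < k.+1%:R^-1 :> R by rewrite invr_gt0 ltr0n.
have [M MP] := ff s _ k0.
exact: (NC _ (leq_maxl N M) _ (MP _ (leq_maxr N M))).
Qed.

Lemma dense_sequence (T : ptopologicalType) : separable T ->
  exists d : nat -> T, forall U : set T, open U -> U !=set0 -> exists j, U (d j).
Proof.
move=> [D cD dD].
have [d dP] : exists d : nat -> T, D `<=` range d.
  move: cD => /pfcard_geP [->|[h]]; first by exists (fun=> point).
  by exists h => x /(@surj _ _ _ _ h)[n _ <-]; exists n.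
exists d => U oU U0; have [x [Ux Dx]] := dD U U0 oU.
by have [j _ jx] := dP _ Dx; exists j; rewrite jx.
Qed.

(** Measurable selection from a countable cover: the least admissible index has measurable
    fibres. *)
Lemma borel_first_index (P : nat -> set G) :
  (forall j, measurable (P j : set (borel G))) -> (forall s, exists j, P j s) ->
  exists idx : G -> nat, (forall s, P (idx s) s) /\
    forall j, measurable (idx @^-1` [set j] : set (borel G)).
Proof.
move=> mP exP.
have exb s : exists j, `[< P j s >] by have [j Pj] := exP s; exists j; apply/asboolP.
exists (fun s => ex_minn (exb s)); split=> [s|j].
  by case: ex_minnP => m /asboolP.
rewrite (_ : _ @^-1` _ = P j `&` \bigcap_(i in [set i | (i < j)%N]) ~` P i).
  apply: measurableI => //; apply: bigcap_measurableType => i _.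
  exact: measurableC.
apply/seteqP; split=> [s /=|s [/= Pj jmin]].
  case: ex_minnP => m /asboolP Pm mmin <-; split=> // i /= im Pi.
  by have := mmin i; rewrite leqNgt im; move=> /(_ (asboolT Pi)).
case: ex_minnP => m /asboolP Pm mmin; apply/eqP; rewrite eqn_leq.
rewrite mmin ?(asboolT Pj) //= leqNgt; apply/negP => mj.
exact: (jmin m mj).
Qed.

(** [f] is approximated by functions with values in a dense sequence, for which the claim holds
    piece by piece; continuity of each [Phi s] carries it to the limit. This is how fields such as
    [theta (alpha s^-1 a) (f s)] are seen to be Borel. *)
Lemma borel_caratheodory (E V : normedModType R[i]) (Phi : G -> E -> V) (f : G -> E) :
  separable E -> (forall x, borel_fun (Phi^~ x)) -> (forall s, continuous (Phi s)) ->
  borel_fun f -> borel_fun (fun s => Phi s (f s)).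
Proof.
move=> /dense_sequence[d dP] mPhi cPhi mf.
have /choice[idx idxP] : forall n, exists idx : G -> nat,
    (forall s, rnorm (d (idx s) - f s) < n.+1%:R^-1) /\
    forall j, measurable (idx @^-1` [set j] : set (borel G)).
  move=> n; apply: (borel_first_index (P := fun j => f @^-1` [set x | rnorm (d j - x) < n.+1%:R^-1])).
    by move=> j; apply: mf; exact: open_rnorm_ball.
  move=> s /=; have [|j] := dP [set x | rnorm (f s - x) < n.+1%:R^-1] (open_rnorm_ball _ _).
    by exists (f s); rewrite /= subrr rnorm0 invr_gt0 ltr0n.
  by exists j; rewrite rnormC.
apply: (@borel_limit _ (fun n s => Phi s (d (idx n s)))).
  by move=> n; apply: (borel_pieces (g := fun j s => Phi s (d j))) => //; exact: (idxP n).2.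
move=> s; apply/rtends_cvg.
have : (fun n => d (idx n s)) @ \oo --> f s.
  apply/rtends_cvg => e /eps_invS[N NP]; exists N => n /NP; apply: lt_trans.
  exact: (idxP n).1.
by move=> dd; apply: continuous_cvg; [exact: cPhi|exact: dd].
Qed.

Lemma borel_comp_continuous (E F : topologicalType) (phi : E -> F) (f : G -> E) :
  continuous phi -> borel_fun f -> borel_fun (phi \o f).
Proof.
by move=> /continuousP cphi mf U oU; rewrite comp_preimage; apply: mf; exact: cphi.
Qed.

Lemma borel_EFin_measurable (f : G -> R) :
  (forall a, measurable ([set s | a < f s] : set (borel G))) ->
  measurable_fun [set: borel G] f.
Proof.
move=> fa mD; apply: (measurability _ (RGenOInfty.measurableE R)) => //.
move=> _ [_ [a ->]] <-; rewrite setTI.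
rewrite (_ : f @^-1` _ = [set s | a < f s]) //.
by apply/seteqP; split => s /=; rewrite in_itv /= andbT.
Qed.

Lemma open_Re_gt (a : R) : open [set z : R[i]^o | a < complex.Re z].
Proof.
apply/open_rnormP => z /= az; exists (complex.Re z - a); first by rewrite subr_gt0.
move=> y h; have := le_lt_trans (Re_le_cabs (z - y)) h.
by rewrite ReD ReN; have := ler_norm (complex.Re z - complex.Re y); lra.
Qed.

Lemma open_Im_gt (a : R) : open [set z : R[i]^o | a < complex.Im z].
Proof.
apply/open_rnormP => z /= az; exists (complex.Im z - a); first by rewrite subr_gt0.
move=> y h; have := le_lt_trans (Im_le_cabs (z - y)) h.
by rewrite ImD ImN; have := ler_norm (complex.Im z - complex.Im y); lra.
Qed.

Lemma borel_Re (f : G -> R[i]^o) : borel_fun f ->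
  measurable_fun [set: borel G] (fun s => complex.Re (f s)).
Proof. by move=> mf; apply: borel_EFin_measurable => a; exact: (mf _ (@open_Re_gt a)). Qed.

Lemma borel_Im (f : G -> R[i]^o) : borel_fun f ->
  measurable_fun [set: borel G] (fun s => complex.Im (f s)).
Proof. by move=> mf; apply: borel_EFin_measurable => a; exact: (mf _ (@open_Im_gt a)). Qed.

End borel_functions.

(** * Integrals of complex functions *)

Section complex_integral.
Context (R : realType) (G : topologicalGroupType) (mu : {measure set (borel G) -> \bar R}).
Implicit Types (f g : G -> R[i]) (h : G -> R).

Definition cintegrable f : Prop :=
  mu.-integrable setT (fun s => (complex.Re (f s))%:E) /\
  mu.-integrable setT (fun s => (complex.Im (f s))%:E).

Lemma cintegrable_dominated f h : borel_fun (f : G -> R[i]^o) ->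
  mu.-integrable setT (fun s => (h s)%:E) -> (forall s, cabs (f s) <= h s) ->
  cintegrable f.
Proof.
move=> mf ih fh; split; apply: le_integrable ih => //.
- by apply/measurable_EFinP; exact: borel_Re.
- move=> s _; rewrite !abse_EFin lee_fin (le_trans (Re_le_cabs _)) // (le_trans (fh s)) //.
  exact: ler_norm.
- by apply/measurable_EFinP; exact: borel_Im.
- move=> s _; rewrite !abse_EFin lee_fin (le_trans (Im_le_cabs _)) // (le_trans (fh s)) //.
  exact: ler_norm.
Qed.

Lemma integrable_lin (k : R) (h1 h2 : G -> R) :
  mu.-integrable setT (fun s => (h1 s)%:E) -> mu.-integrable setT (fun s => (h2 s)%:E) ->
  mu.-integrable setT (fun s => (k * h1 s + h2 s)%:E).
Proof.
move=> i1 i2; under eq_fun do rewrite EFinD EFinM.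
by apply: integrableD => //; exact: integrableZl.
Qed.

Lemma Rintegral_lin (k : R) (h1 h2 : G -> R) :
  mu.-integrable setT (fun s => (h1 s)%:E) -> mu.-integrable setT (fun s => (h2 s)%:E) ->
  \int[mu]_s (k * h1 s + h2 s) = k * \int[mu]_s h1 s + \int[mu]_s h2 s.
Proof.
move=> i1 i2; rewrite RintegralD //.
  by rewrite RintegralZl.
by rewrite (_ : _ \o _ = (fun s => k%:E * (h1 s)%:E)%E) //; exact: integrableZl.
Qed.

Lemma cintegral_lin k f g : cintegrable f -> cintegrable g ->
  cintegral mu (fun s => k * f s + g s) = k * cintegral mu f + cintegral mu g.
Proof.
move=> [fR fI] [gR gI]; apply: complexP.
  rewrite ReD ReM -mulNr -addrA /=.
  under eq_Rintegral do rewrite ReD ReM -mulNr -addrA.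
  rewrite Rintegral_lin ?Rintegral_lin //; exact: integrable_lin.
rewrite ImD ImM -addrA /=.
under eq_Rintegral do rewrite ImD ImM -addrA.
rewrite Rintegral_lin ?Rintegral_lin //; exact: integrable_lin.
Qed.

Lemma eq_cintegral f g : (forall s, f s = g s) -> cintegral mu f = cintegral mu g.
Proof. by move=> fg; congr cintegral; apply/funext. Qed.

Lemma ae_mono (P Q : borel G -> Prop) : (forall s, P s -> Q s) ->
  {ae mu, forall s, P s} -> {ae mu, forall s, Q s}.
Proof. by move=> PQ; apply: filterS. Qed.

Lemma ae_and (P Q : borel G -> Prop) :
  {ae mu, forall s, P s} -> {ae mu, forall s, Q s} -> {ae mu, forall s, P s /\ Q s}.
Proof. by apply: filterS2. Qed.

Lemma ae_eq_cintegral f g : borel_fun (f : G -> R[i]^o) -> borel_fun (g : G -> R[i]^o) ->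
  {ae mu, forall s, f s = g s} -> cintegral mu f = cintegral mu g.
Proof.
move=> mf mg fg; rewrite /cintegral /Rintegral; congr (fine _ +i* fine _)%C.
- apply: ae_eq_integral => //; do ?[by apply/measurable_EFinP; exact: borel_Re].
  by apply: ae_mono fg => s /= -> _.
- apply: ae_eq_integral => //; do ?[by apply/measurable_EFinP; exact: borel_Im].
  by apply: ae_mono fg => s /= -> _.
Qed.

Lemma cintegral_conj f : cintegrable f ->
  cintegral mu (fun s => (f s)^*) = (cintegral mu f)^*.
Proof.
move=> [_ fI]; apply: complexP; rewrite ?Re_conj ?Im_conj /=.
  by apply: eq_Rintegral => s _; rewrite Re_conj.
under eq_Rintegral do rewrite Im_conj -mulN1r.
by rewrite RintegralZl // mulN1r.
Qed.

(** The factor 2 comes from estimating real and imaginary parts separately; it is harmless for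
    boundedness, and in [pi_lambda_M] a tolerance [e / 2] absorbs it. *)
Lemma cabs_cintegral_le f h : borel_fun (f : G -> R[i]^o) ->
  mu.-integrable setT (fun s => (h s)%:E) -> (forall s, cabs (f s) <= h s) ->
  cabs (cintegral mu f) <= 2 * \int[mu]_s h s.
Proof.
move=> mf ih fh; have [fR fI] := cintegrable_dominated mf ih fh.
apply: le_trans (cabs_le_ReIm _) _ => /=; rewrite mulr_natl mulr2n; apply: lerD.
- apply: le_trans (le_normr_Rintegral _ fR) _ => //; apply: le_Rintegral => //.
    exact: integrable_norm.
  by move=> s _; exact: le_trans (Re_le_cabs _) _.
- apply: le_trans (le_normr_Rintegral _ fI) _ => //; apply: le_Rintegral => //.
    exact: integrable_norm.
  by move=> s _; exact: le_trans (Im_le_cabs _) _.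
Qed.

Lemma Rintegral_dominated (h_ : nat -> G -> R) h (g : G -> R) :
  (forall n, measurable_fun [set: borel G] (h_ n)) ->
  measurable_fun [set: borel G] h ->
  (forall s, h_ ^~ s @ \oo --> h s) -> mu.-integrable setT (fun s => (g s)%:E) ->
  (forall n s, `|h_ n s| <= g s) ->
  (fun n => \int[mu]_s h_ n s) @ \oo --> \int[mu]_s h s.
Proof.
move=> mh_ mh hh ig hg.
have [||||i _ c] := @dominated_convergence _ _ _ mu setT measurableT
  (fun n s => (h_ n s)%:E) (fun s => (h s)%:E) (fun s => (g s)%:E) _ _ _ ig.
- by move=> n; apply/measurable_EFinP.
- exact/measurable_EFinP.
- by apply: aeW => s _; apply: cvg_EFin; [exact: nearW|exact: hh].
- by apply: aeW => s n _; rewrite lee_fin.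
by apply: fine_cvg; rewrite fineK // integrable_fin_num.
Qed.

Lemma cintegral_dominated (f_ : nat -> G -> R[i]) f (g : G -> R) :
  (forall n, borel_fun (f_ n : G -> R[i]^o)) -> borel_fun (f : G -> R[i]^o) ->
  (forall s, (f_ ^~ s : nat -> R[i]^o) @ \oo --> (f s : R[i]^o)) ->
  mu.-integrable setT (fun s => (g s)%:E) -> (forall n s, cabs (f_ n s) <= g s) ->
  ((fun n => cintegral mu (f_ n)) : nat -> R[i]^o) @ \oo --> (cintegral mu f : R[i]^o).
Proof.
move=> mf_ mf ff ig fg; apply/rtends_cvg => e e0.
have e20 : 0 < e / 2 by rewrite divr_gt0.
(* One argument for both parts: [p] stands for [Re] or [Im]. *)
have partC (p : R[i] -> R) : (forall z w, p (z - w) = p z - p w) ->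
    (forall z, `|p z| <= cabs z) ->
    (forall n, measurable_fun [set: borel G] (fun s => p (f_ n s))) ->
    measurable_fun [set: borel G] (fun s => p (f s)) ->
    exists N, forall n, (N <= n)%N ->
      `|\int[mu]_s p (f s) - \int[mu]_s p (f_ n s)| < e / 2.
  move=> pB pc mp_ mp.
  have := @Rintegral_dominated (fun n s => p (f_ n s)) (fun s => p (f s)) g mp_ mp.
  case/(_ _ ig _)/cvgrPdist_lt/(_ _ e20) => [s|n s|N _ NP]; last by exists N.
    apply/cvgrPdist_lt => d d0; have /rtends_cvg/(_ _ d0)[N NP] := ff s.
    exists N => // n /NP; rewrite rnormC => h; rewrite -pB.
    exact: le_lt_trans (pc _) h.
  exact: le_trans (pc _) (fg n s).
have [|||N1 N1P] := partC (@complex.Re R) _ (@Re_le_cabs R).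
- by move=> z w; rewrite ReD ReN.
- by move=> n; exact: borel_Re.
- exact: borel_Re.
have [|||N2 N2P] := partC (@complex.Im R) _ (@Im_le_cabs R).
- by move=> z w; rewrite ImD ImN.
- by move=> n; exact: borel_Im.
- exact: borel_Im.
exists (maxn N1 N2) => n; rewrite geq_max => /andP[/N1P h1 /N2P h2].
rewrite rnormC; apply: (le_lt_trans (cabs_le_ReIm (cintegral mu f - cintegral mu (f_ n)))).
rewrite ReD ImD ReN ImN /=; lra.
Qed.

End complex_integral.

Section lipschitz.
Context (R : realType) (E V : normedModType R[i]).

Lemma rcontinuousP (f : E -> V) : continuous f <->
  forall x (e : R), 0 < e -> exists2 d : R, 0 < d &
    forall y, rnorm (x - y) < d -> rnorm (f x - f y) < e.
Proof.
split=> [cf x e e0|cf x].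
  have /cvg_ballP/(_ e%:C%C) := cf x; rewrite ltcR => /(_ e0)/nbhs_ballP[d d0 dP].
  have dE : d = (complex.Re d)%:C%C.
    by move: d0; rewrite /= ltcE; case: (d) => a b /= /andP[/eqP -> _].
  exists (complex.Re d); first by rewrite -(ltcR 0) -dE.
  by move=> y xy; apply/ball_rnormP; apply: dP; rewrite dE; apply/ball_rnormP.
apply/cvg_ballP => e e0.
have eE : e = (complex.Re e)%:C%C.
  by move: e0; case: (e) => a b; rewrite ltcE /= => /andP[/eqP -> _].
have [|d d0 dP] := cf x (complex.Re e); first by rewrite -(ltcR 0) -eE.
apply/nbhs_ballP; exists d%:C%C; first by rewrite /= ltcR.
by move=> y /ball_rnormP xy; rewrite eE; apply/ball_rnormP; exact: dP.
Qed.

Lemma lipschitz_rcontinuous (f : E -> V) (C : R) :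
  (forall x y, rnorm (f x - f y) <= C * rnorm (x - y)) -> continuous f.
Proof.
move=> fC; apply/rcontinuousP => x e e0.
have C0 : 0 < `|C| + 1 by rewrite ltr_wpDl.
exists (e / (`|C| + 1)) => [|y]; first by rewrite divr_gt0.
rewrite ltr_pdivlMr // mulrC; apply: le_lt_trans; apply: le_trans (fC x y) _.
rewrite ler_wpM2r ?rnorm_ge0 //; apply: le_trans (ler_norm _) _.
by rewrite lerDl.
Qed.

End lipschitz.

Section inner_continuity.
Context (R : realType) (H : hilbertType R).
Implicit Types x y : H.
Let ipH := hilbert_inner_product H.

Lemma inner_le x y : cabs (inner x y) <= rnorm x * rnorm y.
Proof. by have := Cauchy_Schwarz ipH x y; rewrite !ipnorm_inner. Qed.

Lemma inner_continuousl y : continuous (fun x => inner x y : R[i]^o).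
Proof.
apply: (@lipschitz_rcontinuous _ _ _ _ (rnorm y)) => x x'.
by rewrite -(ipBl ipH) mulrC; exact: inner_le.
Qed.

Lemma inner_continuousr x : continuous (fun y => inner x y : R[i]^o).
Proof.
apply: (@lipschitz_rcontinuous _ _ _ _ (rnorm x)) => y y'.
by rewrite -(ipBr ipH); exact: inner_le.
Qed.

End inner_continuity.

(** * Classes and representatives in L2 *)

Section L2_classes.
Context (R : realType) (G : topologicalGroupType).
Context (mu : {measure set (borel G) -> \bar R}) (H : separableHilbertType R).
Local Notation K := (L2 mu H).
Implicit Types (f g : G -> H) (x y z : K).
Local Notation sq f := (square_integrable mu f).

Lemma sq_lin k f g : sq f -> sq g -> sq (fun s => k *: f s + g s).
Proof.
move=> sf sg; have [_ /(_ k f g)] := sqint_submod mu H.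
by move=> /(_ (asboolT sf) (asboolT sg)) /asboolP.
Qed.

Lemma sq0 : sq (fun=> 0 : H).
Proof. by have [/asboolP] := sqint_submod mu H. Qed.

Lemma L2_class_eq f g : sq f -> sq g -> {ae mu, forall s, f s = g s} ->
  L2_class mu f = L2_class mu g.
Proof.
move=> sf sg fg; apply/eqP; rewrite /L2_class -Quotient.idealrBE; apply/asboolP.
apply: ae_mono fg => s /= fg.
rewrite -[LHS]/(sval (insubd (0 : sqfun mu H) f) s - sval (insubd (0 : sqfun mu H) g) s).
by rewrite -!/(\val _) !insubdK ?fg ?subrr //; exact/asboolP.
Qed.

Lemma L2_fun_sq x : sq (L2_fun x).
Proof. by have /asboolP := valP (repr (x : Quotient.quot (@null_sqfun R G mu H))). Qed.

Lemma L2_funK x : L2_class mu (L2_fun x) = x.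
Proof. by rewrite /L2_class /L2_fun valKd reprK. Qed.

Lemma L2_classK f : sq f -> {ae mu, forall s, L2_fun (L2_class mu f) s = f s}.
Proof.
move=> sf; pose u : sqfun mu H := insubd 0 f.
have uf : sval u = f by rewrite -/(\val u) insubdK //; exact/asboolP.
have : repr (L2_class mu f : Quotient.quot (@null_sqfun R G mu H)) - u \in @null_sqfun R G mu H.
  by rewrite Quotient.idealrBE reprK.
move=> /asboolP; apply: ae_mono => s /= /eqP; rewrite subr_eq0 => /eqP.
by rewrite -uf.
Qed.

Lemma L2_class_ext f g : sq f -> (forall s, f s = g s) -> L2_class mu f = L2_class mu g.
Proof. by move=> _ fg; congr L2_class; apply/funext. Qed.

Lemma L2_eq x y : {ae mu, forall s, L2_fun x s = L2_fun y s} -> x = y.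
Proof. by move=> xy; rewrite -(L2_funK x) -(L2_funK y); apply: L2_class_eq => //; exact: L2_fun_sq. Qed.

(** Representatives are chosen class by class, so that linearity is available only almost
    everywhere. *)
Lemma L2_fun_lin k x y :
  {ae mu, forall s, L2_fun (k *: x + y) s = k *: L2_fun x s + L2_fun y s}.
Proof.
pose Q := Quotient.quot (@null_sqfun R G mu H).
pose u := k *: repr (x : Q) + repr (y : Q) : sqfun mu H.
have : repr (k *: x + y : Q) - u \in @null_sqfun R G mu H.
  rewrite Quotient.idealrBE reprK /u raddfD /= reprK; apply/eqP.
  by congr (_ + _).
by move=> /asboolP; apply: ae_mono => s /= /eqP; rewrite subr_eq0 => /eqP.
Qed.

Lemma L2_class_lin k f g : sq f -> sq g ->
  L2_class mu (fun s => k *: f s + g s) = k *: L2_class mu f + L2_class mu g.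
Proof.
move=> sf sg; apply: L2_eq.
have := ae_and (L2_classK sf) (L2_classK sg).
move=> /(ae_and (L2_fun_lin k (L2_class mu f) (L2_class mu g))).
move=> /(ae_and (L2_classK (sq_lin k sf sg))).
by apply: ae_mono => s /= [-> [-> [-> ->]]].
Qed.

Lemma L2_class0 : L2_class mu (fun=> 0 : H) = 0.
Proof.
have := L2_class_lin (-1) sq0 sq0; rewrite (scaleN1r (L2_class mu (fun=> 0 : H))) [RHS]addNr => <-.
by apply: L2_class_ext => [|s]; [exact: sq0|rewrite scaler0 addr0].
Qed.

Lemma borel_inner f g : borel_fun f -> borel_fun g ->
  borel_fun (fun s => inner (f s) (g s) : R[i]^o).
Proof.
move=> bf bg; apply: (borel_caratheodory (Phi := fun s e => inner e (g s) : R[i]^o)) => //.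
- exact: separable_subproof.
- by move=> e; apply: (borel_comp_continuous (phi := fun y : H => inner e y : R[i]^o)) => //;
    exact: inner_continuousr.
- by move=> s; exact: inner_continuousl.
Qed.

Lemma sq_integrable f : sq f -> mu.-integrable setT (fun s => (rnorm (f s) ^+ 2)%:E).
Proof.
move=> [bf fi]; apply/integrableP; split.
  by apply/measurable_EFinP; apply: measurable_funX; exact: borel_rnorm.
under eq_integral => s _ do rewrite gee0_abs ?lee_fin ?sqr_ge0 //.
exact: fi.
Qed.

Lemma cintegrable_inner f g : sq f -> sq g -> cintegrable mu (fun s => inner (f s) (g s)).
Proof.
move=> sf sg.
apply: (@cintegrable_dominated _ _ _ _ (fun s => 1 * rnorm (f s) ^+ 2 + rnorm (g s) ^+ 2)).
- exact: borel_inner sf.1 sg.1.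
- by apply: integrable_lin; exact: sq_integrable.
- move=> s; apply: le_trans (inner_le _ _) _.
  have := rnorm_ge0 (f s); have := rnorm_ge0 (g s).
  by move: (rnorm _) (rnorm _) => a b; nra.
Qed.

Lemma L2_inner_class f g : sq f -> sq g ->
  L2_inner (L2_class mu f) (L2_class mu g) = cintegral mu (fun s => inner (f s) (g s)).
Proof.
move=> sf sg; apply: ae_eq_cintegral.
- by apply: borel_inner; exact: (L2_fun_sq _).1.
- exact: borel_inner sf.1 sg.1.
- have := ae_and (L2_classK sf) (L2_classK sg).
  by apply: ae_mono => s /= [-> ->].
Qed.

Lemma L2_inner_self x : L2_inner x x = (\int[mu]_s (rnorm (L2_fun x s) ^+ 2))%:C%C.
Proof.
rewrite /L2_inner /cintegral; apply: complexP => /=.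
  by apply: eq_Rintegral => s _; rewrite inner_norm rnormE -rmorphXn.
rewrite (_ : (fun s => _) = fun=> 0); last first.
  by apply/funext => s; rewrite inner_norm rnormE -rmorphXn.
by rewrite /Rintegral integral0.
Qed.

Lemma L2_inner_product : inner_product (@L2_inner R G mu H).
Proof.
split=> [k x x' y|x y|x|x x0].
- rewrite -[in LHS](L2_funK x) -[in LHS](L2_funK x') -[in LHS](L2_funK y).
  have [sx sx' sy] := And3 (L2_fun_sq x) (L2_fun_sq x') (L2_fun_sq y).
  rewrite -L2_class_lin // L2_inner_class //; last exact: sq_lin.
  rewrite (eq_cintegral mu (g := fun s => k * inner (L2_fun x s) (L2_fun y s)
    + inner (L2_fun x' s) (L2_fun y s))); last by move=> s; rewrite inner_linearl.
  by rewrite cintegral_lin //; exact: cintegrable_inner.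
- rewrite /L2_inner -cintegral_conj; last by apply: cintegrable_inner; exact: L2_fun_sq.
  by apply: eq_cintegral => s; rewrite -inner_conj.
- by rewrite L2_inner_self lecR; apply: Rintegral_ge0 => s _; exact: sqr_ge0.
- have si := sq_integrable (L2_fun_sq x).
  have i0 : (\int[mu]_s `|(rnorm (L2_fun x s) ^+ 2)%:E| = 0)%E.
    under eq_integral => s _ do rewrite gee0_abs ?lee_fin ?sqr_ge0 //.
    rewrite -(fineK (integrable_fin_num measurableT si)); congr EFin.
    by have := L2_inner_self x; rewrite x0 => /(congr1 (@complex.Re R)) /esym.
  have /(ae_eq_integral_abs mu measurableT (measurable_int _ si)) xz := i0.
  rewrite -(L2_funK x) -L2_class0; apply: L2_class_eq; [exact: L2_fun_sq|exact: sq0|].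
  apply: ae_mono xz => s /= h; have /eqP := h I.
  by rewrite eqe expf_eq0 /= => /eqP /rnorm_eq0.
Qed.

Lemma L2_norm_sqr x :
  ((ipnorm (@L2_inner R G mu H) x ^+ 2)%:E = \int[mu]_s (rnorm (L2_fun x s) ^+ 2)%:E)%E.
Proof.
rewrite (ipnorm_sqr L2_inner_product) L2_inner_self /= fineK //.
by apply: integrable_fin_num => //; exact/sq_integrable/L2_fun_sq.
Qed.

Lemma L2_class_norm_sqr f : sq f ->
  ((ipnorm (@L2_inner R G mu H) (L2_class mu f) ^+ 2)%:E = \int[mu]_s (rnorm (f s) ^+ 2)%:E)%E.
Proof.
move=> sf; rewrite L2_norm_sqr; apply: ae_eq_integral => //.
- exact: measurable_int (sq_integrable (L2_fun_sq _)).
- exact: measurable_int (sq_integrable sf).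
- by apply: ae_mono (L2_classK sf) => s /= -> _.
Qed.

End L2_classes.

(** * Limits of rapidly converging sequences *)

Section L2_completeness.
Context (R : realType) (G : topologicalGroupType).
Context (mu : {measure set (borel G) -> \bar R}) (H : separableHilbertType R).
Local Notation K := (L2 mu H).
Implicit Types (f g : G -> H) (x y z : K).
Local Notation sq f := (square_integrable mu f).
Local Notation nrm := (ipnorm (@L2_inner R G mu H)).
Let ipK : inner_product (@L2_inner R G mu H) := L2_inner_product mu H.

Lemma sqB f g : sq f -> sq g -> sq (fun s => f s - g s).
Proof.
move=> sf sg; have := sq_lin (-1) sg sf.
by under eq_fun do rewrite scaleN1r addrC.
Qed.

Lemma L2_classB f g : sq f -> sq g ->
  L2_class mu (fun s => f s - g s) = L2_class mu f - L2_class mu g.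
Proof.
move=> sf sg; rewrite addrC -[- _]scaleN1r -L2_class_lin //.
by congr L2_class; apply/funext => s; rewrite scaleN1r addrC.
Qed.

Lemma L2_dist_sqr f g : sq f -> sq g ->
  ((nrm (L2_class mu f - L2_class mu g) ^+ 2)%:E =
    \int[mu]_s (rnorm (f s - g s) ^+ 2)%:E)%E.
Proof. by move=> sf sg; rewrite -L2_classB // L2_class_norm_sqr //; exact: sqB. Qed.

Lemma borel_if (B : set G) (V : topologicalType) (f g : G -> V) :
  measurable (B : set (borel G)) -> borel_fun f -> borel_fun g ->
  borel_fun (fun s => if `[< B s >] then f s else g s).
Proof.
move=> mB bf bg U oU.
rewrite (_ : _ @^-1` U = (B `&` f @^-1` U) `|` (~` B `&` g @^-1` U)).
  apply: measurableU; apply: measurableI => //; [exact: bf|exact: measurableC|exact: bg].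
apply/seteqP; split=> s /=; case: asboolP => Bs Us; [by left|by right|by case: Us => -[]|].
by case: Us => -[].
Qed.

Lemma sq_le f (h : G -> R) : borel_fun f ->
  mu.-integrable setT (fun s => (h s)%:E) -> (forall s, rnorm (f s) ^+ 2 <= h s) -> sq f.
Proof.
move=> bf /integrableP[mh hi] fh; split=> //; apply: le_lt_trans hi.
apply: ge0_le_integral => //.
- by move=> s _; rewrite lee_fin sqr_ge0.
- by apply/measurable_EFinP; apply: measurable_funX; exact: borel_rnorm.
- exact: measurableT_comp.
- by move=> s _; rewrite abse_EFin lee_fin (le_trans (fh s)) // ler_norm.
Qed.

Lemma geometric_half_sum n : \sum_(0 <= k < n) (2 ^- k : R) <= 2.
Proof.
suff -> : \sum_(0 <= k < n) (2 ^- k : R) = 2 - 2 * 2 ^- n.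
  by rewrite lerBlDr lerDl mulr_ge0 // invr_ge0 exprn_ge0.
elim: n => [|n IH]; first by rewrite big_nil expr0 invr1 mulr1 subrr.
by rewrite big_nat_recr //= IH exprS invfM; field; rewrite expf_neq0.
Qed.

(* A rapidly converging subsequence [f] of representatives is pointwise
   controlled by [S = sum_k 4^k |f_(k+1) - f_k|^2], which has a finite integral. *)
Lemma L2_rapid_limit (f : nat -> G -> H) : (forall k, sq (f k)) ->
  (forall k, (\int[mu]_s (rnorm (f k.+1 s - f k s) ^+ 2)%:E <= (16 ^- k)%:E)%E) ->
  exists g, sq g /\ exists C : R, forall m,
    (\int[mu]_s (rnorm (f m s - g s) ^+ 2)%:E <= (2 ^- m * C)%:E)%E.
Proof.
move=> sf fS.
(* The weight [4^k] serves two purposes: [4^k 16^-k <= 2^-k] bounds the integral of [S] by 2, and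
   [a k s <= S s] gives increments of norm at most [2^-k] times the square root of [S s], which are
   summable. *)
pose a k s : R := 4 ^+ k * rnorm (f k.+1 s - f k s) ^+ 2.
have a0 k s : 0 <= a k s by rewrite mulr_ge0 ?exprn_ge0 ?rnorm_ge0.
have ma k : measurable_fun [set: borel G] (fun s => (a k s)%:E).
  apply/measurable_EFinP; apply: measurable_funM => //; apply: measurable_funX.
  by apply: borel_rnorm; have [] := sqB (sf k.+1) (sf k).
pose S s : \bar R := (\sum_(0 <= k <oo) (a k s)%:E)%E.
have S0 s : (0 <= S s)%E by apply: nneseries_ge0 => k _ _; rewrite lee_fin.
have mS : measurable_fun [set: borel G] S.
  apply: ge0_emeasurable_sum => [k s _ _|k _]; [by rewrite lee_fin|exact: ma].
have S2 : (\int[mu]_s S s <= 2%:E)%E.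
  rewrite integral_nneseries //; last by move=> k s _; rewrite lee_fin.
  apply: lime_le; first by apply: is_cvg_nneseries => k _ _; apply: integral_ge0 => s _; rewrite lee_fin.
  apply: nearW => n; apply: (@le_trans _ _ (\sum_(0 <= k < n) (2 ^- k)%:E)%E); last first.
    by rewrite sumEFin lee_fin geometric_half_sum.
  apply: lee_sum => k _.
  rewrite (_ : (\int[mu]_s (a k s)%:E)%E =
      ((4 ^+ k)%:E * \int[mu]_s (rnorm (f k.+1 s - f k s) ^+ 2)%:E)%E); last first.
    rewrite -ge0_integralZl_EFin //; rewrite ?exprn_ge0 //.
    + by move=> s _; rewrite lee_fin sqr_ge0.
    + by apply/measurable_EFinP; apply: measurable_funX; apply: borel_rnorm; have [] := sqB (sf k.+1) (sf k).
  apply: (@le_trans _ _ ((4 ^+ k)%:E * (16 ^- k)%:E)%E); first by rewrite lee_wpmul2l ?lee_fin ?exprn_ge0.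
  rewrite -EFinM lee_fin -exprVn -exprMn -exprVn.
  by apply: lerXn2r; rewrite ?nnegrE ?mulr_ge0 ?invr_ge0 //; lra.
have aS k s : ((a k s)%:E <= S s)%E.
  apply: le_trans (nneseries_lim_ge k.+1 _) => [|n _ _]; last by rewrite lee_fin.
  by rewrite big_nat_recr //= leeDr // sume_ge0 // => i _; rewrite lee_fin.
pose c s : R := Num.sqrt (fine (S s)).
have c0 s : 0 <= c s by exact: sqrtr_ge0.
have Sc s : (S s < +oo)%E -> S s = (c s ^+ 2)%:E.
  move=> Ss; have finS : S s \is a fin_num by rewrite ge0_fin_numE.
  by rewrite /c sqr_sqrtr ?fineK //; apply: fine_ge0.
have p24 n : (2 ^- n) ^+ 2 = 4 ^- n :> R.
  by rewrite -!exprVn -exprM mulnC exprM; congr (_ ^+ _); field.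
have step s n : (S s < +oo)%E -> rnorm (f n.+1 s - f n s) <= 2 ^- n * c s.
  move=> /Sc Ss; rewrite -(@ler_pXn2r _ 2) ?nnegrE ?rnorm_ge0 ?mulr_ge0 ?invr_ge0 ?exprn_ge0 //.
  have := aS n s; rewrite Ss lee_fin /a exprMn p24.
  by rewrite -ler_pdivlMl ?exprn_gt0.
have fcauchy s m n : (S s < +oo)%E -> (m <= n)%N ->
    rnorm (f n s - f m s) <= 2 * (2 ^- m - 2 ^- n) * c s.
  move=> Ss; elim: n => [|n IH].
    by rewrite leqn0 => /eqP ->; rewrite !subrr rnorm0 mulr0 mul0r.
  rewrite leq_eqVlt => /orP[/eqP ->|]; first by rewrite !subrr rnorm0 mulr0 mul0r.
  rewrite ltnS => /IH {}IH; rewrite -(subrK (f n s) (f n.+1 s)) -addrA.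
  apply: le_trans (rnormD _ _) _; apply: le_trans (lerD (step _ _ Ss) IH) _.
  by rewrite -mulrDl ler_wpM2r // exprS invfM; move: (2 ^- m) (2 ^- n) => p q; lra.
have fbound s m n : (S s < +oo)%E -> (m <= n)%N ->
    rnorm (f n s - f m s) <= 2 * 2 ^- m * c s.
  move=> Ss mn; apply: le_trans (fcauchy s m n Ss mn) _.
  rewrite ler_wpM2r // ler_pM2l // gerBl invr_ge0 exprn_ge0 //.
have small (e : R) : 0 < e -> forall s, exists N, forall m, (N <= m)%N -> 2 * 2 ^- m * c s < e.
  move=> e0 s; have d0 : 0 < e / (2 * (c s + 1)).
    by rewrite divr_gt0 // mulr_gt0 // ltr_wpDl.
  have [N NP] := eps_invS d0; exists N => m /NP h.
  have h1 : 2 ^- m < e / (2 * (c s + 1)).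
    apply: le_lt_trans h; rewrite lef_pV2 ?posrE ?exprn_gt0 ?ltr0n //.
    by rewrite -natrX ler_nat ltn_expl.
  have h2 : 2 ^- m * (2 * (c s + 1)) < e by rewrite -ltr_pdivlMr // mulr_gt0 // ltr_wpDl.
  have h3 : 0 < 2 ^- m :> R by rewrite invr_gt0 exprn_gt0.
  by have := c0 s; move: (2 ^- m) h2 h3 => p; nra.
(* Where [S] is infinite, [g] is set to 0, and the approximants used for measurability are set to 0
   there too, so that convergence holds at every point. *)
have /choice[g gP] : forall s, exists l, ((S s < +oo)%E -> rtends (f^~ s) l) /\ (~ (S s < +oo)%E -> l = 0).
  move=> s; have [Ss|Ss] := pselect (S s < +oo)%E; last by exists 0.
  have [|l fl] := @rcauchy_tends _ _ (f^~ s); last by exists l.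
  move=> e e0; have [N NP] := small e e0 s; exists N => m n Nm Nn.
  have [mn|/ltnW nm] := leqP m n.
    by rewrite rnormC; apply: le_lt_trans (fbound s m n Ss mn) _; exact: NP.
  by apply: le_lt_trans (fbound s n m Ss nm) _; exact: NP.
have bg : borel_fun g.
  apply: (@borel_limit _ _ _ (fun k s => if `[< (S s < +oo)%E >] then f k s else 0)).
    move=> k; apply: borel_if; [|exact: (sf k).1|exact: borel_cst].
    by have := emeasurable_fun_infty_o measurableT mS +oo%E; rewrite setTI.
  move=> s; have [g1 g2] := gP s; case: asboolP => Ss; first exact: g1.
  by rewrite g2 // => e e0; exists 0%N => n _; rewrite subrr rnorm0.
(* The square of the tail bound [2 * 2^-m * c s]; where [S s] is infinite the right side is
   [+oo]. *)
have dist m s : ((rnorm (f m s - g s) ^+ 2)%:E <= (4 * 4 ^- m)%:E * S s)%E.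
  have [Ss|Ss] := pselect (S s < +oo)%E; last first.
    have -> : S s = +oo%E by case: (S s) (S0 s) Ss => [r| |] //= _ []; exact: ltry.
    by rewrite gt0_muley ?leey // lte_fin mulr_gt0 ?invr_gt0 ?exprn_gt0.
  rewrite (Sc s Ss) -EFinM lee_fin.
  have -> : 4 * 4 ^- m * c s ^+ 2 = (2 * 2 ^- m * c s) ^+ 2.
    by rewrite !exprMn p24; ring.
  rewrite ler_pXn2r ?nnegrE ?rnorm_ge0 ?mulr_ge0 ?invr_ge0 ?exprn_ge0 //.
  rewrite rnormC; have [/(_ Ss) fg _] := gP s.
  have gf : rtends (fun n => f (m + n)%N s - f m s) (g s - f m s).
    move=> e /fg[N NP]; exists N => n Nn; rewrite opprB addrA subrK.
    by apply: NP; exact: leq_trans Nn (leq_addl _ _).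
  by apply: rtends_le gf => n; apply: fbound => //; exact: leq_addr.
have Sint : mu.-integrable setT S.
  apply/integrableP; split=> //.
  under eq_integral => s _ do rewrite gee0_abs //.
  exact: le_lt_trans S2 (ltry _).
(* The integral of [S] is at most 2 and [4^-m <= 2^-m], whence the constant 8. *)
have sfg m : (\int[mu]_s (rnorm (f m s - g s) ^+ 2)%:E <= (2 ^- m * 8)%:E)%E.
  apply: (@le_trans _ _ ((4 * 4 ^- m)%:E * \int[mu]_s S s)%E).
    have k0 : 0 <= 4 * 4 ^- m :> R by rewrite mulr_ge0 ?invr_ge0 ?exprn_ge0.
    rewrite -ge0_integralZl //.
    apply: ge0_le_integral => //.
    + by move=> s _; rewrite lee_fin sqr_ge0.
    + apply/measurable_EFinP; apply: measurable_funX; apply: borel_rnorm.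
      apply: borelD; [exact: separable_subproof|exact: (sf m).1|].
      apply: (borel_comp_continuous (phi := fun x : H => - x)) bg.
      by apply: (@lipschitz_rcontinuous _ _ _ _ 1) => x y; rewrite -opprD rnormN mul1r.
    + exact: measurable_funeM.
  apply: (@le_trans _ _ ((4 * 4 ^- m)%:E * 2%:E)%E).
    by rewrite lee_wpmul2l // lee_fin mulr_ge0 ?invr_ge0 ?exprn_ge0.
  rewrite -EFinM lee_fin mulrAC mulrC (_ : 4 * 2 = 8); last by ring.
  rewrite ler_pM2r // lef_pV2 ?posrE ?exprn_gt0 //.
  by apply: lerXn2r; rewrite ?nnegrE //; lra.
exists g; split; last by exists 8.
have sg0 : sq (fun s => f 0%N s - g s).
  split; last by apply: le_lt_trans (sfg 0%N) (ltry _).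
  apply: borelD; [exact: separable_subproof|exact: (sf _).1|].
  apply: (borel_comp_continuous (phi := fun x : H => - x)) bg.
  by apply: (@lipschitz_rcontinuous _ _ _ _ 1) => x y; rewrite -opprD rnormN mul1r.
have := sqB (sf 0%N) sg0; under eq_fun do rewrite opprB addrC subrK.
exact.
Qed.

End L2_completeness.

(** * Completeness of L2 and density of simple functions *)

Section L2_density.
Context (R : realType) (G : topologicalGroupType).
Context (mu : {measure set (borel G) -> \bar R}) (H : separableHilbertType R).
Local Notation K := (L2 mu H).
Implicit Types (f g : G -> H) (x y z : K).
Local Notation sq f := (square_integrable mu f).
Local Notation nrm := (ipnorm (@L2_inner R G mu H)).
Let ipK : inner_product (@L2_inner R G mu H) := L2_inner_product mu H.

Lemma L2_complete : ip_complete (@L2_inner R G mu H).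
Proof.
move=> u uC.
have /choice[N NP] : forall k, exists N, forall m n, (N <= m)%N -> (N <= n)%N ->
    nrm (u m - u n) < 4 ^- k.
  by move=> k; apply: uC; rewrite invr_gt0 exprn_gt0.
(* With cumulative sums both [M k] and [M k.+1] are at least [N k], so consecutive terms of the
   subsequence are [4^-k]-close; the squares give the [16^-k] required above. *)
pose M k := (\sum_(0 <= i < k.+1) N i)%N.
have NM k : (N k <= M k)%N by rewrite /M big_nat_recr //= leq_addl.
have NMS k : (N k <= M k.+1)%N.
  by rewrite /M big_nat_recr //= (leq_trans (NM k)) // leq_addr.
pose f k := L2_fun (u (M k)).
have sf k : sq (f k) := L2_fun_sq _.
have [|g [sg [C gC]]] := L2_rapid_limit sf.
  move=> k; rewrite -L2_dist_sqr // !L2_funK lee_fin.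
  rewrite (_ : 16 ^- k = (4 ^- k) ^+ 2); last first.
    by rewrite -!exprVn -exprM mulnC exprM; congr (_ ^+ _); field.
  by apply: lerXn2r; rewrite ?nnegrE ?ipnorm_ge0 ?invr_ge0 ?exprn_ge0 // ltW // NP.
exists (L2_class mu g) => e e0.
have [k1 k1P] := eps_invS (divr_gt0 e0 (ltr0n R 2)).
have C0 : 0 < `|C| + 1 by rewrite ltr_wpDl.
have [k0 kP] := eps_invS (divr_gt0 (exprn_gt0 2 (divr_gt0 e0 (ltr0n R 2))) C0).
pose k := (k0 + k1)%N.
have uk : nrm (u (M k) - L2_class mu g) < e / 2.
  rewrite -(@ltr_pXn2r _ 2) ?nnegrE ?ipnorm_ge0 ?divr_ge0 ?(ltW e0) //.
  have := gC k; rewrite -L2_dist_sqr // L2_funK lee_fin => h; apply: le_lt_trans h _.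
  have h1 : 2 ^- k < (e / 2) ^+ 2 / (`|C| + 1).
    apply: le_lt_trans (kP k (leq_addr _ _)).
    by rewrite lef_pV2 ?posrE ?exprn_gt0 ?ltr0n // -natrX ler_nat ltn_expl.
  rewrite ltr_pdivlMr // in h1; apply: le_lt_trans h1.
  rewrite ler_wpM2l ?invr_ge0 ?exprn_ge0 //; apply: le_trans (ler_norm _) _.
  by rewrite lerDl.
exists (N k) => n Nn; apply: le_lt_trans (ipnormB ipK _ (u (M k)) _) _.
have h : nrm (u n - u (M k)) < e / 2.
  apply: lt_trans (NP k _ _ Nn (NM k)) _; apply: le_lt_trans (k1P k (leq_addl _ _)).
  by rewrite lef_pV2 ?posrE ?exprn_gt0 ?ltr0n // -natrX ler_nat ltn_expl.
lra.
Qed.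

Lemma integrable_indic_finite (B : set G) : measurable (B : set (borel G)) ->
  (mu B < +oo)%E -> mu.-integrable setT (fun s => (\1_B s : R)%:E).
Proof.
move=> mB muB; apply/integrableP; split.
  by apply/measurable_EFinP; exact: measurable_indic.
under eq_integral => s _ do rewrite gee0_abs ?lee_fin //.
by rewrite integral_indic // setIT.
Qed.

Definition indic_vec (B : set G) (h : H) : G -> H := fun s => if `[< B s >] then h else 0.

Lemma sq_indic_vec (B : set G) h : measurable (B : set (borel G)) -> (mu B < +oo)%E ->
  sq (indic_vec B h).
Proof.
move=> mB muB; apply: (@sq_le _ _ _ _ _ (fun s => rnorm h ^+ 2 * \1_B s)).
- by apply: borel_if => //; exact: borel_cst.
- under eq_fun do rewrite EFinM.
  by apply: integrableZl => //; exact: integrable_indic_finite.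
- move=> s; rewrite /indic_vec indicE; case: asboolP => Bs.
    by rewrite mem_set // mulr1.
  by rewrite memNset // mulr0 rnorm0 expr0n.
Qed.

(** Density of simple functions as an induction principle. The approximation has relative error:
    [g s] is the first point of a dense sequence within [t * rnorm (f s)] of [f s]. An absolute
    error would not be square integrable on a space of infinite measure, whereas here [f - g] and
    [g] are dominated by multiples of [f]. Cutting [g] off after finitely many values leaves a
    finite sum of indicator vectors. *)
Lemma L2_indic_ind (P : K -> Prop) :
  (forall x y, P x -> P y -> P (x + y)) ->
  (forall (B : set G) h, measurable (B : set (borel G)) -> (mu B < +oo)%E ->
     P (L2_class mu (indic_vec B h))) ->
  (forall x, (forall e : R, 0 < e -> exists2 y, P y & nrm (x - y) < e) -> P x) ->
  forall x, P x.
Proof.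
move=> PD PI Pcl x; pose f := L2_fun x; have sf : sq f := L2_fun_sq x.
have P0 : P 0.
  have := PI set0 0 measurable0; rewrite measure0 => /(_ (ltry _)).
  rewrite (_ : indic_vec set0 0 = fun=> 0) ?L2_class0 //.
  by apply/funext => s; rewrite /indic_vec; case: asboolP.
have [d dP] := dense_sequence (separable_subproof : separable H).
apply: Pcl => e e0.
have [t [t0 t1 te]] : exists t : R, [/\ 0 < t, t <= 1 / 2 & t * nrm x < e / 2].
  have c0 : 0 < nrm x + e + 1 by have := ipnorm_ge0 (@L2_inner R G mu H) x; lra.
  exists (e / 2 / (nrm x + e + 1)); split.
  - by rewrite !divr_gt0.
  - by rewrite ler_pdivrMr //; have := ipnorm_ge0 (@L2_inner R G mu H) x; lra.
  - rewrite mulrAC ltr_pdivrMr // ltr_pM2l ?divr_gt0 //.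
    by rewrite -addrA ltrDl; lra.
(* Index 0 is reserved for the zeros of [f], where no point meets the strict relative tolerance. *)
pose v j : H := if j is j'.+1 then d j' else 0.
pose E j : set G := if j is j'.+1 then [set s | rnorm (d j' - f s) < t * rnorm (f s)]
  else [set s | f s = 0].
have bf : borel_fun f := sf.1.
have mE j : measurable (E j : set (borel G)).
  case: j => [|j] /=.
    rewrite (_ : [set s | f s = 0] = ~` (f @^-1` [set y | 0 < rnorm y])).
      by apply: measurableC; exact: (bf _ (@open_rnorm_gt _ _ 0)).
    apply/seteqP; split=> s /= => [->|]; first by rewrite rnorm0 ltxx.
    move=> /negP; rewrite -leNgt => h; apply: rnorm_eq0; apply/eqP.
    by rewrite eq_le h rnorm_ge0.
  rewrite (_ : [set s | _] = [set s | 0 < t * rnorm (f s) - rnorm (d j - f s)]); last first.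
    by apply/seteqP; split=> s /=; rewrite subr_gt0.
  have mh : measurable_fun [set: borel G] (fun s => t * rnorm (f s) - rnorm (d j - f s)).
    apply: measurable_funB.
      by apply: measurable_funM => //; exact: borel_rnorm.
    apply: borel_rnorm; apply: (borel_comp_continuous (phi := fun y : H => d j - y)) bf.
    apply: (@lipschitz_rcontinuous _ _ _ _ 1) => y y'.
    by rewrite opprB addrC addrA subrK rnormC mul1r.
  have := mh measurableT _ (measurable_itv `]0, +oo[); rewrite setTI.
  rewrite (_ : _ @^-1` _ = [set s | 0 < t * rnorm (f s) - rnorm (d j - f s)]) //.
  by apply/seteqP; split=> s /=; rewrite in_itv /= andbT.
have exE s : exists j, E j s.
  have [fs|fs] := eqVneq (f s) 0; first by exists 0%N.
  have fp : 0 < rnorm (f s).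
    by rewrite lt_def rnorm_ge0 andbT; apply: contra_neq fs => /rnorm_eq0.
  have [|j] := dP [set y | rnorm (f s - y) < t * rnorm (f s)] (open_rnorm_ball _ _).
    by exists (f s); rewrite /= subrr rnorm0 mulr_gt0.
  by exists j.+1; rewrite /= rnormC.
have [idx [idxE midx]] := borel_first_index mE exE.
pose g s := v (idx s).
have gf s : rnorm (g s - f s) <= t * rnorm (f s).
  rewrite /g; move: (idxE s); case: (idx s) => [/= ->|j /= /ltW //].
  by rewrite subrr rnorm0 mulr0.
have bg : borel_fun g.
  by apply: (borel_pieces (g := fun j _ => v j)) => // j; exact: borel_cst.
have g2f s : rnorm (g s) ^+ 2 <= 4 * rnorm (f s) ^+ 2.
  have h1 := rnormD (g s - f s) (f s); rewrite subrK in h1.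
  have h2 := gf s; have h3 := rnorm_ge0 (f s); have h4 := rnorm_ge0 (g s).
  have h5 : rnorm (g s) <= 2 * rnorm (f s) by nra.
  by move: (rnorm _) (rnorm _) h3 h4 h5 => p q; nra.
have if2 := sq_integrable sf.
have i4f2 : mu.-integrable setT (fun s => (4 * rnorm (f s) ^+ 2)%:E).
  by under eq_fun do rewrite EFinM; exact: integrableZl.
have sg : sq g := sq_le bg i4f2 g2f.
have xg : nrm (x - L2_class mu g) <= t * nrm x.
  rewrite -(@ler_pXn2r _ 2) ?nnegrE ?mulr_ge0 ?ipnorm_ge0 ?(ltW t0) //.
  rewrite -[in leLHS](L2_funK x) exprMn -lee_fin L2_dist_sqr // EFinM L2_norm_sqr.
  rewrite -ge0_integralZl //; last first.
  - by rewrite lee_fin sqr_ge0.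
  - by move=> s _; rewrite lee_fin sqr_ge0.
  - exact: measurable_int if2.
  apply: ge0_le_integral => //.
  - by move=> s _; rewrite lee_fin sqr_ge0.
  - by apply: measurable_int (sq_integrable (sqB sf sg)).
  - by apply: measurable_funeM; exact: measurable_int if2.
  - move=> s _; rewrite -EFinM lee_fin -exprMn; apply: lerXn2r.
    + by rewrite nnegrE rnorm_ge0.
    + by rewrite nnegrE mulr_ge0 ?rnorm_ge0 // ltW.
    + by rewrite rnormC; exact: gf.
pose gJ J s := if (idx s < J)%N then g s else 0.
have gJE J : gJ J.+1 = (fun s => 1 *: gJ J s + indic_vec (idx @^-1` [set J]) (v J) s).
  apply/funext => s; rewrite /gJ /indic_vec scale1r ltnS leq_eqVlt.
  case: asboolP => [/= idxJ|nJ]; first by rewrite idxJ eqxx ltnn add0r /g idxJ.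
  by case: eqVneq => [/nJ//|_] /=; rewrite addr0.
(* Chebyshev: on this set [g] has the constant value [v J], and [g] is square integrable. *)
have sI J : v J <> 0 -> (mu (idx @^-1` [set J]) < +oo)%E.
  move=> vJ; have vp : 0 < rnorm (v J) ^+ 2.
    by rewrite exprn_gt0 // lt_def rnorm_ge0 andbT; apply/eqP => /rnorm_eq0.
  have mI : measurable_fun [set: borel G] (fun s => (\1_(idx @^-1` [set J]) s : R)%:E).
    by apply/measurable_EFinP; exact: measurable_indic.
  have h : ((rnorm (v J) ^+ 2)%:E * mu (idx @^-1` [set J]) <=
      \int[mu]_s (rnorm (g s) ^+ 2)%:E)%E.
    have -> : mu (idx @^-1` [set J]) = (\int[mu]_s (\1_(idx @^-1` [set J]) s : R)%:E)%E.
      by rewrite integral_indic ?setIT //; exact: midx.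
    rewrite -ge0_integralZl_EFin ?sqr_ge0 //.
    apply: ge0_le_integral => //.
    - by move=> s _; rewrite mule_ge0 // lee_fin sqr_ge0.
    - by apply: measurable_funeM; apply/measurable_EFinP; exact: measurable_indic.
    - exact: measurable_int (sq_integrable sg).
    - move=> s _; rewrite -EFinM lee_fin indicE.
      have [/set_mem /= sJ|_] := boolP (s \in _); last by rewrite mulr0 sqr_ge0.
      by rewrite mulr1 /g sJ.
  have h2 := le_lt_trans h sg.2; rewrite ltey; apply/eqP => muE.
  by move: h2; rewrite muE gt0_muley ?lte_fin // ltxx.
have PJ J : sq (gJ J) /\ P (L2_class mu (gJ J)).
  elim: J => [|J [sJ PgJ]].
    rewrite (_ : gJ 0%N = fun=> 0); last by apply/funext.
    by split; [exact: sq0|rewrite L2_class0].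
  have [vJ|vJ] := pselect (v J = 0).
    rewrite (_ : gJ J.+1 = gJ J) //; apply/funext => s; rewrite gJE scale1r.
    by rewrite /indic_vec vJ; case: ifP => _; rewrite addr0.
  have s1 := sq_indic_vec (v J) (midx J) (sI J vJ).
  rewrite gJE; split; first exact: sq_lin.
  by rewrite L2_class_lin // scale1r; apply: PD => //; apply: PI => //; exact: sI.
have cJ : (fun J => \int[mu]_s (rnorm (g s - gJ J s) ^+ 2)) @ \oo --> (\int[mu]_(s in setT) (0:R)).
  apply: (@Rintegral_dominated _ _ _ _ _ (fun s => 4 * rnorm (f s) ^+ 2)) => //.
  - move=> J; apply: measurable_funX; apply: borel_rnorm.
    exact: (sqB sg (PJ J).1).1.
  - move=> s; apply/cvgrPdist_lt => d0 d0p; exists (idx s).+1 => // J /= sJ.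
    by rewrite /gJ sJ subrr rnorm0 expr0n subrr normr0.
  - move=> J s; rewrite ger0_norm ?sqr_ge0 // /gJ.
    by case: ifP => _; rewrite ?subrr ?subr0 ?g2f // rnorm0 expr0n mulr_ge0 // sqr_ge0.
have /cvgrPdist_lt/(_ _ (exprn_gt0 2 (divr_gt0 e0 (ltr0n R 2))))[J _ /(_ J (leqnn J))] := cJ.
rewrite [X in `|X - _|]/Rintegral integral0 /= sub0r normrN => iJ.
exists (L2_class mu (gJ J)); first exact: (PJ J).2.
apply: le_lt_trans (ipnormB ipK _ (L2_class mu g) _) _.
have h : nrm (L2_class mu g - L2_class mu (gJ J)) < e / 2.
  rewrite -(@ltr_pXn2r _ 2) ?nnegrE ?ipnorm_ge0 ?divr_ge0 ?(ltW e0) //.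
  apply: le_lt_trans iJ; rewrite -lee_fin L2_dist_sqr //; last exact: (PJ J).1.
  rewrite ger0_norm ?Rintegral_ge0 // => [|s _]; last exact: sqr_ge0.
  rewrite /Rintegral fineK // integrable_fin_num //.
  by apply: sq_integrable; apply: sqB => //; exact: (PJ J).1.
rewrite [ltRHS](splitr e); exact: (ltrD (le_lt_trans xg te) h).
Qed.

End L2_density.

(** * Haar measure and the covariant representation *)

Section haar_measure.
Context (R : realType) (G : topologicalGroupType).
Context (mu : {measure set (borel G) -> \bar R}).
Hypothesis haar : left_haar_measure mu.
Implicit Types (s t : G) (B U K : set G).

Lemma mulgl_continuous t : continuous (fun s : G => t * s)%g.
Proof.
move=> s; apply: (continuous_comp (f := fun s : G => (t, s)) (g := fun p : G * G => (p.1 * p.2)%g)).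
  by apply: cvg_pair; [exact: cvg_cst|exact: cvg_id].
exact: mulg_continuous.
Qed.

Lemma mulgr_continuous t : continuous (fun s : G => s * t)%g.
Proof.
move=> s; apply: (continuous_comp (f := fun s : G => (s, t)) (g := fun p : G * G => (p.1 * p.2)%g)).
  by apply: cvg_pair; [exact: cvg_id|exact: cvg_cst].
exact: mulg_continuous.
Qed.

Lemma nbhs_translate t (P : set G) :
  nbhs (1%g : G) P -> nbhs t (fun s => P (t^-1 * s)%g).
Proof. by rewrite -{1}(mulVg t) => /(@mulgl_continuous t^-1%g). Qed.

Lemma borel_measurable_continuous (f : G -> G) : continuous f ->
  measurable_fun [set: borel G] (f : borel G -> borel G).
Proof.
move=> /continuousP cf; apply: (@measurability _ _ (borel G) (borel G) setT f (@open G)) => // _ [U oU <-].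
by rewrite setTI; apply: borel_openP; exact: cf.
Qed.

Lemma borel_translate t B : measurable (B : set (borel G)) ->
  measurable ((fun s => t * s)%g @^-1` B : set (borel G)).
Proof.
move=> mB; have := borel_measurable_continuous (@mulgl_continuous t) measurableT mB.
by rewrite setTI.
Qed.

Lemma haar_translate t B : measurable (B : set (borel G)) ->
  mu ((fun s => t * s)%g @^-1` B) = mu B.
Proof.
move=> mB; have [_ inv _ _ _] := haar; rewrite -(inv (t^-1)%g B mB); congr (mu _).
apply/seteqP; split=> [s /= Bs|_ [s Bs <-]] /=; last by rewrite mulVKg.
by exists (t * s)%g; rewrite ?mulKg.
Qed.

Lemma haar_integral_translate t (f : G -> \bar R) :
  measurable_fun [set: borel G] f -> (forall s, 0 <= f s)%E ->
  (\int[mu]_s f (t * s)%g = \int[mu]_s f s)%E.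
Proof.
move=> mf f0.
have mt := borel_measurable_continuous (@mulgl_continuous t).
have := @ge0_integral_pushforward _ _ _ _ _ _ mt mu setT f measurableT mf (fun s _ => f0 s).
rewrite preimage_setT => <-.
by apply: eq_measure_integral => A mA _; exact: haar_translate.
Qed.

Lemma ae_translate t (P : G -> Prop) : {ae mu, forall s, P s} ->
  {ae mu, forall s, P (t * s)%g}.
Proof.
move=> [N [mN N0 PN]]; exists ((fun s => t * s)%g @^-1` N); split.
- exact: borel_translate.
- by rewrite haar_translate.
- by move=> s /= nPs; apply: PN.
Qed.

Lemma second_countable_separable (T : ptopologicalType) :
  @second_countable T -> separable T.
Proof.
move=> [B cB [_ Bb]]; exists [set get b | b in B].
  exact: (card_le_trans (card_image_le _ _) cB).
move=> O [x Ox] oO; have [b [Bb' bx] bO] := Bb x O (open_nbhs_nbhs (conj oO Ox)).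
exists (get b); split; last by exists b.
by apply: bO; apply: (getI bx).
Qed.

(** For every [x] the open set [U x^-1] meets the dense sequence [d], so countably many left
    translates of [U] cover [G]; if [U] were null, so would be [G]. *)
Lemma haar_open_pos (sepG : separable G) U : open U -> U !=set0 -> (0 < mu U)%E.
Proof.
move=> oU [u Uu]; have [d dP] := dense_sequence sepG.
rewrite lt0e measure_ge0 andbT; apply/eqP => U0.
have [/eqP muT _ _ _ _] := haar; apply: muT; apply/eqP.
rewrite eq_le measure_ge0 andbT.
pose A n : set (borel G) := (fun s => d n * s)%g @^-1` U.
have mA n : measurable (A n) by apply: borel_translate; exact: borel_openP.
have AT : [set: borel G] = \bigcup_n A n.
  apply/seteqP; split=> // x _.
  have /continuousP cr := @mulgr_continuous x.
  have [|j Uj] := dP _ (cr _ oU); first by exists (u * x^-1)%g; rewrite /= mulgVK.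
  by exists j.
rewrite [X in mu X]AT; apply: le_trans (generalized_Boole_inequality _ _ _) _ => //.
  by rewrite -AT; exact: measurableT.
rewrite eseries0 // => n _ _; rewrite /A haar_translate ?U0 //.
exact: borel_openP.
Qed.

Hypotheses (hausG : hausdorff_space G) (lcG : locally_compact [set: G]).

Lemma haar_finite_nbhs t : exists U, [/\ open U, U t & (mu U < +oo)%E].
Proof.
have [_ _ muK _ _] := haar.
have [K nK [cK _]] := lcG (I : [set: G] t).
have nK1 : nbhs t (fun s => [set: G] s -> K s) := nK.
have nK' : nbhs t K by apply: filterS nK1 => s; apply.
exists K^°; split; [exact: open_interior|exact: nK'|].
apply: le_lt_trans (muK K cK); apply: le_measure; rewrite ?inE.
- exact: (borel_openP (@open_interior _ K)).
- rewrite -[K]setCK; apply: measurableC; apply: borel_openP.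
  exact: (closed_openC (compact_closed hausG cK)).
- exact: interior_subset.
Qed.

(** The tube lemma for multiplication along [{1} x K]. *)
Lemma compact_translate_nbhs K U : compact K -> open U -> K `<=` U ->
  \forall s \near (1%g : G), forall x, K x -> U (s * x)%g.
Proof.
move=> /compact_near_coveringP cK oU KU.
apply: (cK G (nbhs (1%g : G)) (fun s x => U (s * x)%g)) => x Kx.
have : nbhs ((1%g : G) * x)%g U by apply: open_nbhs_nbhs; split=> //; rewrite mul1g; exact: KU.
move=> /(@mulg_continuous G (1%g, x)) [[P Q] /= [P1 Qx] PQ].
exists (Q, P) => // -[y s] /= [Qy Ps]; exact: (PQ (s, y)).
Qed.

(** Inner regularity is given for open sets only, so the compact [K] approximates an open [U]
    containing [B], not [B]. For [s] so close to 1 that [s^-1 K] stays in [U], a point [x] outside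
    [B] with [s x] in [B] lies in [U \ B], or else [s x] lies in [U \ K]; each case costs
    [e / 2]. *)
Lemma haar_translate_diff B (e : R) : measurable (B : set (borel G)) ->
  (mu B < +oo)%E -> 0 < e ->
  \forall s \near (1%g : G), (mu ((fun x => s * x)%g @^-1` B `\` B) <= e%:E)%E.
Proof.
move=> mB muB e0; have [_ _ muK outer inner] := haar.
have e20 : 0 < e / 2 by rewrite divr_gt0.
have finB : mu B \is a fin_num by rewrite ge0_fin_numE.
have [_ [U [oU BU] <-] UB] : exists2 y, [set mu U | U in [set U | open U /\ B `<=` U]] y &
    (y < mu B + (e / 2)%:E)%E.
  apply: ereal_inf_lt; rewrite -outer //.
  by rewrite -[X in (X < _)%E]adde0 lteD2lE // lte_fin.
have finU : (mu U < +oo)%E by apply: lt_trans UB _; rewrite lte_add_pinfty ?ltry.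
have [_ [K [cK KU] <-] KUe] : exists2 y, [set mu K | K in [set K | compact K /\ K `<=` U]] y &
    (mu U - (e / 2)%:E < y)%E.
  apply: ereal_sup_gt; rewrite -inner //.
  by rewrite lteBlDr // -[X in (X < _)%E]adde0 lteD2lE ?lte_fin // ge0_fin_numE.
have mU : measurable (U : set (borel G)) := borel_openP oU.
have mK : measurable (K : set (borel G)).
  rewrite -[K]setCK; apply: measurableC; apply: borel_openP.
  exact: (closed_openC (compact_closed hausG cK)).
have finUf : mu U \is a fin_num by rewrite ge0_fin_numE.
have UKe : (mu (U `\` K) <= (e / 2)%:E)%E.
  rewrite measureD // setIidr //; rewrite leeBlDr ?ge0_fin_numE //; last first.
    by apply: le_lt_trans finU; apply: le_measure; rewrite ?inE.
  by move: KUe; rewrite lteBlDr // => /ltW; rewrite addeC.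
have UBe : (mu (U `\` B) <= (e / 2)%:E)%E.
  rewrite measureD // setIidr // leeBlDr //.
  by rewrite addeC ltW.
have near_inv : \forall s \near (1%g : G), forall x, K x -> U (s^-1 * x)%g.
  have := compact_translate_nbhs cK oU KU; rewrite -{1}(invg1 G).
  by move=> /(@invg_continuous G 1%g).
apply: filterS near_inv => s sK.
apply: (@le_trans _ _ (mu ((fun x => s * x)%g @^-1` (U `\` K) `|` (U `\` B)))%E).
  apply: le_measure; rewrite ?inE.
  - by apply: measurableD => //; exact: borel_translate.
  - by apply: measurableU; [apply: borel_translate|]; exact: measurableD.
  - move=> x [/= Bsx nBx]; have [Ksx|nKsx] := pselect (K (s * x)%g).
      by right; split=> //; have := sK _ Ksx; rewrite mulKg.
    by left; split=> //; exact: BU.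
apply: le_trans (measureU2 _ _ _) _.
- by apply: borel_translate; exact: measurableD.
- exact: measurableD.
rewrite [in leRHS](splitr e) EFinD; apply: leeD => //.
by move: UKe; rewrite -(haar_translate s (measurableD mU mK)).
Qed.

End haar_measure.

(** * The left regular representation and its strong continuity *)

Section translations.
Context (R : realType) (G : topologicalGroupType).
Context (mu : {measure set (borel G) -> \bar R}) (H : separableHilbertType R).
Hypotheses (haar : left_haar_measure mu) (hausG : hausdorff_space G).
Local Notation K := (L2 mu H).
Implicit Types (f g : G -> H) (x y z : K) (s t : G).
Local Notation sq f := (square_integrable mu f).
Local Notation nrm := (ipnorm (@L2_inner R G mu H)).
Local Notation lambda := (@lambda_theta R G mu H).
Let ipK : inner_product (@L2_inner R G mu H) := L2_inner_product mu H.

Lemma sq_translate t f : sq f -> sq (fun s => f (t * s)%g).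
Proof.
move=> [bf fi]; split.
  by move=> U oU; exact: (borel_translate t (bf U oU)).
have mf : measurable_fun [set: borel G] (fun s => (rnorm (f s) ^+ 2)%:E).
  by apply/measurable_EFinP; apply: measurable_funX; exact: borel_rnorm.
rewrite (@haar_integral_translate _ _ _ haar t (fun s => (rnorm (f s) ^+ 2)%:E)) //.
by move=> s; rewrite lee_fin sqr_ge0.
Qed.

Lemma lambda_class t f : sq f ->
  lambda t (L2_class mu f) = L2_class mu (fun s => f (t^-1 * s)%g).
Proof.
move=> sf; apply: L2_class_eq.
- exact/sq_translate/L2_fun_sq.
- exact: sq_translate.
- exact: (ae_translate haar t^-1%g (L2_classK sf)).
Qed.

Lemma lambda_linear t : linear (lambda t).
Proof.
move=> k x y; rewrite -(L2_funK x) -(L2_funK y).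
have [sx sy] := conj (L2_fun_sq x) (L2_fun_sq y).
rewrite -L2_class_lin // !lambda_class //; last exact: sq_lin.
by rewrite -L2_class_lin //; exact: sq_translate.
Qed.

Lemma lambda_norm t x : nrm (lambda t x) = nrm x.
Proof.
apply: (@pexpIrn _ 2); rewrite ?nnegrE ?ipnorm_ge0 //.
apply: EFin_inj; rewrite -{1}(L2_funK x) lambda_class; last exact: L2_fun_sq.
rewrite L2_class_norm_sqr; last exact/sq_translate/L2_fun_sq.
rewrite L2_norm_sqr.
apply: (@haar_integral_translate _ _ _ haar t^-1%g (fun s => (rnorm (L2_fun x s) ^+ 2)%:E)).
  by apply/measurable_EFinP; apply: measurable_funX; apply: borel_rnorm; exact: (L2_fun_sq x).1.
by move=> s; rewrite lee_fin sqr_ge0.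
Qed.

Lemma lambdaM s t x : lambda s (lambda t x) = lambda (s * t)%g x.
Proof.
rewrite -(L2_funK x) !lambda_class; do ?[exact: L2_fun_sq|exact/sq_translate/L2_fun_sq].
by congr L2_class; apply/funext => r; rewrite invgM mulgA.
Qed.

Lemma lambda1 x : lambda 1%g x = x.
Proof.
rewrite -{1}(L2_funK x) lambda_class; last exact: L2_fun_sq.
by rewrite -[RHS]L2_funK; congr L2_class; apply/funext => r; rewrite invg1 mul1g.
Qed.

Lemma lambdaB t x y : lambda t (x - y) = lambda t x - lambda t y.
Proof. by have := lambda_linear t (-1) y x; rewrite !scaleN1r ![- _ + _]addrC. Qed.

(** Translations are isometric, so the property passes to norm limits and density leaves the
    indicator vectors. For these the squared distance is [rnorm h ^+ 2] times the measure of a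
    symmetric difference. *)
Lemma lambda_continuous1 x (e : R) : 0 < e ->
  \forall s \near (1%g : G), nrm (lambda s x - x) < e.
Proof.
move: x e; apply: (L2_indic_ind (P := fun x => forall e : R, 0 < e ->
  \forall s \near (1%g : G), nrm (lambda s x - x) < e)).
- move=> x y Px Py e e0; have e20 : 0 < e / 2 by rewrite divr_gt0.
  apply: filterS2 (Px _ e20) (Py _ e20) => s h1 h2.
  have lD : lambda s (x + y) = lambda s x + lambda s y.
    by have := lambda_linear s 1 x y; rewrite !scale1r.
  rewrite lD opprD addrACA [ltRHS](splitr e); apply: le_lt_trans (ipnormD ipK _ _) _.
  exact: ltrD.
- move=> B h mB muB e e0.
  (* Chosen so that [rnorm h ^+ 2 * (2 * d) < e ^+ 2], with the 1 covering [h = 0]. *)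
  pose d : R := e ^+ 2 / (4 * (rnorm h ^+ 2 + 1)).
  have h0 : 0 < rnorm h ^+ 2 + 1 by rewrite ltr_wpDl // sqr_ge0.
  have d0 : 0 < d by rewrite divr_gt0 ?exprn_gt0 // mulr_gt0.
  have n1 := haar_translate_diff haar hausG mB muB d0.
  (* The two halves of the symmetric difference of [s B] and [B] need the estimate at [s^-1] and at
     [s]: [B \ s B] is a translate of [s^-1 B \ B]. *)
  have n2 : \forall s \near (1%g : G), (mu ((fun r : G => s^-1 * r)%g @^-1` B `\` B) <= d%:E)%E.
    by move: n1; rewrite -{1}(invg1 G) => /(@invg_continuous G 1%g).
  apply: filterS2 n1 n2 => s m1 m2.
  have sI := sq_indic_vec h mB muB.
  pose B' := (fun r : G => s^-1 * r)%g @^-1` B.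
  have mB' : measurable (B' : set (borel G)) by exact: borel_translate.
  pose D := (B' `\` B) `|` (B `\` B').
  have mD : measurable (D : set (borel G)).
    exact: (measurableU _ _ (measurableD mB' mB) (measurableD mB mB')).
  have m3 : (mu (B `\` B') <= d%:E)%E.
    have <- := haar_translate haar s (measurableD mB mB').
    rewrite (_ : _ @^-1` _ = (fun r : G => s * r)%g @^-1` B `\` B) //.
    by apply/seteqP; split=> r; rewrite /B' /= mulKg.
  have muD : (mu D <= (2 * d)%:E)%E.
    apply: le_trans (measureU2 _ (measurableD mB' mB) (measurableD mB mB')) _.
    by rewrite mulr_natl mulr2n EFinD; apply: leeD; [exact: m2|exact: m3].
  rewrite -(@ltr_pXn2r _ 2) ?nnegrE ?ipnorm_ge0 ?(ltW e0) // -lte_fin.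
  rewrite lambda_class // L2_dist_sqr //; last exact: sq_translate.
  apply: (@le_lt_trans _ _ (\int[mu]_r ((rnorm h ^+ 2)%:E * (\1_D r)%:E))%E).
    apply: ge0_le_integral => //.
    + by move=> r _; rewrite lee_fin sqr_ge0.
    + apply/measurable_EFinP; apply: measurable_funX; apply: borel_rnorm.
      exact: (sqB (sq_translate s^-1%g sI) sI).1.
    + by apply: measurable_funeM; apply/measurable_EFinP; exact: measurable_indic.
    + move=> r _; rewrite -EFinM lee_fin indicE /indic_vec.
      case: asboolP => Br'; case: asboolP => Br.
      * by rewrite subrr rnorm0 expr0n mulr_ge0 ?sqr_ge0.
      * by rewrite subr0 mem_set ?mulr1 //; left.
      * by rewrite sub0r rnormN mem_set ?mulr1 //; right.
      * by rewrite subrr rnorm0 expr0n mulr_ge0 ?sqr_ge0.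
  rewrite ge0_integralZl_EFin ?sqr_ge0 //; last first.
    by apply/measurable_EFinP; exact: measurable_indic.
  rewrite integral_indic // setIT.
  apply: (@le_lt_trans _ _ ((rnorm h ^+ 2)%:E * (2 * d)%:E)%E).
    by rewrite lee_wpmul2l // lee_fin sqr_ge0.
  rewrite -EFinM lte_fin /d.
  have -> : rnorm h ^+ 2 * (2 * (e ^+ 2 / (4 * (rnorm h ^+ 2 + 1)))) =
      e ^+ 2 * (rnorm h ^+ 2 / (2 * (rnorm h ^+ 2 + 1))) by field; rewrite gt_eqF.
  rewrite gtr_pMr ?exprn_gt0 // ltr_pdivrMr ?mulr_gt0 // mul1r.
  by rewrite mulrDr mulr1 ltr_pwDr // ler_peMl ?sqr_ge0 // ler1n.
- move=> x xP e e0; have e30 : 0 < e / 3 by rewrite divr_gt0.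
  have [y Py xy] := xP _ e30; apply: filterS (Py _ e30) => s h1.
  apply: le_lt_trans (ipnormB ipK _ (lambda s y) _) _.
  rewrite -lambdaB lambda_norm.
  have <- : e / 3 + (e / 3 + e / 3) = e by field.
  apply: ltrD; first by [].
  by apply: le_lt_trans (ipnormB ipK _ y _) _; rewrite (ipnormC ipK y) ltrD.
Qed.

Lemma lambda_continuous x t (e : R) : 0 < e ->
  \forall s \near t, nrm (lambda s x - lambda t x) < e.
Proof.
move=> e0.
have := nbhs_translate t (lambda_continuous1 x e0).
apply: filterS => s h.
have lts := lambdaM t (t^-1 * s)%g x; rewrite mulVKg in lts.
by move: h; rewrite -(lambda_norm t) lambdaB lts.
Qed.

End translations.

Lemma ler_sqrM (R : realType) (x c y : R) : 0 <= x -> x <= c * y ->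
  x ^+ 2 <= c ^+ 2 * y ^+ 2.
Proof.
move=> x0 xcy; rewrite -exprMn; apply: lerXn2r; rewrite ?nnegrE //.
exact: le_trans xcy.
Qed.

(** * The operators pi(a) lambda_t and their matrix norms *)

Section pi_operators.
Context (R : realType) (G : topologicalGroupType).
Context (mu : {measure set (borel G) -> \bar R}) (A : cstarAlgType R).
Context (H : separableHilbertType R) (alpha : G -> A -> A) (theta : A -> H -> H).
Hypotheses (haar : left_haar_measure mu) (hausG : hausdorff_space G).
Hypotheses (dynA : cstar_dynamical_system alpha) (faith : faithful_representation theta).
Local Notation K := (L2 mu H).
Implicit Types (f g : G -> H) (x y z : K) (s t : G) (a b : A).
Local Notation sq f := (square_integrable mu f).
Local Notation ipK := (@L2_inner R G mu H).
Local Notation nrm := (ipnorm ipK).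
Local Notation pi := (@pi_theta R G mu A H alpha theta).
Local Notation lambda := (@lambda_theta R G mu H).
Local Notation pil := (@pi_lambda R G mu A H alpha theta).
Let ipKP : inner_product ipK := L2_inner_product mu H.
Let rep := faith.1.

(** [pi a] acts in the fibre over [s] through [theta o alpha_{s^-1}]; estimates on [pi] become
    pointwise estimates for representations. *)
Lemma alpha_rep s : representation (fun a => theta (alpha s a)).
Proof.
have [/(_ s)[al _ aM aS] _ _] := dynA; split=> [a|k a b v|a b v|a v w].
- by have [+ _ _ _] := rep.
- by rewrite al (repD rep) (repZ rep).
- by rewrite aM (repM rep).
- by rewrite aS (rep_adj rep).
Qed.

(** [alpha 1] is idempotent and injective. *)
Lemma alpha1 a : alpha 1%g a = a.
Proof.
have [/(_ 1%g)[_ /bij_inj ai _ _] am _] := dynA.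
by apply: ai; rewrite -am mulg1.
Qed.

Lemma theta_alpha_le s a v : rnorm (theta (alpha s a) v) <= rnorm a * rnorm v.
Proof. by have := rep_contractive (alpha_rep s) a v; rewrite !ipnorm_inner. Qed.

Lemma theta_alpha_continuous a v : continuous (fun s => theta (alpha s^-1%g a) v).
Proof.
have [_ _ ca] := dynA => s.
apply: (continuous_comp (f := fun s : G => s^-1%g) (g := fun s : G => theta (alpha s a) v)).
  exact: invg_continuous.
apply: (continuous_comp (f := fun s : G => alpha s a) (g := fun b : A => theta b v)).
  exact: ca.
apply: (@lipschitz_rcontinuous _ _ _ _ (rnorm v)) => b b'.
rewrite -(repB rep) mulrC.
by have := rep_contractive rep (b - b') v; rewrite !ipnorm_inner.
Qed.

Lemma borel_pi a f : borel_fun f -> borel_fun (fun s => theta (alpha s^-1%g a) (f s)).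
Proof.
apply: (borel_caratheodory (Phi := fun s v => theta (alpha s^-1%g a) v)).
- exact: separable_subproof.
- by move=> v; apply: borel_continuous; exact: theta_alpha_continuous.
- move=> s; apply: (@lipschitz_rcontinuous _ _ _ _ (rnorm a)) => v w.
  by rewrite -(rep_vB rep); exact: theta_alpha_le.
Qed.

Lemma sq_pi a f : sq f -> sq (fun s => theta (alpha s^-1%g a) (f s)).
Proof.
move=> sf; apply: (@sq_le _ _ _ _ _ (fun s => rnorm a ^+ 2 * rnorm (f s) ^+ 2)).
- exact: borel_pi sf.1.
- by under eq_fun do rewrite EFinM; apply: integrableZl => //; exact: sq_integrable.
- by move=> s; rewrite -exprMn; apply: lerXn2r;
    rewrite ?nnegrE ?mulr_ge0 ?rnorm_ge0 // theta_alpha_le.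
Qed.

Lemma pi_class a f : sq f ->
  pi a (L2_class mu f) = L2_class mu (fun s => theta (alpha s^-1%g a) (f s)).
Proof.
move=> sf; apply: L2_class_eq; [exact/sq_pi/L2_fun_sq|exact: sq_pi|].
by apply: ae_mono (L2_classK sf) => s /= ->.
Qed.

Lemma pi_linear a : linear (pi a).
Proof.
move=> k x y; rewrite -(L2_funK x) -(L2_funK y).
have [sx sy] := conj (L2_fun_sq x) (L2_fun_sq y).
rewrite -L2_class_lin // !pi_class //; last exact: sq_lin.
rewrite -L2_class_lin //; do ?exact: sq_pi.
by congr L2_class; apply/funext => s; exact: (rep_linear rep).
Qed.

Lemma pi_linl k a b x : pi (k *: a + b) x = k *: pi a x + pi b x.
Proof.
have sx := L2_fun_sq x; rewrite -(L2_funK x) !pi_class // -L2_class_lin //; do ?exact: sq_pi.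
congr L2_class; apply/funext => s.
by rewrite (repD (alpha_rep s^-1%g)) (repZ (alpha_rep s^-1%g)).
Qed.

Lemma pi_norm a x : nrm (pi a x) <= rnorm a * nrm x.
Proof.
rewrite -(@ler_pXn2r _ 2) ?nnegrE ?mulr_ge0 ?rnorm_ge0 ?ipnorm_ge0 // exprMn.
have sx := L2_fun_sq x; rewrite -[in leLHS](L2_funK x) pi_class // -lee_fin.
rewrite L2_class_norm_sqr; last exact: sq_pi.
rewrite EFinM L2_norm_sqr -ge0_integralZl_EFin ?sqr_ge0 //; last first.
- exact: measurable_int (sq_integrable sx).
- by move=> s _; rewrite lee_fin sqr_ge0.
apply: ge0_le_integral => //.
- by move=> s _; rewrite lee_fin sqr_ge0.
- exact: measurable_int (sq_integrable (sq_pi a sx)).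
- by apply: measurable_funeM; exact: measurable_int (sq_integrable sx).
- move=> s _; rewrite -EFinM lee_fin -exprMn; apply: lerXn2r;
    by rewrite ?nnegrE ?mulr_ge0 ?rnorm_ge0 // theta_alpha_le.
Qed.

Lemma pi_lambda_linear a t : linear (pil a t).
Proof. by move=> k x y; rewrite /pi_lambda (lambda_linear haar) pi_linear. Qed.

Lemma pi_lambda_linl k a b t x : pil (k *: a + b) t x = k *: pil a t x + pil b t x.
Proof. exact: pi_linl. Qed.

Lemma pi_lambda_norm a t x : nrm (pil a t x) <= rnorm a * nrm x.
Proof. by apply: le_trans (pi_norm _ _) _; rewrite (lambda_norm haar). Qed.

Lemma pi_lambda_bounded a t : bounded_op ipK (pil a t).
Proof. by split; [exact: pi_lambda_linear|exists (rnorm a); exact: pi_lambda_norm]. Qed.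

Section matrices.
Variable n : nat.
Local Notation ipHn := (@ipn R H inner n).
Local Notation ipKn := (@ipn R K ipK n).
Let ipH := hilbert_inner_product H.

Lemma sq_sum (F : 'I_n -> G -> H) : (forall j, sq (F j)) ->
  sq (fun s => \sum_j F j s) /\
  L2_class mu (fun s => \sum_j F j s) = \sum_j L2_class mu (F j).
Proof.
move=> sF; elim: (index_enum _) => [|j r [sr cr]].
  under eq_fun do rewrite big_nil; rewrite big_nil.
  by split; [exact: sq0|exact: L2_class0].
under eq_fun do rewrite big_cons -[F j _]scale1r; rewrite big_cons.
by split; [exact: sq_lin|rewrite L2_class_lin // scale1r cr].
Qed.

(** Identifies the [n]-th power of [L2(G,H)] with [L2(G,H^n)], so that matrices of operators can be
    estimated fibrewise. *)
Lemma L2n_norm_sqr (F : 'I_n -> G -> H) : (forall j, sq (F j)) ->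
  ((ipnorm ipKn (fun j => L2_class mu (F j)) ^+ 2)%:E =
    \int[mu]_s (ipnorm ipHn (fun j => F j s) ^+ 2)%:E)%E.
Proof.
move=> sF; rewrite (ipnorm_ipn_sqr ipKP) -sumEFin.
under eq_integral do rewrite (ipnorm_ipn_sqr ipH) -sumEFin.
rewrite ge0_integral_sum //.
- apply: eq_bigr => j _; rewrite L2_class_norm_sqr //.
  by apply: eq_integral => s _; rewrite ipnorm_inner.
- move=> j; under eq_fun do rewrite ipnorm_inner.
  exact: measurable_int (sq_integrable (sF j)).
- by move=> j s _; rewrite lee_fin sqr_ge0.
Qed.

Lemma L2n_measurable (F : 'I_n -> G -> H) : (forall j, sq (F j)) ->
  measurable_fun [set: borel G] (fun s => (ipnorm ipHn (fun j => F j s) ^+ 2)%:E).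
Proof.
move=> sF; under eq_fun do rewrite (ipnorm_ipn_sqr ipH).
apply/measurable_EFinP; apply: measurable_sum => j.
under eq_fun do rewrite ipnorm_inner.
by apply: measurable_funX; apply: borel_rnorm; exact: (sF j).1.
Qed.

Lemma mxop_pi (a : 'I_n -> 'I_n -> A) (F : 'I_n -> G -> H) : (forall j, sq (F j)) ->
  let P i s := amxop (fun b => theta (alpha s^-1%g b)) a (F^~ s) i in
  (forall i, sq (P i)) /\
  mxop (fun i j => pi (a i j)) (fun j => L2_class mu (F j)) = fun i => L2_class mu (P i).
Proof.
move=> sF P; have sP i : sq (P i) by apply: (sq_sum _).1 => j; exact: sq_pi.
split=> //; apply/funext => i; rewrite /mxop.
under eq_bigr do rewrite pi_class //.
by rewrite -(sq_sum _).2 // => j; exact: sq_pi.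
Qed.

(** The isometry [lambda t] drops out, and in each fibre the bound for [theta] transfers to
    [theta o alpha_{s^-1}], after which the squares are integrated. *)
Lemma mxop_pi_lambda_le (a : 'I_n -> 'I_n -> A) t (c : R) : 0 <= c ->
  amx_bounded theta a c -> (mxnorm ipK (fun i j => pil (a i j) t) <= c%:E)%E.
Proof.
move=> c0 ac; apply: (mxnorm_ub ipKP) => // x.
pose F j := L2_fun (lambda t (x j)).
have sF j : sq (F j) := L2_fun_sq _.
have [sP opE] := mxop_pi a sF.
have -> : mxop (fun i j => pil (a i j) t) x = mxop (fun i j => pi (a i j)) (fun j => L2_class mu (F j)).
  by apply/funext => i; apply: eq_bigr => j _; rewrite L2_funK.
have -> : ipnorm ipKn x = ipnorm ipKn (fun j => L2_class mu (F j)).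
  by apply: (eq_ipnorm_ipn ipKP) => j; rewrite L2_funK (lambda_norm haar).
rewrite -(@ler_pXn2r _ 2) ?nnegrE ?mulr_ge0 ?ipnorm_ge0 // exprMn -lee_fin [in leRHS]EFinM.
have e1 := L2n_norm_sqr sP; rewrite -opE in e1; rewrite e1 (L2n_norm_sqr sF).
rewrite -ge0_integralZl_EFin ?sqr_ge0 //; last first.
- exact: L2n_measurable.
- by move=> s _; rewrite lee_fin sqr_ge0.
apply: ge0_le_integral => //.
- by move=> s _; rewrite lee_fin sqr_ge0.
- exact: L2n_measurable.
- by apply: measurable_funeM; exact: L2n_measurable.
- move=> s _; rewrite -EFinM lee_fin -exprMn; apply: lerXn2r;
    rewrite ?nnegrE ?mulr_ge0 ?ipnorm_ge0 //.
  exact: (amx_bounded_transfer faith (alpha_rep s^-1%g) c0 ac).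
Qed.

(** The operators are tested on the vectors [h j] times the indicator of a small neighbourhood [V]
    of 1 with finite positive measure: there [alpha_{s^-1}] is close to the identity, so the fibres
    almost see [theta] itself. Dividing by the measure of [V] and letting [d] tend to 0 gives the
    bound. *)
Lemma mxop_pi_lambda_ge (sepG : separable G) (lcG : locally_compact [set: G])
    (a : 'I_n -> 'I_n -> A) t (c : R) : 0 <= c ->
  (mxnorm ipK (fun i j => pil (a i j) t) <= c%:E)%E -> amx_bounded theta a c.
Proof.
move=> c0 ac h.
pose q s := ipnorm ipHn (amxop (fun b => theta (alpha s^-1%g b)) a h).
pose m := ipnorm ipHn h ^+ 2.
have q1 : q 1%g = ipnorm ipHn (amxop theta a h).
  congr ipnorm; apply/funext => i; apply: eq_bigr => j _.
  by rewrite invg1 alpha1.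
rewrite -q1; apply/ler_addgt0Pr => d d0.
have [|q1d] := leP (q 1%g) d.
  by move=> /le_trans; apply; rewrite lerDr mulr_ge0 ?ipnorm_ge0.
pose r := q 1%g - d; have r0 : 0 < r by rewrite subr_gt0.
have [U [oU U1 finU]] := haar_finite_nbhs haar hausG lcG 1%g.
have qcont : nbhs (1%g : G) [set s | r < q s].
  (* There are [n * n] entries, each moved by less than [e]; the successor makes the total strictly
     smaller than [d], also for [n = 0]. *)
  pose e := d / (n * n).+1%:R; have e0 : 0 < e by rewrite divr_gt0.
  pose D i j s := rnorm (theta (alpha (1%g : G)^-1%g (a i j)) (h j) - theta (alpha s^-1%g (a i j)) (h j)).
  have nD i j : nbhs (1%g : G) [set s | D i j s < e].
    have /cvg_ballP/(_ e%:C%C) := @theta_alpha_continuous (a i j) (h j) 1%g.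
    by rewrite ltcR => /(_ e0); apply: filterS => s /ball_rnormP.
  have : nbhs (1%g : G) [set s | forall i j, D i j s < e].
    by apply: filter_forall => i; apply: filter_forall => j; exact: nD.
  apply: filterS => s /= De; rewrite /r ltrBlDl addrC -ltrBlDl.
  have ipHn0 := ipn_inner_product ipH n.
  have h1 := ipnormD ipHn0 (amxop (fun b => theta (alpha (1%g : G)^-1%g b)) a h -
    amxop (fun b => theta (alpha s^-1%g b)) a h) (amxop (fun b => theta (alpha s^-1%g b)) a h).
  rewrite subrK -lerBlDr in h1; apply: le_lt_trans h1 _.
  apply: le_lt_trans (ipnorm_ipn_le ipH _) _.
  apply: (@le_lt_trans _ _ (\sum_(i < n) \sum_(j < n) e)).
    apply: ler_sum => i _; rewrite -[X in ipnorm _ X]/(amxop _ a h i - amxop _ a h i).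
    rewrite /amxop /mxop -sumrB; apply: le_trans (ipnorm_sum ipH _ _) _.
    by apply: ler_sum => j _; rewrite ipnorm_inner; exact/ltW/De.
  rewrite !sumr_const !card_ord -mulrnA -mulr_natl /e mulrCA gtr_pMr //.
  by rewrite ltr_pdivrMr ?ltr0n // mul1r ltr_nat.
pose V : set G := interior (U `&` [set s | r < q s]).
have oV : open V := @open_interior _ _.
have V1 : V 1%g by apply: filterI => //; exact: open_nbhs_nbhs.
have VU : V `<=` U by move=> s /interior_subset[].
have mV : measurable (V : set (borel G)) := borel_openP oV.
have finV : (mu V < +oo)%E.
  by apply: le_lt_trans finU; apply: le_measure; rewrite ?inE //; exact: borel_openP.
have muV : 0 < fine (mu V).
  by rewrite fine_gt0 // finV andbT; apply: (haar_open_pos haar sepG oV); exists 1%g.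
have muVE : mu V = (fine (mu V))%:E by rewrite fineK // ge0_fin_numE.
pose F j := indic_vec V (h j).
have sF j : sq (F j) := sq_indic_vec (h j) mV finV.
have [sP opE] := mxop_pi a sF.
(* Applying [lambda t^-1] to the test vectors cancels [lambda t] without changing their norms. *)
have := mxnorm_lb ipKP (fun i j => pi_lambda_linear (a i j) t) ac
  (fun j => lambda t^-1%g (L2_class mu (F j))).
have -> : mxop (fun i j => pil (a i j) t) (fun j => lambda t^-1%g (L2_class mu (F j))) =
    mxop (fun i j => pi (a i j)) (fun j => L2_class mu (F j)).
  apply/funext => i; apply: eq_bigr => j _.
  by rewrite /pi_lambda (lambdaM haar) mulgV (lambda1 haar).
have -> : ipnorm ipKn (fun j => lambda t^-1%g (L2_class mu (F j))) =
    ipnorm ipKn (fun j => L2_class mu (F j)).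
  by apply: (eq_ipnorm_ipn ipKP) => j; exact: (lambda_norm haar).
move=> /(ler_sqrM (ipnorm_ge0 _ _)); rewrite -lee_fin [in leRHS]EFinM.
have e1 := L2n_norm_sqr sP; rewrite -opE in e1; rewrite e1 (L2n_norm_sqr sF).
have e2 : (\int[mu]_s (ipnorm ipHn (fun j => F j s) ^+ 2)%:E = (m * fine (mu V))%:E)%E.
  rewrite EFinM -muVE -[X in (_ * mu X)%E]setIT -integral_indic // -ge0_integralZl_EFin ?sqr_ge0 //.
    apply: eq_integral => s _; rewrite -EFinM indicE /F /indic_vec.
    case: asboolP => Vs; first by rewrite mem_set ?mulr1.
    by rewrite memNset // mulr0 -[X in ipnorm _ X]/(0 : 'I_n -> H) (ipnorm0 (ipn_inner_product ipH n)) expr0n.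
  by apply/measurable_EFinP; exact: measurable_indic.
have e3 : ((r ^+ 2 * fine (mu V))%:E <= \int[mu]_s
    (ipnorm ipHn (fun i => amxop (fun b => theta (alpha s^-1%g b)) a (F^~ s) i) ^+ 2)%:E)%E.
  rewrite EFinM -muVE -[X in (_ * mu X)%E]setIT -integral_indic // -ge0_integralZl_EFin ?sqr_ge0 //; last first.
    by apply/measurable_EFinP; exact: measurable_indic.
  apply: ge0_le_integral => //.
  - by move=> s _; rewrite -EFinM lee_fin mulr_ge0 ?sqr_ge0.
  - by apply: measurable_funeM; apply/measurable_EFinP; exact: measurable_indic.
  - exact: L2n_measurable sP.
  - move=> s _; rewrite -EFinM lee_fin indicE.
    have [/set_mem Vs|_] := boolP (s \in V); last by rewrite mulr0 sqr_ge0.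
    have -> : F^~ s = h by apply/funext => j; rewrite /F /indic_vec asboolT.
    by rewrite mulr1; apply: lerXn2r; rewrite ?nnegrE ?ipnorm_ge0 ?(ltW r0) // ltW //; have [] := interior_subset Vs.
rewrite e2; move=> /(le_trans e3); rewrite -EFinM lee_fin mulrA ler_pM2r // => h1.
rewrite -lerBlDr -/r -(@ler_pXn2r _ 2) ?nnegrE ?mulr_ge0 ?ipnorm_ge0 ?(ltW r0) //.
by rewrite exprMn.
Qed.

End matrices.
End pi_operators.

(** * Normal functionals and the weak* topology *)

Section complex_series.
Context (R : realType).
Implicit Types (z : nat -> R[i]).

Lemma abs_summable_cvg z (B : R) : (forall n, \sum_(k < n) cabs (z k) <= B) ->
  exists2 l : R[i], ((fun n => \sum_(k < n) z k) : nat -> R[i]^o) @ \oo --> (l : R[i]^o) &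
    cabs l <= B.
Proof.
move=> zB.
have part (p : R[i] -> R) : (forall w, `|p w| <= cabs w) ->
    cvgn (series (fun k => p (z k))).
  move=> pc; apply: normed_cvg; apply: nondecreasing_is_cvgn.
    by apply: nondecreasing_series => k _ _; exact: normr_ge0.
  exists B => _ [n _ <-]; apply: le_trans (zB n).
  by rewrite -[leLHS]/(\sum_(0 <= k < n) `|p (z k)|) big_mkord; apply: ler_sum => k _.
have [cR cI] := (part _ (@Re_le_cabs R), part _ (@Im_le_cabs R)).
pose l : R[i] := (limn (series (fun k => complex.Re (z k))) +i*
  limn (series (fun k => complex.Im (z k))))%C.
have ll : rtends ((fun n => \sum_(k < n) z k) : nat -> R[i]^o) (l : R[i]^o).
  move=> e e0; have e20 : 0 < e / 2 by rewrite divr_gt0.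
  move/cvgrPdist_lt : cR => /(_ _ e20)[N1 _ N1P].
  move/cvgrPdist_lt : cI => /(_ _ e20)[N2 _ N2P].
  exists (maxn N1 N2) => n; rewrite geq_max => /andP[/N1P h1 /N2P h2].
  rewrite rnormC; apply: (le_lt_trans (cabs_le_ReIm (l - \sum_(k < n) z k))).
  rewrite ReD ImD ReN ImN Re_sum Im_sum [ltRHS](splitr e).
  have sE (p : R[i] -> R) : \sum_(k < n) p (z k) = series (fun k => p (z k)) n.
    by rewrite seriesEord.
  by rewrite (sE (@complex.Re R)) (sE (@complex.Im R)); exact: ltrD.
exists l; first exact/rtends_cvg.
apply: (rtends_le _ ll) => n; apply: le_trans (zB n).
elim: n => [|n IH]; first by rewrite !big_ord0 rnorm0.
by rewrite !big_ord_recr /=; apply: le_trans (rnormD _ _) _; exact: lerD.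
Qed.

Lemma rtends_lin (V : normedModType R[i]) (k : R[i]) (u v : nat -> V) (x y : V) :
  rtends u x -> rtends v y -> rtends (fun n => k *: u n + v n) (k *: x + y).
Proof.
move=> /rtends_cvg ux /rtends_cvg vy; apply/rtends_cvg; apply: cvgD => //.
exact: cvgZl_tmp.
Qed.

Lemma rtends_ext (V : normedModType R[i]) (u v : nat -> V) (l : V) :
  (forall n, u n = v n) -> rtends v l -> rtends u l.
Proof. by move=> /funext ->. Qed.

End complex_series.

Section bounded_operators.
Context (R : realType) (V : lmodType R[i]) (ip : V -> V -> R[i]).
Hypothesis ipV : inner_product ip.
Local Notation nrm := (ipnorm ip).
Local Notation bop := (bounded_op ip).
Implicit Types (T : V -> V) (k : R[i]).

Lemma bounded_opP T : bop T ->
  exists c : R, 0 <= c /\ forall x, nrm (T x) <= c * nrm x.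
Proof.
move=> [_ [C TC]]; exists `|C|; split=> // x; apply: le_trans (TC x) _.
by rewrite ler_wpM2r ?ipnorm_ge0 // ler_norm.
Qed.

Lemma bounded_op_lin k T T' : bop T -> bop T' -> bop (k *: T + T').
Proof.
move=> bT bT'; have [[c [c0 Tc]] [c' [c'0 Tc']]] := (bounded_opP bT, bounded_opP bT').
have [[lT _] [lT' _]] := (bT, bT'); split=> [j x y|].
  rewrite -[LHS]/(k *: T (j *: x + y) + T' (j *: x + y)) lT lT'.
  rewrite -[RHS]/(j *: (k *: T x + T' x) + (k *: T y + T' y)).
  by rewrite !scalerDr !scalerA (mulrC k j) addrACA.
exists (cabs k * c + c') => x.
apply: le_trans (ipnormD ipV (k *: T x) (T' x)) _; rewrite mulrDl ipnormZ // -mulrA.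
by apply: lerD => //; rewrite ler_wpM2l ?cabs_ge0.
Qed.

Lemma bounded_op0 : bop 0.
Proof.
split=> [k x y|]; first by rewrite scaler0 addr0.
by exists 0 => x; rewrite mul0r -[X in ipnorm _ X]/(0 : V) ipnorm0.
Qed.

Lemma bounded_opB T T' : bop T -> bop T' -> bop (T - T').
Proof. by move=> bT bT'; rewrite addrC -scaleN1r; exact: bounded_op_lin. Qed.

End bounded_operators.

(** * Normal functionals *)

Section normal_functionals.
Context (R : realType) (V : lmodType R[i]) (ip : V -> V -> R[i]).
Hypothesis ipV : inner_product ip.
Local Notation nrm := (ipnorm ip).
Local Notation bop := (bounded_op ip).
Local Notation idx := (predual_index ip).
Local Notation om := (@normal_functional R V ip).
Implicit Types (T : V -> V) (p q : idx) (x y : V) (k : R[i]).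

Lemma square_summableP (u : nat -> V) : square_summable ip u <->
  exists B : R, forall n, \sum_(k < n) nrm (u k) ^+ 2 <= B.
Proof.
have u0 (i : nat) : (0 <= (nrm (u i) ^+ 2)%:E)%E.
  by rewrite lee_fin sqr_ge0.
split=> [uS|[B uB]].
  have fS : (\sum_(0 <= n <oo) (nrm (u n) ^+ 2)%:E)%E \is a fin_num.
    by rewrite ge0_fin_numE // nneseries_ge0 // => i *; exact: u0.
  exists (fine (\sum_(0 <= n <oo) (nrm (u n) ^+ 2)%:E)%E) => n.
  rewrite -lee_fin fineK // -sumEFin -(big_mkord xpredT (fun i => (nrm (u i) ^+ 2)%:E)).
  by apply: nneseries_lim_ge => i *; exact: u0.
rewrite /square_summable; apply: (@le_lt_trans _ _ B%:E); last exact: ltry.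
apply: lime_le; first by apply: is_cvg_nneseries => i *; exact: u0.
by apply: nearW => n; rewrite big_mkord sumEFin lee_fin.
Qed.

(** A bound on these partial sums plays the role of the norm of the functional. It comes from
    [a b <= a^2 + b^2] and square summability. *)
Lemma predual_bound p : exists D : R, 0 <= D /\
  forall n, \sum_(k < n) nrm ((sval p).1 k) * nrm ((sval p).2 k) <= D.
Proof.
case: p => -[xi eta] /= [/square_summableP[B1 B1P] /square_summableP[B2 B2P]].
exists (B1 + B2); split=> [|n].
  by have := B1P 0%N; have := B2P 0%N; rewrite !big_ord0 => h2 h1; exact: addr_ge0.
apply: le_trans (lerD (B1P n) (B2P n)); rewrite -big_split /=; apply: ler_sum => k _.
have := ipnorm_ge0 ip (xi k); have := ipnorm_ge0 ip (eta k).
by move: (nrm _) (nrm _) => a b; nra.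
Qed.

Lemma normal_cvg_bound p T (c : R) : 0 <= c -> (forall x, nrm (T x) <= c * nrm x) ->
  ((fun n => \sum_(k < n) ip (T ((sval p).1 k)) ((sval p).2 k)) : nat -> R[i]^o)
    @ \oo --> (om p T : R[i]^o) /\
  forall D : R, (forall n, \sum_(k < n) nrm ((sval p).1 k) * nrm ((sval p).2 k) <= D) ->
    cabs (om p T) <= c * D.
Proof.
move=> c0 Tc.
have h (D : R) : (forall n, \sum_(k < n) nrm ((sval p).1 k) * nrm ((sval p).2 k) <= D) ->
    forall n, \sum_(k < n) cabs (ip (T ((sval p).1 k)) ((sval p).2 k)) <= c * D.
  move=> DP n; apply: le_trans (ler_wpM2l c0 (DP n)); rewrite mulr_sumr.
  apply: ler_sum => k _; apply: le_trans (Cauchy_Schwarz ipV _ _) _.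
  by rewrite mulrA ler_wpM2r ?ipnorm_ge0.
have omE (l : R[i]) : ((fun n => \sum_(k < n) ip (T ((sval p).1 k)) ((sval p).2 k))
    : nat -> R[i]^o) @ \oo --> (l : R[i]^o) -> om p T = l.
  by move/cvg_lim; apply; exact: norm_hausdorff.
pose z n := ip (T ((sval p).1 n)) ((sval p).2 n).
split=> [|D /h zD].
  have [D [_ /h zD]] := predual_bound p.
  by have [l lc _] := abs_summable_cvg (z := z) zD; rewrite (omE _ lc).
by have [l /omE -> lD] := abs_summable_cvg (z := z) zD.
Qed.

Lemma normal_cvg p T : bop T ->
  ((fun n => \sum_(k < n) ip (T ((sval p).1 k)) ((sval p).2 k)) : nat -> R[i]^o)
    @ \oo --> (om p T : R[i]^o).
Proof. by move=> /bounded_opP[c [c0 Tc]]; have [] := normal_cvg_bound p c0 Tc. Qed.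

Lemma normal_bound p : exists D : R, 0 <= D /\ forall T (c : R), 0 <= c ->
  (forall x, nrm (T x) <= c * nrm x) -> cabs (om p T) <= c * D.
Proof.
have [D [D0 DP]] := predual_bound p; exists D; split=> // T c c0 Tc.
by have [_] := normal_cvg_bound p c0 Tc; exact.
Qed.

Lemma normal_lim p T (l : R[i]) : ((fun n => \sum_(k < n) ip (T ((sval p).1 k)) ((sval p).2 k))
    : nat -> R[i]^o) @ \oo --> (l : R[i]^o) -> om p T = l.
Proof. by move/cvg_lim; apply; exact: norm_hausdorff. Qed.

(** [normal_functional] is a [limn], whose value is meaningful when the series converges;
    boundedness of the operators ensures this. *)
Lemma normal_lin p k T T' : bop T -> bop T' ->
  om p (k *: T + T') = k * om p T + om p T'.
Proof.
move=> bT bT'; apply: normal_lim.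
have /rtends_cvg cp := @normal_cvg p _ bT; have /rtends_cvg cq := @normal_cvg p _ bT'.
have c1 := rtends_lin k cp cq.
apply/rtends_cvg; apply: rtends_ext c1 => n; rewrite -[RHS]/(k * _ + _) mulr_sumr -big_split; apply: eq_bigr => i _ /=.
by rewrite -(ipPl ipV).
Qed.

Lemma normal0 p : om p 0 = 0.
Proof.
apply: normal_lim; rewrite (_ : (fun n => _) = fun=> 0); first exact: cvg_cst.
by apply/funext => n; rewrite big1 // => k _; exact: (ip0l ipV).
Qed.

Lemma normalZ p k T : bop T -> om p (k *: T) = k * om p T.
Proof.
by move=> bT; rewrite -[k *: T]addr0 normal_lin ?normal0 ?addr0 //; exact: bounded_op0.
Qed.

Lemma normalB p T T' : bop T -> bop T' -> om p (T - T') = om p T - om p T'.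
Proof. by move=> bT bT'; rewrite addrC -scaleN1r normal_lin // mulN1r addrC. Qed.

Lemma predual_rank_one x y : exists p, (forall T, om p T = ip (T x) y) /\
  forall n, \sum_(k < n) nrm ((sval p).1 k) * nrm ((sval p).2 k) <= nrm x * nrm y.
Proof.
pose e (v : V) (n : nat) : V := if n is 0%N then v else 0.
have eS v : square_summable ip (e v).
  apply/square_summableP; exists (nrm v ^+ 2) => -[|n]; first by rewrite big_ord0 sqr_ge0.
  by rewrite big_ord_recl big1 ?addr0 // => i _; rewrite /= (ipnorm0 ipV) expr0n.
exists (exist _ (e x, e y) (conj (eS x) (eS y))); split=> [T|[|n]] /=.
- apply: normal_lim; apply/rtends_cvg => d d0; exists 1%N => -[//|n] _ /=.
  by rewrite big_ord_recl big1 ?addr0 ?subrr ?rnorm0 // => i _; rewrite /= (ip0r ipV).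
- by rewrite big_ord0 mulr_ge0 ?ipnorm_ge0.
- by rewrite big_ord_recl big1 ?addr0 // => i _; rewrite /= (ipnorm0 ipV) mul0r.
Qed.

Lemma sum_interleave (W : zmodType) (f g : nat -> W) n :
  \sum_(i < n.*2) (if odd i then g i./2 else f i./2) = \sum_(i < n) f i + \sum_(i < n) g i.
Proof.
elim: n => [|n IH]; first by rewrite !big_ord0 addr0.
rewrite doubleS !big_ord_recr /= IH odd_double /= uphalf_double doubleK.
by rewrite -!addrA; congr (_ + _); rewrite addrCA.
Qed.

Lemma square_summable_interleave (u v : nat -> V) :
  square_summable ip u -> square_summable ip v ->
  square_summable ip (fun i => if odd i then v i./2 else u i./2).
Proof.
move=> /square_summableP[B uB] /square_summableP[C vC]; apply/square_summableP.
exists (B + C) => n; apply: le_trans (lerD (uB n) (vC n)).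
pose w i := nrm (if odd i then v i./2 else u i./2) ^+ 2.
rewrite -(sum_interleave (fun i => nrm (u i) ^+ 2) (fun i => nrm (v i) ^+ 2)).
rewrite (_ : \sum_(i < n.*2) _ = \sum_(i < n.*2) w i); last first.
  by apply: eq_bigr => i _; rewrite /w; case: ifP.
rewrite -!(big_mkord xpredT w) [leRHS](@big_cat_nat _ _ _ n) //=; last by rewrite -addnn leq_addr.
by rewrite lerDl; apply: sumr_ge0 => i _; exact: sqr_ge0.
Qed.

(** The sequences of [p] and [q] are interleaved, with [k] absorbed into the vectors of [p]. The
    partial sums of even length are those of the combination, and the full series is already known
    to converge. *)
Lemma predual_comb k p q : exists r, forall T, bop T -> om r T = k * om p T + om q T.
Proof.
case: p => -[xi eta] /= pS; case: q => -[xi' eta'] /= qS.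
have kxi : square_summable ip (fun i => k *: xi i).
  have /square_summableP[B xB] := pS.1; apply/square_summableP.
  exists (cabs k ^+ 2 * B) => n; apply: le_trans (ler_wpM2l (sqr_ge0 _) (xB n)).
  by rewrite mulr_sumr; apply: ler_sum => i _; rewrite ipnormZ // exprMn.
exists (exist _ (_, _) (conj (square_summable_interleave kxi qS.1)
  (square_summable_interleave pS.2 qS.2))) => T bT.
set r := exist _ _ _; set p := exist _ _ _; set q := exist _ _ _.
have cr := @normal_cvg r _ bT.
have /rtends_cvg cp := @normal_cvg p _ bT; have /rtends_cvg cq := @normal_cvg q _ bT.
have c1 := rtends_lin k cp cq.
have c2 : ((fun n => \sum_(i < n.*2) ip (T ((sval r).1 i)) ((sval r).2 i)) : nat -> R[i]^o)
    @ \oo --> (om r T : R[i]^o).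
  move/rtends_cvg : cr => cr; apply/rtends_cvg => e /cr[N NP].
  by exists N => n Nn; apply: NP; rewrite -addnn (leq_trans Nn) ?leq_addr.
have h := @norm_hausdorff _ R[i]^o.
rewrite -(cvg_lim h c2); apply: (cvg_lim h).
apply/rtends_cvg; apply: rtends_ext c1 => n.
transitivity (\sum_(i < n) k * ip (T (xi i)) (eta i) + \sum_(i < n) ip (T (xi' i)) (eta' i)).
  2: by rewrite -mulr_sumr.
rewrite -(sum_interleave (fun i => k * ip (T (xi i)) (eta i)) (fun i => ip (T (xi' i)) (eta' i))).
apply: eq_bigr => i _ /=; case: ifP => // _; rewrite -(ipZl ipV); congr ip.
by have [lT _] := bT; rewrite (linear_homog lT).
Qed.

Lemma square_summable_shift (u : nat -> V) N :
  square_summable ip u -> square_summable ip (fun j => u (N + j)%N).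
Proof.
move=> /square_summableP[B uB]; apply/square_summableP; exists B => n.
apply: le_trans (uB (N + n)%N); rewrite big_split_ord /= lerDr.
by apply: sumr_ge0 => i _; exact: sqr_ge0.
Qed.

(** Up to a tail that is small uniformly on bounded sets of operators, a normal functional is a
    finite sum of rank one functionals; continuity and extension questions thereby reduce to
    [<T x, y>]. *)
Lemma normal_tail p (e : R) : 0 < e -> exists N q,
  (forall T, bop T ->
    om p T = \sum_(k < N) ip (T ((sval p).1 k)) ((sval p).2 k) + om q T) /\
  forall n, \sum_(k < n) nrm ((sval q).1 k) * nrm ((sval q).2 k) <= e.
Proof.
move=> e0; pose z (j : nat) := nrm ((sval p).1 j) * nrm ((sval p).2 j).
have z0 j : 0 <= z j by rewrite mulr_ge0 ?ipnorm_ge0.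
have [D [D0 DP]] := predual_bound p.
have : cvgn (series z).
  apply: nondecreasing_is_cvgn; first by apply: nondecreasing_series => j _ _; exact: z0.
  by exists D => _ [n _ <-]; rewrite seriesEord; exact: DP.
move=> /cvgrPdist_lt/(_ _ (divr_gt0 e0 (ltr0n R 2)))[N _ NP].
have tailN n : \sum_(k < n) z (N + k)%N <= e.
  have := NP _ (leqnn N); have := NP (N + n)%N (leq_addr _ _).
  rewrite !seriesEord /= big_split_ord /= !ltr_norml.
  by move=> /andP[h1 h2] /andP[h3 h4]; lra.
exists N; move: tailN {DP NP z0}; rewrite {}/z; case: p => -[xi eta] /= [xS eS] tailN.
pose q : idx := exist _ (_, _) (conj (square_summable_shift N xS) (square_summable_shift N eS)).
exists q; split=> // T bT; set p := exist _ _ _.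
have /rtends_cvg cp := @normal_cvg p _ bT; have /rtends_cvg cq := @normal_cvg q _ bT.
apply: normal_lim; apply/rtends_cvg => d /cq[M MP]; exists (N + M)%N => n Nn.
have -> : n = (N + (n - N))%N by rewrite subnKC // (leq_trans _ Nn) ?leq_addr.
rewrite big_split_ord /= opprD addrACA subrr add0r.
by apply: MP; rewrite leq_subRL ?(leq_trans _ Nn) ?leq_addr.
Qed.

Lemma predual_zero : exists q, forall T, bop T -> om q T = 0.
Proof.
have [q [qP _]] := predual_rank_one 0 0; exists q => T _.
by rewrite qP (ip0r ipV).
Qed.

Lemma normal_separates T T' : (forall p, om p T = om p T') -> T = T'.
Proof.
move=> TT'; apply/funext => x; apply: (ip_inj ipV) => y.
by have [p [pP _]] := predual_rank_one x y; rewrite -!pP.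
Qed.

End normal_functionals.

(** * Weak* neighbourhoods, closures and continuity *)

Section weak_star_topology.
Context (R : realType) (V : lmodType R[i]) (ip : V -> V -> R[i]).
Hypothesis ipV : inner_product ip.
Local Notation nrm := (ipnorm ip).
Local Notation bop := (bounded_op ip).
Local Notation idx := (predual_index ip).
Local Notation om := (@normal_functional R V ip).
Implicit Types (T : V -> V) (p q : idx) (ps : seq idx) (M X : set (V -> V)).

Definition all_prop (I : Type) (P : I -> Prop) (s : seq I) : Prop :=
  foldr (fun i Q => P i /\ Q) True s.

Lemma all_prop_cat (I : Type) (P : I -> Prop) (s t : seq I) :
  all_prop P (s ++ t) <-> all_prop P s /\ all_prop P t.
Proof.
elim: s => [|i s IH] /=; first by split=> [|[]].
by split=> [[Pi /IH[]]|[[Pi Ps] Pt]]; [|split=> //; exact/IH].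
Qed.

Lemma all_prop_impl (I : Type) (P Q : I -> Prop) (s : seq I) :
  (forall i, P i -> Q i) -> all_prop P s -> all_prop Q s.
Proof. by move=> PQ; elim: s => [//|i s IH] /= [/PQ ? /IH]. Qed.

Definition ws_close ps (e : R) T T' : Prop :=
  all_prop (fun p => cabs (om p T - om p T') < e) ps.

(** For the direct implication, the sets containing some [ws_close] ball form a filter [F] along
    which the pairing converges in every coordinate, hence in the product; an open set of the
    initial topology is a preimage from that product. *)
Lemma nbhs_weak_starP T (U : set (V -> V)) :
  nbhs (T : weak_star ip) U <->
  exists ps (e : R), 0 < e /\ forall T', ws_close ps e T T' -> U T'.
Proof.
split=> [TU|[ps [e [e0 psU]]]].
  pose F : set_system (V -> V) := [set U | exists ps (e : R), 0 < e /\
    forall T', ws_close ps e T T' -> U T'].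
  have FF : Filter F.
    split.
    - by exists [::], 1; split.
    - move=> P Q [ps [e [e0 hP]]] [qs [d [d0 hQ]]].
      exists (ps ++ qs), (Num.min e d); split; first by rewrite lt_min e0.
      move=> T' /all_prop_cat[hp hq]; split.
        by apply: hP; apply: all_prop_impl hp => p; rewrite lt_min => /andP[].
      by apply: hQ; apply: all_prop_impl hq => p; rewrite lt_min => /andP[].
    - by move=> P Q PQ [ps [e [e0 hP]]]; exists ps, e; split=> // T' /hP /PQ.
  case: TU => _ [ [W0 oW <-] WT] WU.
  suff hF : F (@normal_pairing R V ip @^-1` W0).
    by have [ps [e [e0 h]]] := hF; exists ps, e; split=> // T' /h /WU.
  have cF : (@normal_pairing R V ip) @ F --> (normal_pairing T :
      prod_topology (fun _ : idx => R[i]^o)).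
    apply/cvg_sup => p W /= [_ [ [B oB <-] BT] BW].
    have /open_rnormP/(_ _ BT)[e e0 eB] := oB.
    by exists [:: p], e; split=> // T' [h _]; apply: BW; exact: eB.
  exact: (cF W0 (open_nbhs_nbhs (conj oW WT))).
have h p : nbhs (T : weak_star ip) [set T' | cabs (om p T - om p T') < e].
  pose B := [set z : R[i]^o | rnorm ((om p T : R[i]^o) - z) < e].
  have oB : open B := open_rnorm_ball _ _.
  have h1 := @proj_continuous {classic idx} (fun _ => R[i]^o) p (normal_pairing T).
  have h2 := h1 B (open_nbhs_nbhs (conj oB _)).
  have h3 := @initial_continuous _ _ (@normal_pairing R V ip) T _ (h2 _).
  apply: h3.
  by rewrite /B /= /proj /normal_pairing subrr rnorm0.
apply: (@filterS _ _ _ [set T' | ws_close ps e T T']).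
  exact: psU.
elim: ps {psU} => [|p ps IH]; first exact: filterT.
exact: filterI (h p) IH.
Qed.

Lemma closure_weak_starP X T : closure (X : set (weak_star ip)) T <->
  forall ps (e : R), 0 < e -> exists2 T', X T' & ws_close ps e T T'.
Proof.
split=> [cT ps e e0|h U /nbhs_weak_starP[ps [e [e0 psU]]]].
  have [|T' [XT' cl]] := cT [set T' | ws_close ps e T T'].
    by apply/nbhs_weak_starP; exists ps, e.
  by exists T'.
by have [T' XT' /psU UT'] := h ps e e0; exists T'.
Qed.

Definition op_subspace M : Prop := [/\ M 0, M `<=` bop &
  forall (k : R[i]) T T', M T -> M T' -> M (k *: T + T')].

Lemma op_subspaceZ M k T : op_subspace M -> M T -> M (k *: T).
Proof. by move=> [M0 _ ML] MT; rewrite -[k *: T]addr0; exact: ML. Qed.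

(* The last clause says that [q] is a combination of the functionals in [ps]. *)
Lemma finite_kernel ps M (phi : (V -> V) -> R[i]) : op_subspace M ->
  (forall (k : R[i]) T T', M T -> M T' -> phi (k *: T + T') = k * phi T + phi T') ->
  (forall T, M T -> all_prop (fun p => om p T = 0) ps -> phi T = 0) ->
  exists q, (forall T, M T -> phi T = om q T) /\
    forall T T', bop T -> bop T' -> all_prop (fun p => om p T = om p T') ps ->
      om q T = om q T'.
Proof.
elim: ps M => [|p ps IH] M sM philin phi0.
  have [q q0] := predual_zero ipV; exists q; split=> [T MT|T T' bT bT' _].
    by rewrite phi0 // q0 //; have [_ Mb _] := sM; exact: Mb.
  by rewrite !q0.
have [M0 Mb ML] := sM.
(* The induction is over all subspaces: it is applied to the kernel of [p] in [M], and the
   functional found there is corrected by the multiple of [p] that makes it right at one [e] with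
   [om p e <> 0]. *)
pose N := [set T | M T /\ om p T = 0].
have sN : op_subspace N.
  split; first by split=> //; exact: normal0.
  - by move=> T [/Mb].
  - move=> k T T' [MT pT] [MT' pT']; split; first exact: ML.
    by rewrite (normal_lin ipV) ?pT ?pT' ?mulr0 ?addr0 //; exact: Mb.
have [q [qN qps]] : exists q, (forall T, N T -> phi T = om q T) /\
    forall T T', bop T -> bop T' -> all_prop (fun p => om p T = om p T') ps ->
      om q T = om q T'.
  apply: IH => // [k T T' [MT _] [MT' _]|T [MT pT] hT]; first exact: philin.
  exact: phi0.
have [pM|/existsNP[e /not_implyP[Me /eqP pe]]] := pselect (forall T, M T -> om p T = 0).
  exists q; split=> [T MT|T T' bT bT' [_]]; last exact: qps.
  by apply: qN; split=> //; exact: pM.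
have [r rP] := predual_comb ipV ((phi e - om q e) / om p e) p q.
exists r; split=> [T MT|T T' bT bT' [pT psT]]; last by rewrite !rP // pT (qps T T').
have bT := Mb _ MT; have be := Mb _ Me.
pose k := om p T / om p e.
have NT : N (- k *: e + T).
  split; first exact: ML.
  by rewrite (normal_lin ipV) // /k mulNr divfK // addNr.
have := qN _ NT; rewrite philin // (normal_lin ipV) // rP // => h.
have -> : phi T = k * phi e + (- k * om q e + om q T) by rewrite -h mulNr addrA addrN add0r.
by rewrite /k; field.
Qed.

(** To add [p] to the list: if some [e] in [X] is killed by [ps] but not by [p], a multiple of [e]
    corrects the value. Otherwise [p] agrees on [X] with a combination [q] of [ps]; then [p - q]
    kills [X], hence [T'], and the old solution already fits. *)
Lemma finite_interpolation ps X T' : op_subspace X -> bop T' ->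
  (forall q, (forall T, X T -> om q T = 0) -> om q T' = 0) ->
  exists2 T, X T & all_prop (fun p => om p T = om p T') ps.
Proof.
move=> sX bT' XT'; have [X0 Xb XL] := sX.
elim: ps => [|p ps [x0 Xx0 x0P]]; first by exists 0.
have [[e [Xe e0 pe]]|noe] := pselect (exists e, [/\ X e,
    all_prop (fun p => om p e = 0) ps & om p e <> 0]).
  have /eqP pe' := pe.
  pose k := (om p T' - om p x0) / om p e.
  exists (k *: e + x0); first exact: XL.
  split; first by rewrite (normal_lin ipV) ?divfK ?subrK //; exact: Xb.
  elim: ps e0 x0P {pe pe'} => [//|q ps IH] /= [e1 e2] [x1 x2]; split; last exact: IH.
  by rewrite (normal_lin ipV) ?e1 ?mulr0 ?add0r //; exact: Xb.
have [||q [qX qps]] := @finite_kernel ps X (om p) sX.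
- by move=> k T T2 XT XT2; rewrite (normal_lin ipV) //; exact: Xb.
- by move=> T XT Tps; apply: contrapT => pT; apply: noe; exists T.
have [r rP] := predual_comb ipV (-1) q p.
have : om r T' = 0.
  by apply: XT' => T XT; rewrite rP ?mulN1r ?qX ?addNr //; exact: Xb.
rewrite rP // mulN1r addrC => /eqP; rewrite subr_eq0 => /eqP pT'.
exists x0 => //; split=> //.
by rewrite pT' qX // (qps x0 T') //; exact: Xb.
Qed.

(** The nontrivial half of the bipolar theorem for subspaces: the finitely many functionals of a
    neighbourhood can be matched exactly. *)
Lemma weak_star_closure_interpolation X T : op_subspace X -> bop T ->
  (forall q, (forall T', X T' -> om q T' = 0) -> om q T = 0) -> weak_star_closure ip X T.
Proof.
move=> sX bT XT; split=> //; apply/closure_weak_starP => ps e e0.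
have [x Xx xps] := finite_interpolation ps sX bT XT; exists x => //.
by apply: all_prop_impl xps => p ->; rewrite subrr cabs0.
Qed.

Lemma weak_star_closure_subspace X : op_subspace X -> op_subspace (weak_star_closure ip X).
Proof.
move=> sX; have [X0 Xb XL] := sX.
split=> [|T []//|k T T' [bT /closure_weak_starP cT] [bT' /closure_weak_starP cT']].
  split; first exact: Xb.
  by apply: subset_closure.
split; first exact: bounded_op_lin.
apply/closure_weak_starP => ps e e0.
have d0 : 0 < e / 2 / (cabs k + 1) by rewrite !divr_gt0 // ltr_wpDl // cabs_ge0.
have [x Xx xT] := cT ps _ d0.
have [x' Xx' xT'] := cT' ps (e / 2) (divr_gt0 e0 (ltr0n R 2)).
exists (k *: x + x'); first exact: XL.
elim: ps xT xT' {cT cT'} => [//|p ps IH] /= [h hs] [h' hs']; split; last exact: IH.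
rewrite !(normal_lin ipV) //; do ?exact: Xb.
rewrite opprD addrACA -mulrBr [ltRHS](splitr e); apply: le_lt_trans (cabsD _ _) _.
apply: ltrD => //; rewrite cabsM; rewrite ltr_pdivlMr ?ltr_wpDl ?cabs_ge0 // in h.
apply: le_lt_trans h; rewrite mulrC ler_wpM2l ?cabs_ge0 //.
by rewrite lerDl.
Qed.

Lemma weak_star_closure_zero X q : (forall T, X T -> om q T = 0) ->
  forall T, weak_star_closure ip X T -> om q T = 0.
Proof.
move=> q0 T [_ /closure_weak_starP cT]; apply: cabs_eq0; apply/eqP.
rewrite eq_le cabs_ge0 andbT; apply/ler_addgt0Pr => e e0.
have [x /q0 qx [/ltW]] := cT [:: q] e e0.
by rewrite qx subr0 add0r.
Qed.

(** A continuous linear [om p o S] is bounded on a basic neighbourhood of 0, hence vanishes on the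
    common kernel of finitely many normal functionals, and [finite_kernel] makes it normal.
    Conversely the functionals of a neighbourhood are pulled back one by one. *)
Lemma weak_star_continuousP M S : op_subspace M -> linear_on M S ->
  (forall T, M T -> bop (S T)) ->
  weak_star_continuous ip M S <->
  forall p, exists q, forall T, M T -> om p (S T) = om q T.
Proof.
move=> sM linS bS; have [M0 Mb ML] := sM.
have S0 : S 0 = 0.
  by have := linS 1 0 0 M0 M0; rewrite scaler0 scale1r addr0 -{1}[S 0]addr0 => /addrI.
have SZ k T : M T -> S (k *: T) = k *: S T.
  by move=> MT; have := linS k T 0 MT M0; rewrite S0 !addr0.
split=> [/subspace_continuousP cS p|hS].
  have h : nbhs (0 : weak_star ip)
      [set T : V -> V | M T -> cabs (om p (S 0) - om p (S T)) < 1].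
    have := cS 0 M0 [set T : V -> V | cabs (om p (S 0) - om p T) < 1].
    by apply; apply/nbhs_weak_starP; exists [:: p], 1; split=> // T [hT _].
  have /nbhs_weak_starP[ps [e [e0 psS]]] := h.
  have [||q [qM _]] := @finite_kernel ps M (om p \o S) sM; last by exists q.
  - move=> k T T' MT MT' /=; rewrite linS // (normal_lin ipV) //; exact: bS.
  - move=> T MT Tps /=; apply: cabs_eq0; apply/eqP; rewrite eq_le cabs_ge0 andbT.
    apply/ler_addgt0Pr => d d0; rewrite add0r.
    (* Operators in the common kernel may be scaled freely; the scale [1 / d] turns the bound 1 into
       [d]. *)
    pose k : R[i] := (d^-1)%:C%C.
    have MkT : M (k *: T) by exact: op_subspaceZ.
    have := psS (k *: T); rewrite /= SZ // S0 (normal0 ipV) sub0r cabsN.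
    rewrite (normalZ ipV); last exact: bS.
    rewrite cabsM cabs_real ger0_norm ?invr_ge0 ?(ltW d0) //.
    rewrite ltr_pdivrMl // mulr1 => hd; apply/ltW/hd => //.
    apply: all_prop_impl Tps => q qT.
    by rewrite (normalZ ipV) ?qT ?mulr0 ?(normal0 ipV) ?subrr ?cabs0 //; exact: Mb.
apply/subspace_continuousP => T MT U /nbhs_weak_starP[ps [e [e0 psU]]].
apply/nbhs_weak_starP.
suff hqs : exists qs, forall T', M T' -> ws_close qs e T T' -> ws_close ps e (S T) (S T').
  have [qs qsP] := hqs; exists qs, e; split=> // T' cT' MT'; apply: psU; exact: qsP.
elim: ps {psU} => [|p ps [qs qsP]]; first by exists [::].
have [q qP] := hS p; exists (q :: qs) => T' MT' [h hs]; split; last exact: qsP.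
by rewrite !qP.
Qed.

End weak_star_topology.

(** * The crossed product *)

Section integrated_forms.
Context (R : realType) (G : topologicalGroupType).
Context (mu : {measure set (borel G) -> \bar R}) (A : cstarAlgType R).
Context (H : separableHilbertType R) (alpha : G -> A -> A) (theta : A -> H -> H).
Hypotheses (haar : left_haar_measure mu) (hausG : hausdorff_space G).
Hypotheses (sepA : separable A).
Hypotheses (dynA : cstar_dynamical_system alpha) (faith : faithful_representation theta).
Local Notation K := (L2 mu H).
Local Notation ipK := (@L2_inner R G mu H).
Local Notation nrm := (ipnorm ipK).
Local Notation bop := (bounded_op ipK).
Local Notation om := (@normal_functional R K ipK).
Local Notation pil := (@pi_lambda R G mu A H alpha theta).
Local Notation coef := (@fourier_coefficient R G mu A H alpha theta).
Local Notation iform := (@is_integrated_form R G mu A H alpha theta).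
Implicit Types (f g : G -> A) (x y : K) (s t : G) (a b : A) (p q : predual_index ipK)
  (T : K -> K) (k : R[i]).
Let ipKP : inner_product ipK := L2_inner_product mu H.
Let pb a t : bop (pil a t) := pi_lambda_bounded haar dynA faith a t.

Lemma coefficient_lin p t k a b : coef p t (k *: a + b) = k * coef p t a + coef p t b.
Proof.
rewrite /fourier_coefficient -(normal_lin ipKP) //; congr normal_functional.
by apply/funext => x; exact: (pi_lambda_linl dynA faith).
Qed.

Lemma coefficientB p t a b : coef p t (a - b) = coef p t a - coef p t b.
Proof. by rewrite addrC -scaleN1r coefficient_lin mulN1r addrC. Qed.

Lemma coefficient_bound p : exists D : R, 0 <= D /\
  forall t a, cabs (coef p t a) <= rnorm a * D.
Proof.
have [D [D0 DP]] := normal_bound ipKP p; exists D; split=> // t a.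
apply: DP; [exact: rnorm_ge0|exact: (pi_lambda_norm haar dynA faith)].
Qed.

Lemma pi_lambda_inner_continuous a x y t (e : R) : 0 < e ->
  \forall s \near t, cabs (ipK (pil a s x) y - ipK (pil a t x) y) < e.
Proof.
move=> e0; pose d := e / (rnorm a * nrm y + 1).
have c0 : 0 <= rnorm a * nrm y by rewrite mulr_ge0 ?rnorm_ge0 ?ipnorm_ge0.
have d0 : 0 < d by rewrite divr_gt0 // ltr_wpDl.
apply: filterS (lambda_continuous haar hausG x t d0) => s sd.
rewrite -(ipBl ipKP); apply: le_lt_trans (Cauchy_Schwarz ipKP _ _) _.
have lp : linear (pi_theta (mu := mu) alpha theta a) := pi_linear dynA faith a.
have -> : pil a s x - pil a t x =
    pi_theta alpha theta a (lambda_theta s x - lambda_theta t x).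
  rewrite addrC -scaleN1r -lp; congr (pi_theta _ _ _ _).
  by rewrite scaleN1r addrC.
apply: (@le_lt_trans _ _ (rnorm a * nrm y * d)); last first.
  by rewrite /d mulrCA gtr_pMr // ltr_pdivrMr ?ltr_wpDl // mul1r ltrDl.
rewrite mulrAC ler_wpM2r ?ipnorm_ge0 //.
apply: le_trans (pi_norm dynA faith _ _) _.
by rewrite ler_wpM2l ?rnorm_ge0 // ltW.
Qed.

(** [nrm (pil a s x) <= rnorm a * nrm x] makes the tail of [p] small uniformly in [s], at most
    [e / 4] at [s] and at [t]; the head is a finite sum of continuous matrix coefficients and gets
    [e / 2]. *)
Lemma coefficient_near p a t (e : R) : 0 < e ->
  \forall s \near t, cabs (coef p s a - coef p t a) < e.
Proof.
move=> e0; pose d := e / 4 / (rnorm a + 1).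
have a1 : 0 < rnorm a + 1 by rewrite ltr_wpDl // rnorm_ge0.
have d0 : 0 < d by rewrite !divr_gt0.
have [N [q [pq qd]]] := normal_tail ipKP p d0.
have qle s : cabs (om q (pil a s)) <= e / 4.
  have [_ /(_ _ qd) h] := normal_cvg_bound ipKP q (rnorm_ge0 a)
    (pi_lambda_norm haar dynA faith a s).
  apply: le_trans h _; rewrite /d mulrCA ler_piMr ?divr_ge0 ?(ltW e0) //.
  by rewrite ler_pdivrMr // mul1r lerDl.
have : \forall s \near t, cabs (\sum_(k < N) (ipK (pil a s ((sval p).1 k)) ((sval p).2 k) -
    ipK (pil a t ((sval p).1 k)) ((sval p).2 k))) < e / 2.
  elim: N {pq} (e / 2) (divr_gt0 e0 (ltr0n R 2)) => [|N IH] c c0.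
    by apply: nearW => s; rewrite big_ord0 cabs0.
  have c2 : 0 < c / 2 by rewrite divr_gt0.
  have h := pi_lambda_inner_continuous a ((sval p).1 N) ((sval p).2 N) t c2.
  apply: filterS2 (IH _ c2) h => s h1 h2; rewrite big_ord_recr /= [ltRHS](splitr c).
  by apply: le_lt_trans (cabsD _ _) _; exact: ltrD.
apply: filterS => s; rewrite sumrB => h.
have E (u v w z : R[i]) : u + v - (w + z) = u - w + (v - z) by rewrite opprD addrACA.
have hE := congr2 (fun u v : R[i] => u - v) (pq _ (pb a s)) (pq _ (pb a t)).
rewrite [X in cabs X](etrans hE (E _ _ _ _)).
have h1 := qle s; have h2 := qle t.
apply: (le_lt_trans (cabsD _ _)).
have h3 := cabsD (om q (pil a s)) (- om q (pil a t)); rewrite cabsN in h3.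
have eE : e / 2 + (e / 4 + e / 4) = e by field.
rewrite -[ltRHS]eE.
exact: (ltr_leD h (le_trans h3 (lerD h1 h2))).
Qed.

(** A Caratheodory function: continuous in [s] for fixed [a], Lipschitz in [a] for fixed [s], with
    [A] separable. *)
Lemma coefficient_borel p f : borel_fun f ->
  borel_fun ((fun s => coef p s (f s)) : G -> R[i]^o).
Proof.
have [D [D0 DP]] := coefficient_bound p.
apply: (borel_caratheodory (Phi := fun s a => coef p s a : R[i]^o)) => //.
- move=> a; apply: borel_continuous => t; apply/cvg_ballP => e e0.
  have [eE {}e0] : e = (complex.Re e)%:C%C /\ 0 < complex.Re e.
    by move: e0; case: (e) => u v; rewrite ltcE /= => /andP[/eqP ->].
  rewrite eE; apply: filterS (coefficient_near p a t e0) => s h.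
  by apply/ball_rnormP; rewrite rnormC.
- move=> s; apply: (@lipschitz_rcontinuous _ _ _ _ D) => a b.
  by rewrite mulrC; have := DP s (a - b); rewrite coefficientB.
Qed.

Lemma L1_integrable f : L1 mu f -> mu.-integrable setT (fun s => (rnorm (f s))%:E).
Proof.
move=> [bf fi]; apply/integrableP; split.
  by apply/measurable_EFinP; exact: borel_rnorm.
by under eq_integral do rewrite gee0_abs ?lee_fin ?rnorm_ge0 //.
Qed.

Lemma L1_integrableM f (D : R) : L1 mu f ->
  mu.-integrable setT (fun s => (rnorm (f s) * D)%:E).
Proof.
move=> Lf; under eq_fun do rewrite mulrC EFinM.
by apply: integrableZl => //; exact: L1_integrable.
Qed.

Lemma coefficient_integrable p f : L1 mu f -> cintegrable mu (fun s => coef p s (f s)).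
Proof.
move=> Lf; have [D [D0 DP]] := coefficient_bound p.
apply: (cintegrable_dominated (h := fun s => rnorm (f s) * D)).
- exact: coefficient_borel Lf.1.
- exact: L1_integrableM.
- by move=> s; exact: DP.
Qed.

Lemma pi_lambda_inner_borel f x y : L1 mu f ->
  borel_fun ((fun s => ipK (pil (f s) s x) y) : G -> R[i]^o) /\
  cintegrable mu (fun s => ipK (pil (f s) s x) y).
Proof.
move=> Lf; have [p [pE _]] := predual_rank_one ipKP x y.
under eq_fun do rewrite -pE; split; first exact: (coefficient_borel p Lf.1).
exact: (coefficient_integrable p Lf).
Qed.

(** The weak definition of the integral covers rank one functionals; the series of [p] is exchanged
    with the integral by dominated convergence, with majorant [rnorm (f s) * D]. *)
Lemma normal_integrated p f T : L1 mu f -> iform f T ->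
  om p T = cintegral mu (fun s => coef p s (f s)).
Proof.
move=> Lf [bT Tf]; have [D [D0 DP]] := predual_bound p.
pose F n s := \sum_(k < n) ipK (pil (f s) s ((sval p).1 k)) ((sval p).2 k).
have FP n : [/\ borel_fun (F n : G -> R[i]^o), cintegrable mu (F n) &
    cintegral mu (F n) = \sum_(k < n) ipK (T ((sval p).1 k)) ((sval p).2 k)].
  (* Writing the partial sum as a single normal functional makes the measurability and integrability
     of [F n] instances of the lemmas on coefficients. *)
  have [q [qF qT]] : exists q, (forall S, bop S ->
      \sum_(k < n) ipK (S ((sval p).1 k)) ((sval p).2 k) = om q S) /\
      cintegral mu (F n) = \sum_(k < n) ipK (T ((sval p).1 k)) ((sval p).2 k).
    elim: n => [|n [q [qF qT]]].
      have [q q0] := predual_zero ipKP; exists q; split=> [S bS|].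
        by rewrite big_ord0 q0.
      rewrite big_ord0 (@eq_cintegral _ _ mu _ (fun=> 0)); last by move=> s; rewrite /F big_ord0.
      by rewrite /cintegral /Rintegral /= !integral0.
    have [p1 [p1E _]] := predual_rank_one ipKP ((sval p).1 n) ((sval p).2 n).
    have [r rE] := predual_comb ipKP 1 q p1; exists r; split=> [S bS|].
      by rewrite big_ord_recr /= rE // mul1r qF // p1E.
    rewrite big_ord_recr /= -qT Tf -[in RHS](mul1r (cintegral mu (F n))).
    rewrite -cintegral_lin; last 2 first.
    - have -> : F n = fun s => coef q s (f s) by apply/funext => s; exact: qF.
      exact: coefficient_integrable.
    - exact: (pi_lambda_inner_borel _ _ Lf).2.
    by apply: eq_cintegral => s; rewrite mul1r /F big_ord_recr.
  have -> : F n = fun s => coef q s (f s) by apply/funext => s; exact: qF.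
  split; [exact: (coefficient_borel _ Lf.1)|exact: coefficient_integrable|].
  by rewrite -qT; apply: eq_cintegral => s; exact/esym/qF.
apply: (normal_lim (ip := ipK)).
have -> : (fun n => \sum_(k < n) ipK (T ((sval p).1 k)) ((sval p).2 k)) =
    (fun n => cintegral mu (F n)).
  by apply/funext => n; have [_ _ ->] := FP n.
apply: (cintegral_dominated (g := fun s => rnorm (f s) * D)).
- by move=> n; have [] := FP n.
- exact: (coefficient_borel _ Lf.1).
- by move=> s; exact: (normal_cvg ipKP).
- exact: L1_integrableM.
- move=> n s; apply: le_trans (ler_wpM2l (rnorm_ge0 (f s)) (DP n)).
  elim: n => [|n IH]; first by rewrite /F !big_ord0 cabs0 mulr0.
  rewrite /F !big_ord_recr /= mulrDr; apply: le_trans (cabsD _ _) _; apply: lerD => //.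
  apply: le_trans (Cauchy_Schwarz ipKP _ _) _; rewrite mulrA ler_wpM2r ?ipnorm_ge0 //.
  exact: (pi_lambda_norm haar dynA faith).
Qed.

End integrated_forms.

(** * Norm closures of spaces of operators *)

Section norm_closed_subspaces.
Context (R : realType) (V : lmodType R[i]) (ip : V -> V -> R[i]).
Hypothesis ipV : inner_product ip.
Local Notation nrm := (ipnorm ip).
Local Notation bop := (bounded_op ip).
Local Notation om := (@normal_functional R V ip).
Implicit Types (T : V -> V) (X : set (V -> V)) (k : R[i]).

(** [norm_closure] uses strict inequalities, while bounds on a supremum are weak; aiming at [e / 2]
    restores strictness. *)
Lemma opnorm_lin_lt k (e : R) : 0 < e -> exists2 d : R, 0 < d & forall T T',
  linear T -> linear T' -> (opnorm ip T < d%:E)%E -> (opnorm ip T' < d%:E)%E ->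
  (opnorm ip (k *: T + T')%R < e%:E)%E.
Proof.
move=> e0; pose d := e / 2 / (cabs k + 1).
have k1 : 0 < cabs k + 1 by rewrite ltr_wpDl // cabs_ge0.
have d0 : 0 < d by rewrite !divr_gt0.
exists d => // T T' lT lT' /ltW/(opnorm_lb ipV lT) Td /ltW/(opnorm_lb ipV lT') T'd.
have le2 : (opnorm ip (k *: T + T')%R <= (e / 2)%:E)%E.
  apply: (opnorm_ub (ip := ip)); first by rewrite divr_ge0 ?(ltW e0).
  move=> x; apply: le_trans (ipnormD ipV (k *: T x) (T' x)) _; rewrite (ipnormZ ipV).
  apply: le_trans (lerD (ler_wpM2l (cabs_ge0 k) (Td x)) (T'd x)) _.
  rewrite mulrA -mulrDl -[X in _ + X]mul1r -mulrDl (mulrC _ d) /d divfK //.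
  by rewrite gt_eqF.
by apply: le_lt_trans le2 _; rewrite lte_fin ltr_pdivrMr // ltr_pMr // ltr1n.
Qed.

Lemma sub_norm_closure X : X `<=` bop -> X `<=` norm_closure ip X.
Proof.
move=> Xb T XT; split; first exact: Xb.
move=> e e0; exists T => //; rewrite subrr; apply: (@le_lt_trans _ _ 0%:E); last by rewrite lte_fin.
by apply: (opnorm_ub (ip := ip)) => // x; rewrite mul0r -[X in ipnorm _ X]/(0 : V) (ipnorm0 ipV).
Qed.

Lemma norm_closure_subspace X : op_subspace ip X -> op_subspace ip (norm_closure ip X).
Proof.
move=> [X0 Xb XL]; split=> [|T []//|k T T' [bT XT] [bT' XT']].
  exact: sub_norm_closure.
split; first exact: (bounded_op_lin ipV).
move=> e e0; have [d d0 dP] := opnorm_lin_lt k e0.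
have [S XS TS] := XT d d0; have [S' XS' TS'] := XT' d d0.
exists (k *: S + S'); first exact: XL.
have -> : k *: T + T' - (k *: S + S') = k *: (T - S) + (T' - S').
  by rewrite scalerBr opprD addrACA.
have [bS bS'] := conj (Xb _ XS) (Xb _ XS').
by apply: dP => //; [have [] := bounded_opB ipV bT bS|have [] := bounded_opB ipV bT' bS'].
Qed.

Lemma norm_closure_zero X q : X `<=` bop -> (forall T, X T -> om q T = 0) ->
  forall T, norm_closure ip X T -> om q T = 0.
Proof.
move=> Xb q0 T [bT XT]; have [D [D0 DP]] := normal_bound ipV q.
apply: cabs_eq0; apply/eqP; rewrite eq_le cabs_ge0 andbT; apply/ler_addgt0Pr => e e0.
have D1 : 0 < D + 1 by rewrite ltr_wpDl.
have d0 : 0 < e / (D + 1) by rewrite divr_gt0.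
have [S XS] := XT _ d0; have bS := Xb _ XS.
have bTS := bounded_opB ipV bT bS; have [lTS _] := bTS.
move=> /ltW/(opnorm_lb ipV lTS)/(DP _ _ (ltW d0)).
rewrite (normalB ipV) // (q0 S XS) subr0 add0r => /le_trans; apply.
by rewrite mulrAC ler_pdivrMr // ler_wpM2l ?(ltW e0) // lerDl.
Qed.

End norm_closed_subspaces.

(** * Integrated forms generate the weak* crossed product *)

Section crossed_product_operators.
Context (R : realType) (G : topologicalGroupType).
Context (mu : {measure set (borel G) -> \bar R}) (A : cstarAlgType R).
Context (H : separableHilbertType R) (alpha : G -> A -> A) (theta : A -> H -> H).
Hypotheses (haar : left_haar_measure mu) (hausG : hausdorff_space G).
Hypotheses (lcG : locally_compact [set: G]) (sepG : separable G) (sepA : separable A).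
Hypotheses (dynA : cstar_dynamical_system alpha) (faith : faithful_representation theta).
Local Notation K := (L2 mu H).
Local Notation ipK := (@L2_inner R G mu H).
Local Notation nrm := (ipnorm ipK).
Local Notation bop := (bounded_op ipK).
Local Notation om := (@normal_functional R K ipK).
Local Notation pil := (@pi_lambda R G mu A H alpha theta).
Local Notation coef := (@fourier_coefficient R G mu A H alpha theta).
Local Notation iform := (@is_integrated_form R G mu A H alpha theta).
Local Notation M := (@ws_crossed_product R G mu A H alpha theta).
Implicit Types (f g : G -> A) (x y : K) (s t : G) (a b : A) (p q : predual_index ipK)
  (T : K -> K) (k : R[i]).
Let ipKP : inner_product ipK := L2_inner_product mu H.
Let pb a t : bop (pil a t) := pi_lambda_bounded haar dynA faith a t.

Lemma L1_lin k f g : L1 mu f -> L1 mu g -> L1 mu (fun s => k *: f s + g s).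
Proof.
move=> Lf Lg.
have b : borel_fun (fun s => k *: f s + g s).
  apply: (borelD (f := fun s => k *: f s)) Lg.1 => //.
  by apply: (borel_comp (phi := fun a => k *: a)) Lf.1; exact: scaler_continuous.
split=> //.
have i2 := integrable_lin (cabs k) (L1_integrable Lf) (L1_integrable Lg).
have [_] := integrableP _ _ _ i2; apply: le_lt_trans; apply: ge0_le_integral => //.
- by move=> s _; rewrite lee_fin rnorm_ge0.
- by apply/measurable_EFinP; exact: borel_rnorm.
- by apply: measurableT_comp => //; exact: measurable_int i2.
- move=> s _; rewrite abse_EFin lee_fin; apply: le_trans (ler_norm _).
  by apply: le_trans (rnormD _ _) _; rewrite rnormZ.
Qed.

Lemma L1_indic (B : set G) a : measurable (B : set (borel G)) -> (mu B < +oo)%E ->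
  L1 mu (fun s => if `[< B s >] then a else 0).
Proof.
move=> mB muB; split; first by apply: borel_if => //; exact: borel_cst.
have := integrableZl measurableT (rnorm a) (integrable_indic_finite mB muB).
move=> /integrableP[_]; under eq_integral => s _.
  rewrite -EFinM abse_EFin ger0_norm ?mulr_ge0 ?rnorm_ge0 //.
  rewrite (_ : _ * _ = rnorm (if `[< B s >] then a else 0)); last first.
    rewrite indicE; case: asboolP => Bs; first by rewrite mem_set // mulr1.
    by rewrite memNset // mulr0 rnorm0.
  over.
by [].
Qed.

(** The integral of [<pil (f s) s x, y>] is a sesquilinear form bounded by twice the L1 norm of
    [f]. *)
Lemma integrated_form_exists f : L1 mu f -> exists T, iform f T.
Proof.
move=> Lf; pose B x y := cintegral mu (fun s => ipK (pil (f s) s x) y).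
have iB x y := (pi_lambda_inner_borel haar hausG sepA dynA faith x y Lf).2.
have [|||T [lT TC TB]] := @sesquilinear_operator _ _ _ ipKP (@L2_complete R G mu H) B
    (2 * \int[mu]_s rnorm (f s)).
- move=> k x x' y; rewrite /B -cintegral_lin //; apply: eq_cintegral => s.
  by rewrite -(ipPl ipKP) (pi_lambda_linear haar dynA faith).
- move=> k x y y'; rewrite /B -cintegral_lin //; apply: eq_cintegral => s.
  by rewrite (ipDr ipKP) (ipZr ipKP).
- move=> x y.
  have -> : 2 * \int[mu]_s rnorm (f s) * (nrm x * nrm y) =
      2 * \int[mu]_s (rnorm (f s) * (nrm x * nrm y)).
    by rewrite RintegralZr ?mulrA //; exact: L1_integrable.
  apply: cabs_cintegral_le.
  + exact: (pi_lambda_inner_borel haar hausG sepA dynA faith x y Lf).1.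
  + exact: L1_integrableM.
  + move=> s; apply: le_trans (Cauchy_Schwarz ipKP _ _) _; rewrite mulrA.
    by rewrite ler_wpM2r ?ipnorm_ge0 //; exact: (pi_lambda_norm haar dynA faith).
by exists T; split=> //; split=> //; eexists.
Qed.

Lemma integrated_forms_subspace :
  op_subspace ipK [set T | exists2 f, L1 mu f & iform f T].
Proof.
split=> [|T [f _ []]//|k T T' [f Lf [bT Tf]] [g Lg [bT' Tg]]].
  have Lf : L1 mu (fun _ : G => 0 : A).
    by have := L1_indic 0 measurable0; rewrite measure0 => /(_ (ltry _));
      under eq_fun do rewrite if_same.
  exists (fun=> 0) => //; split; first exact: (bounded_op0 ipKP).
  move=> x y; rewrite -[X in ipK X _]/(0 : K) (ip0l ipKP).
  rewrite (@eq_cintegral _ _ mu _ (fun=> 0)).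
    by rewrite /cintegral /Rintegral /= !integral0.
  move=> s; have -> : pil 0 s x = 0.
    by have := pi_lambda_linl dynA faith (-1) 0 0 s x; rewrite scaler0 addr0 scaleN1r addNr.
  by rewrite (ip0l ipKP).
exists (fun s => k *: f s + g s); first exact: L1_lin.
split; first exact: (bounded_op_lin ipKP).
move=> x y; rewrite -[X in ipK X _]/(k *: T x + T' x) (ipPl ipKP) Tf Tg.
rewrite -cintegral_lin.
- by apply: eq_cintegral => s; rewrite (pi_lambda_linl dynA faith) (ipPl ipKP).
- exact: (pi_lambda_inner_borel haar hausG sepA dynA faith x y Lf).2.
- exact: (pi_lambda_inner_borel haar hausG sepA dynA faith x y Lg).2.
Qed.

Lemma crossed_product_subspace : op_subspace ipK (@crossed_product R G mu A H alpha theta).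
Proof. exact: (norm_closure_subspace ipKP integrated_forms_subspace). Qed.

Lemma M_subspace : op_subspace ipK M.
Proof. exact: (weak_star_closure_subspace ipKP crossed_product_subspace). Qed.

(** The integral formula gives vanishing on integrated forms; it passes to the norm closure and then
    to the weak* closure because [q] is continuous for both topologies. *)
Lemma M_zero q : (forall t a, coef q t a = 0) -> forall T, M T -> om q T = 0.
Proof.
move=> q0; apply: weak_star_closure_zero; apply: (norm_closure_zero ipKP).
  by have [] := integrated_forms_subspace.
move=> T [f Lf Tf]; rewrite (normal_integrated haar hausG sepA dynA faith _ Lf Tf).
rewrite (@eq_cintegral _ _ mu _ (fun=> 0)); last by move=> s; exact: q0.
by rewrite /cintegral /Rintegral /= !integral0.
Qed.

Lemma M_eq p q : (forall t a, coef p t a = coef q t a) -> forall T, M T -> om p T = om q T.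
Proof.
move=> pq T MT; have [_ Mb _] := M_subspace.
have [r rP] := predual_comb ipKP (-1) q p.
have : om r T = 0.
  apply: M_zero MT => t a; rewrite /fourier_coefficient rP //.
  by rewrite mulN1r addrC -[X in X - _]/(coef p t a) pq subrr.
by rewrite rP ?mulN1r 1?addrC; [move/eqP; rewrite subr_eq0 => /eqP|exact: Mb].
Qed.

(* The integrated form of [a 1_V], for a small neighbourhood [V] of [t], is up to
   the factor [mu V] an average of the [pil a s] with [s] close to [t]. *)
Lemma pi_lambda_M a t : M (pil a t).
Proof.
(* It remains to see that a normal [q] vanishing on the crossed product has [coef q t a = 0]. *)
apply: (weak_star_closure_interpolation ipKP crossed_product_subspace) => // q q0.
pose c := coef q t a; rewrite -[LHS]/c.
have [U [oU Ut finU]] := haar_finite_nbhs haar hausG lcG t.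
apply: cabs_eq0; apply/eqP; rewrite eq_le cabs_ge0 andbT; apply/ler_addgt0Pr => e e0.
have e2 : 0 < e / 2 by rewrite divr_gt0.
pose V : set G := interior (U `&` [set s | cabs (coef q s a - c) < e / 2]).
have oV : open V := @open_interior _ _.
have Vt : V t.
  apply: filterI; first exact: open_nbhs_nbhs.
  exact: (coefficient_near haar hausG dynA faith q a t e2).
have VU : V `<=` U by move=> s /interior_subset[].
have mV : measurable (V : set (borel G)) := borel_openP oV.
have finV : (mu V < +oo)%E.
  by apply: le_lt_trans finU; apply: le_measure; rewrite ?inE //; exact: borel_openP.
have muV : 0 < fine (mu V).
  by rewrite fine_gt0 // finV andbT; apply: (haar_open_pos haar sepG oV); exists t.
pose f s : A := if `[< V s >] then a else 0.
have Lf : L1 mu f := L1_indic a mV finV.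
have [T Tf] := integrated_form_exists Lf.
have intf0 : cintegral mu (fun s => coef q s (f s)) = 0.
  rewrite -(normal_integrated haar hausG sepA dynA faith _ Lf Tf); apply: q0.
  by apply: sub_norm_closure => //; [have [] := integrated_forms_subspace|exists f].
pose ind (s : G) : R[i] := (\1_V s : R)%:C%C.
have iind : cintegrable mu ind.
  split; first exact: integrable_indic_finite.
  exact: integrable0.
have intind : cintegral mu ind = (fine (mu V))%:C%C.
  apply: complexP => /=; last by rewrite /Rintegral integral0.
  by rewrite /Rintegral integral_indic // setIT.
pose g (s : G) : R[i] := if `[< V s >] then coef q s a - c else 0.
have bg : borel_fun (g : G -> R[i]^o).
  apply: (borel_if (f := (fun s => coef q s a - c) : G -> R[i]^o)) => //; last exact: borel_cst.
  have := coefficient_borel haar hausG sepA dynA faith q (@borel_cst G A a).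
  apply: (borel_comp (phi := fun z : R[i]^o => z - c)).
  by apply: (@lipschitz_rcontinuous _ _ _ _ 1) => z w; rewrite mul1r opprB addrA subrK.
have gle s : cabs (g s) <= e / 2 * \1_V s.
  rewrite /g indicE; case: asboolP => Vs; last by rewrite memNset // mulr0 cabs0.
  by rewrite mem_set // mulr1 ltW //; have [] := interior_subset Vs.
have ig : mu.-integrable setT (fun s => (e / 2 * \1_V s)%:E).
  by under eq_fun do rewrite EFinM; apply: integrableZl => //; exact: integrable_indic_finite.
have c0 s : coef q s 0 = 0.
  by have := coefficientB haar dynA faith q s 0 0; rewrite subrr => ->; rewrite subrr.
(* The vanishing integral of [coef q s a] over [V] is split into the constant [c] and the deviation
   [g]. *)
have e3 : c * (fine (mu V))%:C%C + cintegral mu g = 0.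
  rewrite -intind -cintegral_lin //; last exact: (cintegrable_dominated bg ig gle).
  rewrite -intf0; apply: eq_cintegral => s; rewrite /ind /g /f indicE.
  case: asboolP => Vs; first by rewrite mem_set // mulr1 addrC subrK.
  by rewrite memNset // mulr0 add0r c0.
(* The deviation contributes at most [2 * (e / 2)] times the measure of [V], which is positive and
   cancels. *)
have := cabs_cintegral_le bg ig gle.
have -> : cintegral mu g = - (c * (fine (mu V))%:C%C) by apply/eqP; rewrite -addr_eq0 addrC e3.
rewrite cabsN cabsM cabs_real (ger0_norm (ltW muV)) RintegralZl //; last first.
  exact: integrable_indic_finite.
have -> : \int[mu]_s (\1_V s : R) = fine (mu V) by rewrite /Rintegral integral_indic // setIT.
by rewrite mulrA ler_pM2r // mulrC divfK ?add0r // pnatr_eq0.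
Qed.

End crossed_product_operators.

(** * Multipliers *)

Section multipliers.
Context (R : realType) (G : topologicalGroupType).
Context (mu : {measure set (borel G) -> \bar R}) (A : cstarAlgType R).
Context (H : separableHilbertType R) (alpha : G -> A -> A) (theta : A -> H -> H).
Hypotheses (haar : left_haar_measure mu) (hausG : hausdorff_space G).
Hypotheses (lcG : locally_compact [set: G]) (sepG : separable G) (sepA : separable A).
Hypotheses (dynA : cstar_dynamical_system alpha) (faith : faithful_representation theta).
Local Notation K := (L2 mu H).
Local Notation ipK := (@L2_inner R G mu H).
Local Notation nrm := (ipnorm ipK).
Local Notation bop := (bounded_op ipK).
Local Notation om := (@normal_functional R K ipK).
Local Notation pil := (@pi_lambda R G mu A H alpha theta).
Local Notation coef := (@fourier_coefficient R G mu A H alpha theta).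
Local Notation M := (@ws_crossed_product R G mu A H alpha theta).
Local Notation FS := (@fourier_space R G mu A H alpha theta).
Local Notation ff := (@fourier_functional R G mu A H alpha theta).
Local Notation fnorm := (@fourier_norm R G mu A H alpha theta).
Local Notation Mcb := (@Mcb_norm R G mu A H alpha theta).
Local Notation adj := (@fourier_adjoint R G mu A H alpha theta).
Implicit Types (F : G -> A -> A) (x y : K) (s t : G) (a b : A) (p q r : predual_index ipK)
  (T : K -> K) (k : R[i]) (S : (K -> K) -> K -> K) (u : G -> A -> R[i]).
Let ipKP : inner_product ipK := L2_inner_product mu H.
Let pb a t : bop (pil a t) := pi_lambda_bounded haar dynA faith a t.
Let subM : op_subspace ipK M := M_subspace haar hausG sepA dynA faith.
Let Mb T (MT : M T) : bop T := let: And3 _ h _ := subM in h T MT.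
Let Mpil a t : M (pil a t) := pi_lambda_M haar hausG lcG sepG sepA dynA faith a t.
Let omE p q : (forall t a, coef p t a = coef q t a) -> forall T, M T -> om p T = om q T.
Proof. exact: M_eq. Qed.

(** The chosen functional may differ from [om p], but it has the same coefficient, and [M_eq] makes
    the two agree on [M]. *)
Lemma fourier_functionalE p T : M T -> ff (coef p) T = om p T.
Proof.
move=> MT; rewrite /fourier_functional; case: xgetP => [_ _ [q /= qp <-]|/(_ (om p))[]].
  by apply: (omE _ MT) => t a; rewrite qp.
by exists p.
Qed.

Lemma fourier_norm_ub p (c : R) :
  (forall T, M T -> (opnorm ipK T <= 1)%E -> cabs (om p T) <= c) ->
  (fnorm (coef p) <= c%:E)%E.
Proof.
move=> h; apply: ge_ereal_sup => _ [T [MT T1] <-].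
by rewrite fourier_functionalE // lee_fin; exact: h.
Qed.

Lemma fourier_norm_predual_bound p (D : R) :
  (forall n, \sum_(j < n) nrm ((sval p).1 j) * nrm ((sval p).2 j) <= D) ->
  (fnorm (coef p) <= D%:E)%E.
Proof.
move=> pD; apply: fourier_norm_ub => T MT T1; have [lT _] := Mb MT.
have [_ /(_ _ pD)] := normal_cvg_bound ipKP p ler01 (opnorm_lb ipKP lT T1).
by rewrite mul1r.
Qed.

Lemma fourier_norm_lb p T (c e : R) : M T -> 0 < c -> (forall x, nrm (T x) <= c * nrm x) ->
  (fnorm (coef p) <= e%:E)%E -> cabs (om p T) <= e * c.
Proof.
move=> MT c0 Tc pe; pose T1 := (c^-1)%:C%C *: T.
have MT1 : M T1 by exact: (op_subspaceZ _ subM).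
have T1le : (opnorm ipK T1 <= 1)%E.
  apply: (opnorm_ub (ip := ipK)) => // x.
  rewrite -[X in ipnorm _ X]/((c^-1)%:C%C *: T x) (ipnormZ ipKP) cabs_real.
  by rewrite ger0_norm ?invr_ge0 ?(ltW c0) // mul1r ler_pdivrMl.
have : ((cabs (om p T1))%:E <= e%:E)%E.
  by apply: le_trans pe; apply: ereal_sup_ubound; exists T1 => //; rewrite fourier_functionalE.
rewrite lee_fin (normalZ ipKP) ?cabsM ?cabs_real; last exact: Mb.
by rewrite ger0_norm ?invr_ge0 ?(ltW c0) // ler_pdivrMl // mulrC.
Qed.

Lemma fourier_norm_fin p : exists2 e : R, 0 <= e & fnorm (coef p) = e%:E.
Proof.
have [D [_ /fourier_norm_predual_bound h]] := predual_bound p.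
have h0 : (0 <= fnorm (coef p))%E.
  have [M0 _ _] := subM.
  apply: (@le_trans _ _ (cabs (ff (coef p) 0))%:E); first by rewrite lee_fin cabs_ge0.
  apply: ereal_sup_ubound; exists 0 => //; split=> //.
  by apply: (opnorm_ub (ip := ipK)) => // x; rewrite mul1r (ipnorm0 ipKP) ipnorm_ge0.
case: (fnorm _) h h0 => [e _|//|//]; first by rewrite lee_fin; exists e.
Qed.

Lemma Mcb_norm_ext S S' : (forall T, M T -> S T = S' T) -> Mcb S = Mcb S'.
Proof.
move=> SS'.
have SE n (x : 'I_n -> 'I_n -> K -> K) : (forall i j, M (x i j)) ->
    (fun i j => S (x i j)) = (fun i j => S' (x i j)).
  by move=> Mx; apply/funext => i; apply/funext => j; exact: (SS' _ (Mx i j)).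
rewrite /Mcb_norm /cb_norm; apply: (congr1 (@ereal_sup R)).
apply/seteqP; split=> z [n [x [Mx x1 zE]]]; exists n, x; split.
- exact: Mx.
- exact: x1.
- exact: (etrans zE (congr1 (mxnorm ipK (n := n)) (SE n x Mx))).
- exact: Mx.
- exact: x1.
- exact: (etrans zE (esym (congr1 (mxnorm ipK (n := n)) (SE n x Mx)))).
Qed.

Lemma completely_bounded_on_M_ext S S' : (forall T, M T -> S T = S' T) ->
  completely_bounded_on_M alpha theta S -> completely_bounded_on_M alpha theta S'.
Proof.
have [_ _ ML] := subM.
move=> SS' [MS lS cS]; split=> [T MT|k T T' MT MT'|]; first by rewrite -SS' //; exact: MS.
  by rewrite -!SS' //; [exact: lS|exact: ML].
by rewrite -(Mcb_norm_ext SS').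
Qed.

Lemma ereal_lt_pinfty_bound (z : \bar R) : (z < +oo)%E -> exists2 c : R, 0 < c & (z <= c%:E)%E.
Proof.
case: z => [c _| |_]; [|by []|by exists 1; [|rewrite leNye]].
by exists (`|c| + 1); [rewrite ltr_wpDl //|rewrite lee_fin ler_wpDr // ler_norm].
Qed.

Lemma Mcb_opnorm S (c : R) : completely_bounded_on_M alpha theta S -> 0 < c ->
  (Mcb S <= c%:E)%E -> forall T, M T -> (opnorm ipK T <= 1)%E ->
  forall x, nrm (S T x) <= c * nrm x.
Proof.
move=> [MS _ _] c0 Sc T MT T1; have [lST _] := Mb (MS T MT); have [lT _] := Mb MT.
apply: (opnorm_lb ipKP lST); apply/(opnorm_mxnorm1 ipKP lST (ltW c0)).
apply: le_trans Sc; apply: ereal_sup_ubound; exists 1%N, (fun _ _ => T); split=> //.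
exact/(opnorm_mxnorm1 ipKP lT ler01).
Qed.

(** Level [n = 1] of the cb norm. [Amxnorm] is computed through [theta], so contractivity is used to
    enter the unit ball and [faithful_bound] to return to the norm of [A]. *)
Lemma Acb_norm_bound (phi : A -> A) (c : R) : linear phi -> 0 < c ->
  (Acb_norm theta phi <= c%:E)%E -> forall a, rnorm (phi a) <= c * rnorm a.
Proof.
move=> lphi c0 phic a; have rep := faith.1.
have phiZ k b : phi (k *: b) = k *: phi b.
  have phi0 : phi 0 = 0.
    by have := lphi (-1) 0 0; rewrite scaler0 addr0 scaleN1r addNr.
  by have := lphi k b 0; rewrite !addr0 phi0 addr0.
have [a0|a0] := eqVneq (rnorm a) 0.
  have -> : phi a = 0.
    by rewrite (rnorm_eq0 a0); have := phiZ 0 0; rewrite !scale0r.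
  by rewrite rnorm0 mulr_ge0 ?rnorm_ge0 // ltW.
have {}a0 : 0 < rnorm a by rewrite lt_def a0 rnorm_ge0.
pose k : R[i] := ((rnorm a)^-1)%:C%C; pose b := k *: a.
have kn (d : A) : rnorm (k *: d) = rnorm d / rnorm a.
  by rewrite rnormZE cabs_real ger0_norm ?invr_ge0 ?rnorm_ge0 // mulrC.
have lt d : linear (theta d) by exact: rep_linear rep d.
have ipH := hilbert_inner_product H.
have b1 : (Amxnorm theta (fun _ _ : 'I_1 => b) <= 1)%E.
  apply/(opnorm_mxnorm1 ipH (lt b) ler01); apply: (opnorm_ub (ip := inner)) => // v.
  by apply: le_trans (rep_contractive rep b v) _; rewrite kn divff // gt_eqF.
have : (Amxnorm theta (fun _ _ : 'I_1 => phi b) <= c%:E)%E.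
  by apply: le_trans phic; apply: ereal_sup_ubound; exists 1%N, (fun _ _ => b).
move=> /(opnorm_mxnorm1 ipH (lt (phi b)) (ltW c0))/(opnorm_lb ipH (lt (phi b))).
by move=> /(faithful_bound faith (ltW c0)); rewrite phiZ kn ler_pdivrMr.
Qed.

(** [q] is [p o S] on [M]; its coefficient is read off at the operators [pil a t], which lie in [M]
    and are mapped by [S] as [F] prescribes. *)
Lemma normal_pullback F S : herz_schur_extension alpha theta F S -> forall p, exists q,
  coef q = fourier_multiplication F (coef p) /\ forall T, M T -> om p (S T) = om q T.
Proof.
move=> [[MS lS _] wS SF] p.
have /(weak_star_continuousP ipKP subM lS (fun T MT => Mb (MS T MT)))/(_ p)[q qP] := wS.
exists q; split; last exact: qP.
apply/funext => t; apply/funext => a.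
exact: (etrans (esym (qP _ (Mpil a t))) (congr1 (om p) (SF a t))).
Qed.

(** The coefficients come from all normal functionals, which separate operators; hence the [xget] in
    [fourier_adjoint] has only one possible value. *)
Lemma fourier_adjoint_unique F T T' : M T' ->
  (forall u, FS u -> ff u T' = ff (fourier_multiplication F u) T) -> adj F T = T'.
Proof.
move=> MT' T'P; rewrite /fourier_adjoint; case: xgetP => [T1 _ [MT1 T1P]|/(_ T')[] //].
apply: (normal_separates ipKP) => p.
rewrite -(fourier_functionalE p MT1) -(fourier_functionalE p MT').
have FSp : FS (coef p) by exists p.
exact: (etrans (T1P _ FSp) (esym (T'P _ FSp))).
Qed.

Lemma fourier_adjoint_extension F S : herz_schur_extension alpha theta F S ->
  forall T, M T -> S T = adj F T.
Proof.
move=> FS' T MT; have [[MS _ _] _ _] := FS'.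
apply: esym; apply: fourier_adjoint_unique; first exact: (MS T MT).
move=> _ [p _ <-]; have [q [qE qP]] := normal_pullback FS' p; rewrite -qE.
rewrite (fourier_functionalE q MT) (fourier_functionalE p (MS T MT)).
exact: (qP T MT).
Qed.

Lemma herz_schur_cb_fourier F : herz_schur_multiplier mu alpha theta F ->
  cb_fourier_multiplier mu alpha theta F.
Proof.
move=> [cbF [C FC] [S FS']]; have [cbS _ _] := FS'; have [MS lS cS] := cbS.
have C1 : 0 < `|C| + 1 by rewrite ltr_wpDl.
have Fb t a : rnorm (F t a) <= (`|C| + 1) * rnorm a.
  apply: Acb_norm_bound => //; first exact: (cbF t).1.
  by apply: le_trans (FC t) _; rewrite lee_fin ler_wpDr ?ler_norm.
split; [|exact: cbF|
  exact: (completely_bounded_on_M_ext (fourier_adjoint_extension FS') cbS)].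
have [c c0 Sc] := ereal_lt_pinfty_bound cS.
split=> [t||_ [p _ <-]|].
- by split; [exact: (cbF t).1|exists (`|C| + 1)].
- by exists (`|C| + 1).
- by have [q [qE _]] := normal_pullback FS' p; rewrite -qE; exists q.
(* On [M] the functional of the product is [p o S], so level one of the cb norm of [S] bounds
   [s_F]. *)
exists c => _ [p _ <-]; have [q [<- qP]] := normal_pullback FS' p.
have [e e0 pe] := fourier_norm_fin p; rewrite pe -EFinM; apply: fourier_norm_ub => T MT T1.
rewrite -(qP T MT) mulrC.
apply: (fourier_norm_lb (MS T MT) c0); last by rewrite pe.
exact: (Mcb_opnorm cbS c0 Sc MT T1).
Qed.

(* The rank one functionals turn the bounded functional [p |-> om (kappa p) T] on
   the predual into a bounded sesquilinear form, hence into an operator; it lies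
   in [M] because it kills every [q] vanishing on the crossed product. *)
Lemma fourier_adjoint_exists F T : fourier_multiplier mu alpha theta F -> M T ->
  M (adj F T) /\ forall u, FS u -> ff u (adj F T) = ff (fourier_multiplication F u) T.
Proof.
move=> [_ _ Fst [C0 FC0]] MT.
suff [T' [MT' T'P]] : exists T', M T' /\
    forall u, FS u -> ff u T' = ff (fourier_multiplication F u) T.
  by rewrite (fourier_adjoint_unique MT' T'P).
pose C := `|C0| + 1; have Cp : 0 < C by rewrite ltr_wpDl.
have [c [c0 Tc]] := bounded_opP (Mb MT).
pose d := c + 1; have d0 : 0 < d by rewrite ltr_wpDl.
have Td x : nrm (T x) <= d * nrm x.
  by apply: le_trans (Tc x) _; rewrite ler_wpM2r ?ipnorm_ge0 // lerDl.
(* [kappa] is an arbitrary choice and need not be linear. [Phi], however, depends only on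
   coefficients, since [T] lies in [M]; this is what [Philin] exploits. *)
have /choice[kappa kP] : forall p, exists q, coef q = fourier_multiplication F (coef p).
  by move=> p; have [|q _ qP] := Fst (coef p); [exists p|exists q].
pose Phi p := om (kappa p) T.
have Philin k p q r : (forall t a, coef r t a = k * coef p t a + coef q t a) ->
    Phi r = k * Phi p + Phi q.
  move=> rP; have [r' r'P] := predual_comb ipKP k (kappa p) (kappa q).
  rewrite /Phi -r'P; last exact: Mb.
  apply: (omE _ MT) => t a.
  have E v : coef (kappa v) t a = coef v t (F t a) := congr1 (fun u => u t a) (kP v).
  have r'E := etrans (r'P _ (pb a t)) (congr2 (fun z w => k * z + w) (E p) (E q)).
  exact: (etrans (E r) (etrans (rP t (F t a)) (esym r'E))).
have Phib p (D : R) : (forall n, \sum_(j < n) nrm ((sval p).1 j) * nrm ((sval p).2 j) <= D) ->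
    cabs (Phi p) <= C * d * D.
  move=> /fourier_norm_predual_bound pD; rewrite mulrAC; apply: fourier_norm_lb => //.
  rewrite kP; apply: le_trans (FC0 _ _) _; first by exists p.
  have [e e0 pe] := fourier_norm_fin p; rewrite pe lee_fin in pD.
  rewrite pe -EFinM lee_fin; apply: le_trans (ler_wpM2l (ltW Cp) pD).
  by rewrite ler_wpM2r // /C ler_wpDr // ler_norm.
have /choice[rho rhoP] : forall z : K * K, exists p, (forall T0, om p T0 = ipK (T0 z.1) z.2) /\
    forall n, \sum_(j < n) nrm ((sval p).1 j) * nrm ((sval p).2 j) <= nrm z.1 * nrm z.2.
  by move=> z; exact: predual_rank_one.
have rhoE x y t a : coef (rho (x, y)) t a = ipK (pil a t x) y := (rhoP (x, y)).1 _.
have [|||T' [lT' T'C T'E]] := @sesquilinear_operator _ _ _ ipKP (@L2_complete R G mu H)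
    (fun x y => Phi (rho (x, y))) (C * d).
- move=> k x x' y; apply: Philin => t a; rewrite !rhoE.
  by rewrite (pi_lambda_linear haar dynA faith) (ipPl ipKP).
- move=> k x y y'; apply: Philin => t a; rewrite !rhoE.
  by rewrite (ipDr ipKP) (ipZr ipKP).
- by move=> x y; exact: (Phib _ _ (rhoP (x, y)).2).
have Cd0 : 0 <= C * d by rewrite mulr_ge0 ?(ltW Cp) ?(ltW d0).
have bT' : bop T' by split=> //; exists (C * d).
(* [T'] is built from rank one functionals only. Agreement extends to finite sums by [Philin] and to
   all [p] by a tail on which both sides are at most [e / 2]. *)
have PhiT' p : om p T' = Phi p.
  apply/eqP; rewrite -subr_eq0; apply/eqP/cabs_eq0/eqP.
  rewrite eq_le cabs_ge0 andbT; apply/ler_addgt0Pr => e e0; rewrite add0r.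
  have Cd1 : 0 < 2 * (C * d) by rewrite mulr_gt0 ?mulr_gt0.
  have [N [q [pq qe]]] := normal_tail ipKP p (divr_gt0 e0 Cd1).
  have [r [rE rPhi]] : exists r, (forall T0, bop T0 ->
      om r T0 = \sum_(j < N) ipK (T0 ((sval p).1 j)) ((sval p).2 j)) /\
      Phi r = \sum_(j < N) ipK (T' ((sval p).1 j)) ((sval p).2 j).
    elim: N {pq} => [|N [r [rE rPhi]]].
      have [z z0] := predual_zero ipKP; exists z; split=> [T0 bT0|]; rewrite big_ord0.
        exact: z0.
      have zc t a : coef z t a = 0 := z0 _ (pb a t).
      by rewrite (Philin (-1) z z z) ?mulN1r ?addNr // => t a; rewrite !zc mulr0 addr0.
    pose v := rho ((sval p).1 N, (sval p).2 N).
    have [w wP] := predual_comb ipKP 1 r v; exists w; split=> [T0 bT0|].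
      by rewrite big_ord_recr /= -(rE T0 bT0) (wP T0 bT0) mul1r (rhoP _).1.
    rewrite big_ord_recr /= -rPhi T'E (Philin 1 r v) ?mul1r // => t a.
    exact: (wP _ (pb a t)).
  have PhiE : Phi p = \sum_(j < N) ipK (T' ((sval p).1 j)) ((sval p).2 j) + Phi q.
    rewrite -rPhi -[X in X + _]mul1r; apply: Philin => t a; rewrite mul1r.
    exact: (etrans (pq _ (pb a t)) (congr1 (fun z => z + om q (pil a t)) (esym (rE _ (pb a t))))).
  have h1 : cabs (om q T') <= C * d * (e / (2 * (C * d))).
    by have [_] := normal_cvg_bound ipKP q Cd0 T'C; apply.
  have h2 := Phib _ _ qe.
  rewrite (pq _ bT') PhiE opprD addrACA subrr add0r.
  apply: le_trans (cabsD _ _) _; rewrite cabsN; apply: le_trans (lerD h1 h2) _.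
  have halves (g : R) : 0 < 2 * g -> g * (e / (2 * g)) + g * (e / (2 * g)) = e.
    by move=> g0; rewrite -mulr2n -[LHS]mulr_natl mulrA mulrCA divff ?mulr1 // gt_eqF.
  by rewrite (halves _ Cd1).
(* If [q] kills the crossed product, it kills [M] and so has zero coefficient; [Philin] with [q] in
   all places and factor -1 then gives [Phi q = 0]. *)
have MT' : M T'.
  have sX := crossed_product_subspace haar hausG sepA dynA faith.
  apply: (weak_star_closure_interpolation ipKP sX bT') => q q0.
  have qM := weak_star_closure_zero q0.
  have qc t a : coef q t a = 0 := qM _ (Mpil a t).
  by rewrite PhiT' (Philin (-1) q q q) ?mulN1r ?addNr // => t a; rewrite !qc mulr0 addr0.
exists T'; split=> // _ [p _ <-]; rewrite -kP.
exact: (etrans (fourier_functionalE p MT')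
  (etrans (PhiT' p) (esym (fourier_functionalE (kappa p) MT)))).
Qed.

(** The extension is [adj F] itself: its action on functionals is given by coefficients, which
    yields weak* continuity and, since normal functionals separate operators, its values at
    [pil a t]. *)
Lemma cb_fourier_herz_schur F : cb_fourier_multiplier mu alpha theta F ->
  herz_schur_multiplier mu alpha theta F.
Proof.
move=> [mF cbF cbS]; have [MS lS cS] := cbS.
have adjP p : exists q, coef q = fourier_multiplication F (coef p) /\
    forall T, M T -> om p (adj F T) = om q T.
  have [_ _ Fst _] := mF; have FSp : FS (coef p) by exists p.
  have [q _ qE] := Fst _ FSp; exists q; split=> [//|T MT].
  have [MT' T'P] := fourier_adjoint_exists mF MT; have h := T'P _ FSp; rewrite -qE in h.
  exact: (etrans (esym (fourier_functionalE p MT')) (etrans h (fourier_functionalE q MT))).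
have adjF a t : adj F (pil a t) = pil (F t a) t.
  apply: (normal_separates ipKP) => p; have [q [qE qP]] := adjP p.
  exact: (etrans (qP _ (Mpil a t)) (congr1 (fun u => u t a) qE)).
have [c c0 Sc] := ereal_lt_pinfty_bound cS.
split; [exact: cbF|exists c => t|exists (adj F); split=> //].
  (* A matrix over [A] in the unit ball gives a matrix of [pil (a i j) t] in the unit ball over [M];
     [adj F] maps it to one of norm at most [c], and the reverse comparison returns to [A]. The
     constant [c] is the same for all [t]. *)
  apply: ge_ereal_sup => _ [n [a [_ a1 ->]]].
  have ipH := hilbert_inner_product H.
  have lt b : linear (theta b) by exact: rep_linear faith.1 b.
  apply: (mxnorm_ub ipH) (ltW c0) _.
  apply: (mxop_pi_lambda_ge haar hausG dynA faith sepG lcG (a := fun i j => F t (a i j)) (t := t)).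
    exact: ltW.
  have -> : (fun i j => pil (F t (a i j)) t) = (fun i j => adj F (pil (a i j) t)).
    by apply/funext => i; apply/funext => j; rewrite adjF.
  apply: le_trans Sc; apply: ereal_sup_ubound; exists n, (fun i j => pil (a i j) t).
  split; [by move=> i j; exact: Mpil| |by []].
  have h := @mxop_pi_lambda_le _ _ mu _ _ alpha _ haar dynA faith n a t 1 ler01.
  exact: (h (mxnorm_lb ipH (fun i j => lt (a i j)) a1)).
apply/(weak_star_continuousP ipKP subM lS (fun T MT => Mb (MS T MT))) => p.
by have [q [_ qP]] := adjP p; exists q.
Qed.

(** Whichever extension [xget] selects, it agrees with [adj F] on [M], and [Mcb_norm] only looks
    there. *)
Lemma herz_schur_normE F : herz_schur_multiplier mu alpha theta F ->
  herz_schur_norm mu alpha theta F = cb_fourier_multiplier_norm mu alpha theta F.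
Proof.
move=> [_ _ [S FS']]; rewrite /herz_schur_norm /cb_fourier_multiplier_norm.
case: xgetP => [S0 _ S0P|/(_ S)[]//].
exact: (Mcb_norm_ext (fourier_adjoint_extension S0P)).
Qed.

End multipliers.

Theorem corollary3p5 (R : realType) (G : topologicalGroupType)
    (mu : {measure set (borel G) -> \bar R}) (A : cstarAlgType R)
    (H : separableHilbertType R) (alpha : G -> A -> A) (theta : A -> H -> H)
    (hausG : hausdorff_space G) (lcG : locally_compact [set: G])
    (scG : @second_countable G) (haar_mu : left_haar_measure mu)
    (sepA : separable A) (dynA : cstar_dynamical_system alpha)
    (faith : faithful_representation theta) :
  herz_schur_multiplier mu alpha theta =
    cb_fourier_multiplier mu alpha theta :> set (G -> A -> A) /\
  forall F : G -> A -> A, herz_schur_multiplier mu alpha theta F ->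
    herz_schur_norm mu alpha theta F =
      cb_fourier_multiplier_norm mu alpha theta F.
Proof.
have sepG := second_countable_separable scG.
split; last by move=> F; exact: herz_schur_normE.
apply/seteqP; split=> F; first exact: herz_schur_cb_fourier.
exact: cb_fourier_herz_schur.
Qed.
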